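(* Let $\varphi:\mathbb D\to\mathbb D$ be a parabolic holomorphic self-map of positive hyperbolic step, and let $\Delta\subset\mathcal Z_\forall(\varphi)$ be a non-empty set. Then the following two conditions are equivalent: (a) $\psi_1\circ\psi_2=\psi_2\circ\psi_1$ for any $\psi_1,\psi_2\in\Delta$; (b) the family $\mathcal F:=\Delta\cup\{\varphi\}$ admits simultaneous linearization.
   Context: $\mathbb D$ is the open unit disc in $\mathbb C$. For a holomorphic self-map $\varphi$ of $\mathbb D$ which is not an automorphism with a fixed point in $\mathbb D$ (and not the identity), the iterates $\varphi^{\circ n}$ converge locally uniformly to a point $\tau\in\overline{\mathbb D}$, the Denjoy–Wolff point. The map is non-elliptic if $\tau\in\partial\mathbb D$, and parabolic if moreover the angular derivative satisfies $\varphi'(\tau)=1$. A non-elliptic $\varphi$ is of positive hyperbolic step if $\lim_{n\to\infty}\rho_{\mathbb D}(\varphi^{\circ n}(z_0),\varphi^{\circ(n+1)}(z_0))>0$ for some (equivalently, every) $z_0\in\mathbb D$, where $\rho_{\mathbb D}$ is the hyperbolic distance. The centralizer $\mathcal Z_\forall(\varphi)$ is the set of all holomorphic $\psi:\mathbb D\to\mathbb D$ with $\psi\circ\varphi=\varphi\circ\psi$. (If $\varphi$ is parabolic, every element of $\mathcal Z_\forall(\varphi)$ other than the identity $\mathrm{id}_{\mathbb D}$ is known to be parabolic.) A (finite or infinite) family $\mathcal F$ of holomorphic self-maps of $\mathbb D$, each of which is non-elliptic or equal to $\mathrm{id}_{\mathbb D}$, and which contains at least one map different from $\mathrm{id}_{\mathbb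 D}$, admits simultaneous linearization if there exist a holomorphic function $h:\mathbb D\to\mathbb C$ and a map $c:\mathcal F\to\mathbb C$, not vanishing identically, such that $h\circ\psi=h+c(\psi)$ for every $\psi\in\mathcal F$. *)

(* Defs.v *)
From Stdlib Require Import Reals.
From Coquelicot Require Import Coquelicot.

Open Scope R_scope.

(** Maps on the unit disc are represented by total functions [C -> C], of which
    only the values on the disc matter; accordingly equality of maps is always
    pointwise equality on the disc. *)

Definition disc (z : C) : Prop := Cmod z < 1.

Definition holomorphic (f : C -> C) : Prop :=
  forall z, disc z -> ex_derive (K := C_AbsRing) (V := C_NormedModule) f z.

Definition self_map (f : C -> C) : Prop :=
  holomorphic f /\ forall z, disc z -> disc (f z).

Definition eq_on_disc (f g : C -> C) : Prop := forall z, disc z -> f z = g z.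

Definition compose (f g : C -> C) : C -> C := fun z => f (g z).

Definition id_disc : C -> C := fun z => z.

Definition iterate (f : C -> C) (n : nat) : C -> C := fun z => Nat.iter n f z.

Definition locally_uniformly_to (u : nat -> C -> C) (g : C -> C) : Prop :=
  forall z0, disc z0 ->
  exists delta : posreal, forall eps : posreal,
    eventually (fun n =>
      forall z, disc z -> Cmod (z - z0)%C < delta -> Cmod (u n z - g z)%C < eps).

(** Identity and elliptic automorphisms have no such point, since their
    iterates do not converge to a constant. *)
Definition Denjoy_Wolff_point (f : C -> C) (tau : C) : Prop :=
  Cmod tau <= 1 /\ locally_uniformly_to (iterate f) (fun _ => tau).

Definition non_elliptic (f : C -> C) : Prop :=
  self_map f /\ exists tau, Denjoy_Wolff_point f tau /\ Cmod tau = 1.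

Definition Stolz_region (sigma : C) (M : R) (z : C) : Prop :=
  disc z /\ Cmod (z - sigma)%C < M * (1 - Cmod z).

Definition angular_limit (f : C -> C) (sigma l : C) : Prop :=
  forall M, 1 < M ->
    filterlim f (within (Stolz_region sigma M) (locally sigma)) (locally l).

(** Angular derivative at a boundary fixed point [sigma]: the boundary value
    [f sigma] in the difference quotient is [sigma], which is the case at a
    Denjoy-Wolff point on the circle. *)
Definition angular_derivative (f : C -> C) (sigma l : C) : Prop :=
  angular_limit (fun z => (f z - sigma) / (z - sigma))%C sigma l.

Definition parabolic (f : C -> C) : Prop :=
  self_map f /\
  exists tau, Denjoy_Wolff_point f tau /\ Cmod tau = 1 /\
    angular_derivative f tau (RtoC 1).

Definition pseudo_hyperbolic_dist (z w : C) : R :=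
  Cmod ((z - w) / (1 - Cconj w * z))%C.

(** Normalised to curvature -4, i.e. the artanh of the pseudo-hyperbolic
    distance. *)
Definition hyperbolic_dist (z w : C) : R :=
  / 2 * ln ((1 + pseudo_hyperbolic_dist z w) / (1 - pseudo_hyperbolic_dist z w)).

Definition positive_hyperbolic_step (f : C -> C) : Prop :=
  exists z0, disc z0 /\
  exists l : R, 0 < l /\
    is_lim_seq (fun n => hyperbolic_dist (iterate f n z0) (iterate f (S n) z0)) l.

Definition commute_on_disc (f g : C -> C) : Prop :=
  eq_on_disc (compose f g) (compose g f).

Definition centralizer (f : C -> C) : (C -> C) -> Prop :=
  fun psi => self_map psi /\ commute_on_disc psi f.

(** Families to which the notion of simultaneous linearization applies. *)
Definition linearization_family (F : (C -> C) -> Prop) : Prop :=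
  (forall psi, F psi ->
     self_map psi /\ (non_elliptic psi \/ eq_on_disc psi id_disc)) /\
  exists psi, F psi /\ ~ eq_on_disc psi id_disc.

(** Two members of [F] agreeing on the disc automatically receive the same
    constant [c], so [c] is a function of the map of the disc. *)
Definition simultaneous_linearization (F : (C -> C) -> Prop) : Prop :=
  linearization_family F /\
  exists (h : C -> C) (c : (C -> C) -> C),
    holomorphic h /\
    (exists psi, F psi /\ c psi <> RtoC 0) /\
    forall psi, F psi ->
      eq_on_disc (compose h psi) (fun z => h z + c psi)%C.

(* Main.v *)
(** Let [tau] be the Denjoy-Wolff point and send it to infinity by a Cayley transform. Rescaling the
    half-plane by affine maps so that the [n]-th point of an orbit sits at [i], the iterates of [phi]
    become holomorphic maps [h_n] into the half-plane. Their limit [h] along an ultrafilter satisfies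
    [h o phi = h + b] with [b] real, and [b <> 0] because the hyperbolic step is positive. The same
    limit turns every [psi] in the centralizer into a self-map [G psi] of the half-plane that
    commutes with the translation by [b] and satisfies [h o psi = G psi o h]; the maps [h_n] are
    eventually injective up to [h], so [psi] is determined by [h o psi].

    The drift [g w - w] of such a map [g] is [b]-periodic with nonnegative imaginary part. Either it
    is a real constant, or [g] strictly raises imaginary parts; then the drift tends to a constant
    fast enough for [g^n w - g^n i] to stay locally bounded and to converge along an ultrafilter to an
    Abel function of [g], which linearizes every map commuting with [g]. If all [G psi] are
    translations, [h] itself linearizes the family; otherwise one uses the Abel function of some
    [G psi] composed with [h].

    Conversely, suppose that [h0] linearizes [phi], [psi1] and [psi2], where [G psi1] is not a
    translation. Near a noncritical point of [h0] and of the Abel function composed with [h], the maps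
    [h o psi1 o psi2 o psi1^n] and [h o psi2 o psi1 o psi1^n] are, up to additive constants, injective
    and close to each other for suitable [n]. Points with the same image are identified by [h0], hence
    equal, so both maps coincide. That the nontrivial elements of the centralizer are non-elliptic
    follows from Wolff's lemma, since their orbits leave every compact set. *)

From Stdlib Require Import ZArith Reals Lra Lia ClassicalEpsilon.
From Coquelicot Require Import Coquelicot.
From mathcomp Require filter.
Require Import Defs.

Set Bullet Behavior "Strict Subproofs".
Open Scope R_scope.

(** Limits along an ultrafilter take the place of normal families: one fixed ultrafilter provides
    the limits at all points and for all [psi] at once, so identities between the approximating maps
    pass to the limit without any choice of subsequences. Schwarz-Pick supplies the bounds and the
    equicontinuity. The ultrafilter is chosen so that consecutive orbit points have imaginary parts
    of ratio tending to 1; this makes [b] real, and it is where the angular derivative 1 enters. The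
    obstacle is that maps in the centralizer need not be injective, nor [h] surjective. Equality of
    [h p] and [h q] only says that some iterate of [phi] identifies [p] and [q]; a linearizer [h0]
    of [phi] shifts both by the same constant, whence [h0 p = h0 q]. Likewise, maps are first
    compared together with an iterate, which the identity theorem then removes. Quadratic rates for
    the drift have two uses: they keep its limit off the boundary of the half-plane, and, as heights
    grow linearly along orbits, they are summable, which bounds the distance between two orbits. *)

Lemma Cmod_sub_sym (a b : C) : Cmod (a - b) = Cmod (b - a).
Proof. rewrite <- Cmod_opp. f_equal. ring. Qed.

Lemma Cmod_sub_triangle (a b c : C) : Cmod (a - c) <= Cmod (a - b) + Cmod (b - c).
Proof. replace (a - c)%C with ((a - b) + (b - c))%C by ring. apply Cmod_triangle. Qed.

Lemma Cmod_sub_le (a b : C) : Cmod a <= Cmod (a - b) + Cmod b.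
Proof. replace a with ((a - b) + b)%C at 1 by ring. apply Cmod_triangle. Qed.

Lemma Cmod_minus_le (a b : C) : Cmod (a - b) <= Cmod a + Cmod b.
Proof. rewrite <- (Cmod_opp b). apply Cmod_triangle. Qed.

Lemma Cmod_sqr (z : C) : Cmod z ^ 2 = fst z ^ 2 + snd z ^ 2.
Proof. apply Cmod2_alt. Qed.

Lemma Cmod_eq_sub (a b : C) : Cmod (a - b) = 0 -> a = b.
Proof. intros H. apply Cmod_eq_0 in H. replace a with ((a - b) + b)%C by ring. rewrite H. ring. Qed.

Lemma Rabs_fst_le (z : C) : Rabs (fst z) <= Cmod z.
Proof. apply re_le_Cmod. Qed.

Lemma Rabs_snd_le (z : C) : Rabs (snd z) <= Cmod z.
Proof.
  eapply Rle_trans; [|apply Rmax_Cmod]. apply Rmax_r.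
Qed.

Lemma Cmod_le_parts (z : C) : Cmod z <= Rabs (fst z) + Rabs (snd z).
Proof.
  apply Rsqr_incr_0_var.
  - unfold Rsqr. pose proof (Cmod_sqr z) as H.
    rewrite <- (pow2_abs (fst z)), <- (pow2_abs (snd z)) in H.
    pose proof (Rabs_pos (fst z)). pose proof (Rabs_pos (snd z)). nra.
  - pose proof (Rabs_pos (fst z)). pose proof (Rabs_pos (snd z)). lra.
Qed.

Lemma Cneq_sub (a b : C) : a <> b -> 0 < Cmod (a - b).
Proof.
  intros H. destruct (Cmod_ge_0 (a - b)) as [|E]; auto.
  exfalso. apply H. apply Cmod_eq_sub. auto.
Qed.

Lemma Cmod_le_of_sqr (z : C) (r : R) : 0 <= r -> Cmod z ^ 2 <= r ^ 2 -> Cmod z <= r.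
Proof. intros Hr H. pose proof (Cmod_ge_0 z). nra. Qed.

(** * Limits along an ultrafilter *)

(** Free ultrafilters on the natural numbers: [uf_ex] expresses properness, and [uf_eventually]
    excludes the principal ones, so that ordinary limits are also limits along [U]. *)
Record ultrafilter (U : (nat -> Prop) -> Prop) : Prop := {
  uf_imp : forall P Q : nat -> Prop, (forall n, P n -> Q n) -> U P -> U Q;
  uf_and : forall P Q, U P -> U Q -> U (fun n => P n /\ Q n);
  uf_dec : forall P, U P \/ U (fun n => ~ P n);
  uf_ex : forall P, U P -> exists n, P n;
  uf_eventually : forall N, U (fun n => (N <= n)%nat)
}.

(** The decreasing sets [P k] meet every tail, so together with the tails they generate a proper
    filter, which extends to an ultrafilter. In this way a property that holds only along a
    subsequence can be built into [U]. *)
Lemma ultrafilter_exists (P : nat -> nat -> Prop) :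
  (forall k n, P (S k) n -> P k n) ->
  (forall k N, exists n, (N <= n)%nat /\ P k n) ->
  exists U, ultrafilter U /\ forall k, U (P k).
Proof.
  intros Hdec Hinf.
  assert (Hmono : forall j k n, (j <= k)%nat -> P k n -> P j n).
  { intros j k n Hjk. induction Hjk; auto. }
  pose (F := fun A : nat -> Prop => exists k N, forall n, (N <= n)%nat -> P k n -> A n).
  assert (PF : filter.ProperFilter F).
  { constructor.
    - intros (k & N & H). destruct (Hinf k N) as (n & Hn & Hp). exact (H n Hn Hp).
    - constructor.
      + exists 0%nat, 0%nat. intros n _ _. exact I.
      + intros A B (k & N & HA) (k' & N' & HB).
        exists (max k k'), (max N N'). intros n Hn Hp. split.
        * apply HA. lia. apply Hmono with (max k k'); auto; lia.
        * apply HB. lia. apply Hmono with (max k k'); auto; lia.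
      + intros A B HAB (k & N & HA). exists k, N. intros n Hn Hp. apply HAB. apply HA; auto. }
  destruct (filter.ultraFilterLemma PF) as (U & HU & HFU).
  pose proof (filter.ultra_proper (UltraFilter := HU)) as [HU0 [HUT HUI HUS]].
  exists U. split.
  - constructor.
    + intros A B HAB HA. apply (HUS A); auto.
    + intros A B HA HB. apply (HUI A B); auto.
    + intros A. exact (filter.in_ultra_setVsetC A HU).
    + intros A HA. apply NNPP. intros Hn. apply HU0.
      apply (HUS A); auto. intros n Hn'. exfalso. apply Hn. exists n. exact Hn'.
    + intros N. apply HFU. exists 0%nat, N. auto.
  - intros k. apply HFU. exists k, 0%nat. auto.
Qed.

Section Ultralimits.
Variable U : (nat -> Prop) -> Prop.
Hypothesis HU : ultrafilter U.

Definition ulim (x : nat -> C) (l : C) : Prop :=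
  forall e, 0 < e -> U (fun n => Cmod (x n - l) < e).

Definition ulimR (x : nat -> R) (l : R) : Prop :=
  forall e, 0 < e -> U (fun n => Rabs (x n - l) < e).

Lemma uf_true (P : nat -> Prop) : (forall n, P n) -> U P.
Proof. intros H. apply (uf_imp U HU (fun n => (0 <= n)%nat)). auto. apply (uf_eventually U HU). Qed.

Lemma uf_ev (P : nat -> Prop) : (exists N, forall n, (N <= n)%nat -> P n) -> U P.
Proof. intros (N & H). apply (uf_imp U HU (fun n => (N <= n)%nat)). auto. apply (uf_eventually U HU). Qed.

Lemma uf_imp2 (P Q S : nat -> Prop) : U P -> U Q -> (forall n, P n -> Q n -> S n) -> U S.
Proof.
  intros HP HQ H. apply (uf_imp U HU (fun n => P n /\ Q n)).
  - intros n [? ?]; auto.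
  - apply (uf_and U HU); auto.
Qed.

Lemma ulim_ext (x y : nat -> C) l : (forall n, x n = y n) -> ulim x l -> ulim y l.
Proof.
  intros H Hx e He. apply (uf_imp U HU) with (2 := Hx e He). intros n. rewrite H. auto.
Qed.

Lemma ulim_const c : ulim (fun _ => c) c.
Proof.
  intros e He. apply uf_true. intros _. replace (c - c)%C with (RtoC 0) by ring. rewrite Cmod_0. auto.
Qed.

Lemma ulim_unique x l l' : ulim x l -> ulim x l' -> l = l'.
Proof.
  intros H H'. apply NNPP. intros Hn. apply Cneq_sub in Hn.
  set (e := Cmod (l - l') / 2) in *. assert (He : 0 < e) by (unfold e; lra).
  destruct (uf_ex U HU _ (uf_and U HU _ _ (H e He) (H' e He))) as (n & H1 & H2).
  pose proof (Cmod_sub_triangle l (x n) l'). rewrite (Cmod_sub_sym l (x n)) in H0. unfold e in *. lra.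
Qed.

Lemma ulim_of_bound x l (y : nat -> R) :
  U (fun n => Cmod (x n - l) <= y n) -> ulimR y 0 -> ulim x l.
Proof.
  intros H Hy e He. apply (uf_imp2 _ _ _ H (Hy e He)). intros n H1 H2.
  rewrite Rminus_0_r in H2. apply Rabs_def2 in H2. lra.
Qed.

(** The limit is the supremum of the [r] with [r <= x n] for [U]-almost all [n]; as [U] decides
    every set, both one-sided estimates follow by contradiction. *)
Lemma ulimR_bound_exists (x : nat -> R) M : U (fun n => Rabs (x n) <= M) -> exists l, ulimR x l.
Proof.
  intros HM.
  pose (E := fun r => U (fun n => r <= x n)).
  destruct (completeness E) as (l & Hub & Hlub).
  - exists M. intros r Hr.
    destruct (uf_ex U HU _ (uf_and U HU _ _ HM Hr)) as (n & H1 & H2).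
    apply Rabs_le_between in H1. lra.
  - exists (- M). apply (uf_imp U HU) with (2 := HM). intros n H. apply Rabs_le_between in H. lra.
  - exists l. intros e He.
    assert (H1 : U (fun n => l - e < x n)).
    { destruct (uf_dec U HU (fun n => l - e < x n)) as [|H]; auto.
      exfalso. assert (l <= l - e); [|lra]. apply Hlub. intros r Hr.
      destruct (uf_ex U HU _ (uf_and U HU _ _ H Hr)) as (n & H1 & H2). lra. }
    assert (H2 : U (fun n => x n < l + e)).
    { destruct (uf_dec U HU (fun n => x n < l + e)) as [|H]; auto.
      exfalso. assert (l + e <= l); [|lra]. apply Hub.
      apply (uf_imp U HU) with (2 := H). intros n Hn. lra. }
    apply (uf_imp2 _ _ _ H1 H2). intros n ? ?. apply Rabs_def1; lra.
Qed.

Lemma ulim_bound_exists (x : nat -> C) M : U (fun n => Cmod (x n) <= M) -> exists l, ulim x l.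
Proof.
  intros HM.
  destruct (ulimR_bound_exists (fun n => fst (x n)) M) as (a & Ha).
  { apply (uf_imp U HU) with (2 := HM). intros n H. pose proof (Rabs_fst_le (x n)). lra. }
  destruct (ulimR_bound_exists (fun n => snd (x n)) M) as (b & Hb).
  { apply (uf_imp U HU) with (2 := HM). intros n H. pose proof (Rabs_snd_le (x n)). lra. }
  exists (a, b). intros e He.
  assert (He2 : 0 < e / 2) by lra.
  apply (uf_imp2 _ _ _ (Ha _ He2) (Hb _ He2)). intros n H1 H2.
  pose proof (Cmod_le_parts (x n - (a, b))). simpl in H.
  unfold Rminus in *. lra.
Qed.

Lemma ulimR_le (x y : nat -> R) a b :
  ulimR x a -> ulimR y b -> U (fun n => x n <= y n) -> a <= b.
Proof.
  intros Ha Hb H. apply Rnot_lt_le. intros Hlt.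
  assert (He : 0 < (a - b) / 2) by lra.
  destruct (uf_ex U HU _ (uf_and U HU _ _ H (uf_and U HU _ _ (Ha _ He) (Hb _ He)))) as (n & H1 & H2 & H3).
  apply Rabs_def2 in H2. apply Rabs_def2 in H3. lra.
Qed.

Lemma ulimR_const c : ulimR (fun _ => c) c.
Proof. intros e He. apply uf_true. intros _. rewrite Rminus_diag, Rabs_R0. auto. Qed.

Lemma ulimR_ext (x y : nat -> R) l : (forall n, x n = y n) -> ulimR x l -> ulimR y l.
Proof. intros H Hx e He. apply (uf_imp U HU) with (2 := Hx e He). intros n. rewrite H. auto. Qed.

Lemma ulimR_unique x l l' : ulimR x l -> ulimR x l' -> l = l'.
Proof.
  intros H H'. apply Rle_antisym; eapply ulimR_le; eauto; apply uf_true; intros; lra.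
Qed.

Lemma ulimR_of_lim (x : nat -> R) (l : R) : is_lim_seq x l -> ulimR x l.
Proof.
  intros H e He. apply is_lim_seq_spec in H. destruct (H (mkposreal e He)) as (N & HN).
  apply uf_ev. exists N. intros n Hn. apply HN. auto.
Qed.

Lemma ulimR_le_l (x : nat -> R) a c : ulimR x a -> U (fun n => x n <= c) -> a <= c.
Proof. intros H H'. apply (ulimR_le x (fun _ => c)); auto using ulimR_const. Qed.

Lemma ulimR_ge_l (x : nat -> R) a c : ulimR x a -> U (fun n => c <= x n) -> c <= a.
Proof. intros H H'. apply (ulimR_le (fun _ => c) x); auto using ulimR_const. Qed.

Lemma ulimR_plus x y a b : ulimR x a -> ulimR y b -> ulimR (fun n => x n + y n) (a + b).
Proof.
  intros Hx Hy e He. assert (H : 0 < e / 2) by lra.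
  apply (uf_imp2 _ _ _ (Hx _ H) (Hy _ H)). intros n H1 H2.
  apply Rabs_def2 in H1. apply Rabs_def2 in H2. apply Rabs_def1; lra.
Qed.

Lemma ulimR_mult x y a b : ulimR x a -> ulimR y b -> ulimR (fun n => x n * y n) (a * b).
Proof.
  intros Hx Hy e He.
  assert (Hb : 0 < Rabs b + 1) by (pose proof (Rabs_pos b); lra).
  assert (Ha : 0 < Rabs a + 1) by (pose proof (Rabs_pos a); lra).
  set (d := Rmin 1 (Rmin (e / (2 * (Rabs b + 1))) (e / (2 * (Rabs a + 1))))).
  assert (Hd : 0 < d).
  { unfold d. repeat apply Rmin_pos; try lra; apply Rdiv_lt_0_compat; lra. }
  assert (Hd1 : d <= 1) by apply Rmin_l.
  assert (Hd2 : d * (Rabs b + 1) <= e / 2).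
  { assert (d <= e / (2 * (Rabs b + 1))). unfold d. eapply Rle_trans. apply Rmin_r. apply Rmin_l.
    apply Rmult_le_compat_r with (r := Rabs b + 1) in H; [|lra].
    replace (e / (2 * (Rabs b + 1)) * (Rabs b + 1)) with (e / 2) in H by (field; lra). auto. }
  assert (Hd3 : d * (Rabs a + 1) <= e / 2).
  { assert (d <= e / (2 * (Rabs a + 1))). unfold d. eapply Rle_trans. apply Rmin_r. apply Rmin_r.
    apply Rmult_le_compat_r with (r := Rabs a + 1) in H; [|lra].
    replace (e / (2 * (Rabs a + 1)) * (Rabs a + 1)) with (e / 2) in H by (field; lra). auto. }
  apply (uf_imp2 _ _ _ (Hx _ Hd) (Hy _ Hd)). intros n H1 H2.
  replace (x n * y n - a * b) with ((x n - a) * (y n - b) + ((x n - a) * b + a * (y n - b))) by ring.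
  eapply Rle_lt_trans. apply Rabs_triang. eapply Rle_lt_trans. apply Rplus_le_compat_l. apply Rabs_triang.
  rewrite !Rabs_mult. pose proof (Rabs_pos (x n - a)). pose proof (Rabs_pos (y n - b)).
  pose proof (Rabs_pos a). pose proof (Rabs_pos b). nra.
Qed.

Lemma ulim_fst x l : ulim x l -> ulimR (fun n => fst (x n)) (fst l).
Proof.
  intros H e He. apply (uf_imp U HU) with (2 := H e He). intros n Hn.
  pose proof (Rabs_fst_le (x n - l)). simpl in H0. unfold Rminus in *. lra.
Qed.

Lemma ulim_snd x l : ulim x l -> ulimR (fun n => snd (x n)) (snd l).
Proof.
  intros H e He. apply (uf_imp U HU) with (2 := H e He). intros n Hn.
  pose proof (Rabs_snd_le (x n - l)). simpl in H0. unfold Rminus in *. lra.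
Qed.

Lemma ulim_Cmod_sub x l : ulim x l -> ulimR (fun n => Cmod (x n - l)) 0.
Proof.
  intros H e He. apply (uf_imp U HU) with (2 := H e He). intros n Hn.
  rewrite Rminus_0_r, Rabs_pos_eq; auto. apply Cmod_ge_0.
Qed.

Lemma ulim_Cmod x l : ulim x l -> ulimR (fun n => Cmod (x n)) (Cmod l).
Proof.
  intros H e He. apply (uf_imp U HU) with (2 := H e He). intros n Hn.
  pose proof (Cmod_sub_le (x n) l). pose proof (Cmod_sub_le l (x n)). rewrite (Cmod_sub_sym l) in H1.
  apply Rabs_def1; lra.
Qed.

Lemma ulim_plus x y a b : ulim x a -> ulim y b -> ulim (fun n => x n + y n)%C (a + b)%C.
Proof.
  intros Hx Hy. apply ulim_of_bound with (fun n => Cmod (x n - a) + Cmod (y n - b)).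
  - apply uf_true. intros n. replace (x n + y n - (a + b))%C with ((x n - a) + (y n - b))%C by ring.
    apply Cmod_triangle.
  - replace 0 with (0 + 0) by ring. apply ulimR_plus; apply ulim_Cmod_sub; auto.
Qed.

Lemma ulim_opp x a : ulim x a -> ulim (fun n => - x n)%C (- a)%C.
Proof.
  intros H e He. apply (uf_imp U HU) with (2 := H e He). intros n Hn.
  rewrite <- Cmod_opp. replace (- (- x n - - a))%C with (x n - a)%C by ring. auto.
Qed.

Lemma ulim_minus x y a b : ulim x a -> ulim y b -> ulim (fun n => x n - y n)%C (a - b)%C.
Proof. intros. apply ulim_plus; auto using ulim_opp. Qed.

Lemma ulim_mult x y a b : ulim x a -> ulim y b -> ulim (fun n => x n * y n)%C (a * b)%C.
Proof.
  intros Hx Hy.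
  apply ulim_of_bound with (fun n => Cmod (x n - a) * Cmod (y n) + Cmod a * Cmod (y n - b)).
  - apply uf_true. intros n.
    replace (x n * y n - a * b)%C with ((x n - a) * y n + a * (y n - b))%C by ring.
    eapply Rle_trans. apply Cmod_triangle. rewrite !Cmod_mult. lra.
  - replace 0 with (0 * Cmod b + Cmod a * 0) by ring. apply ulimR_plus; apply ulimR_mult;
    auto using ulim_Cmod_sub, ulim_Cmod, ulimR_const.
Qed.

Lemma ulim_real_pair (x y : nat -> R) a b : ulimR x a -> ulimR y b -> ulim (fun n => (x n, y n)) (a, b).
Proof.
  intros Hx Hy e He. assert (H : 0 < e / 2) by lra.
  apply (uf_imp2 _ _ _ (Hx _ H) (Hy _ H)). intros n H1 H2.
  pose proof (Cmod_le_parts ((x n, y n) - (a, b))). simpl in H0. unfold Rminus in *. lra.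
Qed.

Lemma ulim_Cmod_le x l M : ulim x l -> U (fun n => Cmod (x n) <= M) -> Cmod l <= M.
Proof. intros H H'. exact (ulimR_le_l _ _ _ (ulim_Cmod _ _ H) H'). Qed.

(* A bounded sequence with summable geometric increments stays close to its ultralimit, which
   replaces completeness. *)
Lemma ulim_geometric (x : nat -> C) A q :
  0 <= q < 1 -> (forall n, Cmod (x (S n) - x n) <= A * q ^ n) ->
  exists l, ulim x l /\ forall n, Cmod (x n - l) <= A / (1 - q) * q ^ n.
Proof.
  intros Hq Hx.
  assert (HA : 0 <= A).
  { pose proof (Hx 0%nat). pose proof (Cmod_ge_0 (x 1%nat - x 0%nat)). simpl in H. lra. }
  assert (Hc : forall n k, Cmod (x (n + k)%nat - x n) <= A / (1 - q) * (q ^ n - q ^ (n + k))).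
  { intros n k. induction k.
    - rewrite Nat.add_0_r. replace (x n - x n)%C with (RtoC 0) by ring. rewrite Cmod_0. right; ring.
    - rewrite Nat.add_succ_r. pose proof (Hx (n + k)%nat).
      pose proof (Cmod_sub_triangle (x (S (n + k))) (x (n + k)%nat) (x n)).
      replace (A / (1 - q) * (q ^ n - q ^ S (n + k))) with
        (A / (1 - q) * (q ^ n - q ^ (n + k)) + A * q ^ (n + k)) by (simpl; field; lra). lra. }
  assert (Hc' : forall n k, Cmod (x (n + k)%nat - x n) <= A / (1 - q) * q ^ n).
  { intros n k. pose proof (Hc n k). assert (0 <= q ^ (n + k)) by (apply pow_le; lra).
    assert (0 <= A / (1 - q)) by (apply Rdiv_le_0_compat; lra). nra. }
  destruct (ulim_bound_exists x (A / (1 - q) + Cmod (x 0%nat))) as (l & Hl).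
  { apply uf_true. intros n. pose proof (Hc' 0%nat n). simpl in H.
    pose proof (Cmod_sub_le (x n) (x 0%nat)). lra. }
  exists l. split; auto. intros n.
  rewrite Cmod_sub_sym. apply (ulim_Cmod_le (fun m => x m - x n)%C).
  - apply ulim_minus; auto using ulim_const.
  - apply uf_ev. exists n. intros m Hm. replace m with (n + (m - n))%nat by lia. apply Hc'.
Qed.

End Ultralimits.

Lemma some_ultrafilter : exists U, ultrafilter U.
Proof.
  destruct (ultrafilter_exists (fun _ _ => True)) as (U & HU & _); eauto.
Qed.

(** * Complex derivatives *)

(** An explicit form of complex differentiability, shared by two normed-module structures on [C]:
    holomorphy is stated with [C_NormedModule], whereas the product rule and the inner map of the
    chain rule use [C_AbsRing] as a module over itself. *)
Definition cder (f : C -> C) (z l : C) : Prop :=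
  forall e, 0 < e -> exists d, 0 < d /\
    forall h, Cmod h < d -> Cmod (f (z + h)%C - f z - l * h) <= e * Cmod h.

Definition ccont (f : C -> C) (z : C) : Prop :=
  forall e, 0 < e -> exists d, 0 < d /\ forall w, Cmod (w - z) < d -> Cmod (f w - f z) < e.

Lemma cder_iff f z l :
  cder f z l <-> is_derive (K := C_AbsRing) (V := C_NormedModule) f z l.
Proof.
  split.
  - intros H. split. apply is_linear_scal_l.
    intros x Hx. apply (@is_filter_lim_locally_unique C_AbsRing (AbsRing_NormedModule C_AbsRing)) in Hx.
    subst x. intros eps. destruct (H eps (cond_pos eps)) as (d & Hd & H').
    exists (mkposreal d Hd).
    change (forall y : C, Cmod (y - z) < d -> Cmod (f y - f z - (y - z) * l) <= eps * Cmod (y - z)).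
    intros y Hy. specialize (H' _ Hy).
    replace (z + (y - z))%C with y in H' by ring.
    replace (f y - f z - (y - z) * l)%C with (f y - f z - l * (y - z))%C by ring. exact H'.
  - intros [_ H] e He.
    destruct (H z (fun P HP => HP) (mkposreal e He)) as (d & Hd).
    exists d. split. apply cond_pos. intros h Hh.
    assert (Hh' : Cmod (z + h - z) < d) by (replace (z + h - z)%C with h by ring; auto).
    specialize (Hd (z + h)%C Hh').
    change (Cmod (f (z + h)%C - f z - (z + h - z) * l) <= e * Cmod (z + h - z)) in Hd.
    replace (z + h - z)%C with h in Hd by ring. rewrite (Cmult_comm l). exact Hd.
Qed.

Lemma cder_iff_AbsRing f z l :
  cder f z l <-> is_derive (K := C_AbsRing) (V := AbsRing_NormedModule C_AbsRing) f z l.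
Proof.
  split.
  - intros H. split. apply is_linear_scal_l.
    intros x Hx. apply (@is_filter_lim_locally_unique C_AbsRing (AbsRing_NormedModule C_AbsRing)) in Hx.
    subst x. intros eps. destruct (H eps (cond_pos eps)) as (d & Hd & H').
    exists (mkposreal d Hd).
    change (forall y : C, Cmod (y - z) < d -> Cmod (f y - f z - (y - z) * l) <= eps * Cmod (y - z)).
    intros y Hy. specialize (H' _ Hy).
    replace (z + (y - z))%C with y in H' by ring.
    replace (f y - f z - (y - z) * l)%C with (f y - f z - l * (y - z))%C by ring. exact H'.
  - intros [_ H] e He.
    destruct (H z (fun P HP => HP) (mkposreal e He)) as (d & Hd).
    exists d. split. apply cond_pos. intros h Hh.
    assert (Hh' : Cmod (z + h - z) < d) by (replace (z + h - z)%C with h by ring; auto).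
    specialize (Hd (z + h)%C Hh').
    change (Cmod (f (z + h)%C - f z - (z + h - z) * l) <= e * Cmod (z + h - z)) in Hd.
    replace (z + h - z)%C with h in Hd by ring. rewrite (Cmult_comm l). exact Hd.
Qed.

Lemma cder_const c z : cder (fun _ => c) z 0.
Proof. apply cder_iff. apply (is_derive_const (K := C_AbsRing) (V := C_NormedModule)). Qed.

Lemma cder_id z : cder (fun w => w) z 1.
Proof.
  intros e He. exists 1. split. lra. intros h _. replace (z + h - z - 1 * h)%C with (RtoC 0) by ring.
  rewrite Cmod_0. pose proof (Cmod_ge_0 h). nra.
Qed.

Lemma cder_plus f g z a b : cder f z a -> cder g z b -> cder (fun w => f w + g w)%C z (a + b).
Proof.
  rewrite !cder_iff. apply (is_derive_plus (K := C_AbsRing) (V := C_NormedModule)).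
Qed.

Lemma cder_mult f g z a b :
  cder f z a -> cder g z b -> cder (fun w => f w * g w)%C z (a * g z + f z * b).
Proof.
  rewrite !cder_iff_AbsRing. intros Hf Hg.
  apply (is_derive_mult (K := C_AbsRing) f g z a b Hf Hg). apply Cmult_comm.
Qed.

Lemma cder_comp f g z a b : cder f (g z) a -> cder g z b -> cder (fun w => f (g w)) z (a * b).
Proof.
  rewrite (cder_iff_AbsRing g), !cder_iff. intros Hf Hg. rewrite Cmult_comm.
  exact (is_derive_comp (K := C_AbsRing) (V := C_NormedModule) f g z a b Hf Hg).
Qed.

Lemma cder_eq f z a b : a = b -> cder f z a -> cder f z b.
Proof. intros ->. auto. Qed.

Lemma cder_scal c f z a : cder f z a -> cder (fun w => c * f w)%C z (c * a).
Proof.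
  intros H. eapply cder_eq; [|apply cder_mult; [apply cder_const|apply H]]. cbn beta; ring.
Qed.

Lemma cder_opp f z a : cder f z a -> cder (fun w => - f w)%C z (- a).
Proof.
  rewrite !cder_iff. apply (is_derive_opp (K := C_AbsRing) (V := C_NormedModule)).
Qed.

Lemma cder_minus f g z a b : cder f z a -> cder g z b -> cder (fun w => f w - g w)%C z (a - b).
Proof. intros Hf Hg. apply cder_plus; auto using cder_opp. Qed.

Lemma cder_ext f g z l d :
  0 < d -> (forall w, Cmod (w - z) < d -> f w = g w) -> cder f z l -> cder g z l.
Proof.
  intros Hd Hfg H e He. destruct (H e He) as (d' & Hd' & H').
  exists (Rmin d d'). split. apply Rmin_pos; auto. intros h Hh.
  rewrite <- !Hfg.
  - apply H'. eapply Rlt_le_trans; [apply Hh|apply Rmin_r].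
  - replace (z - z)%C with (RtoC 0) by ring. rewrite Cmod_0; auto.
  - replace (z + h - z)%C with h by ring. eapply Rlt_le_trans; [apply Hh|apply Rmin_l].
Qed.

Lemma cder_ext_all f g z l : (forall w, f w = g w) -> cder f z l -> cder g z l.
Proof. intros H. apply (cder_ext f g z l 1). lra. auto. Qed.

Lemma cder_cont f z l : cder f z l -> ccont f z.
Proof.
  intros H e He. destruct (H 1 Rlt_0_1) as (d & Hd & H').
  pose proof (Cmod_ge_0 l).
  assert (Hq : 0 < e / (Cmod l + 2)) by (apply Rdiv_lt_0_compat; lra).
  exists (Rmin d (e / (Cmod l + 2))). split. apply Rmin_pos; auto.
  intros w Hw.
  assert (H1 : Cmod (w - z) < d) by (eapply Rlt_le_trans; [apply Hw|apply Rmin_l]).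
  assert (H2 : Cmod (w - z) < e / (Cmod l + 2)) by (eapply Rlt_le_trans; [apply Hw|apply Rmin_r]).
  specialize (H' _ H1). replace (z + (w - z))%C with w in H' by ring.
  apply Rlt_div_r in H2; [|lra].
  pose proof (Cmod_sub_le (f w - f z) (l * (w - z))). rewrite Cmod_mult in H3.
  pose proof (Cmod_ge_0 (w - z)). nra.
Qed.

Lemma cder_inv (z : C) : z <> 0 -> cder (fun w => / w)%C z (- / (z * z)).
Proof.
  intros Hz e He. assert (Hm : 0 < Cmod z) by (apply Cmod_gt_0; auto).
  set (m := Cmod z) in *.
  exists (Rmin (m / 2) (e * (m * m * m) / 2)). split.
  { apply Rmin_pos. lra. assert (0 < m * m * m) by (repeat apply Rmult_lt_0_compat; auto). nra. }
  intros h Hh.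
  assert (H1 : Cmod h < m / 2) by (eapply Rlt_le_trans; [apply Hh|apply Rmin_l]).
  assert (H2 : Cmod h < e * (m * m * m) / 2) by (eapply Rlt_le_trans; [apply Hh|apply Rmin_r]).
  assert (H3 : m / 2 <= Cmod (z + h)).
  { pose proof (Cmod_sub_le z (- h)). rewrite Cmod_opp in H.
    replace (z - - h)%C with (z + h)%C in H by ring. fold m in H. lra. }
  assert (Hzh : (z + h)%C <> 0) by (apply Cmod_gt_0; lra).
  replace (/ (z + h) - / z - - / (z * z) * h)%C with (h * h / ((z * z) * (z + h)))%C
    by (field; repeat split; auto).
  rewrite Cmod_div by (repeat apply Cmult_neq_0; auto). rewrite !Cmod_mult. fold m.
  pose proof (Cmod_ge_0 h).
  apply Rle_div_l. { apply Rmult_lt_0_compat; nra. }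
  assert (Cmod h <= e * (m * m * Cmod (z + h))).
  { assert (m * m * (m / 2) <= m * m * Cmod (z + h)) by (apply Rmult_le_compat_l; nra).
    assert (e * (m * m * (m / 2)) <= e * (m * m * Cmod (z + h))) by (apply Rmult_le_compat_l; lra). lra. }
  nra.
Qed.

Lemma cder_div (f g : C -> C) z a b : g z <> 0 -> cder f z a -> cder g z b ->
  cder (fun w => f w / g w)%C z ((a * g z - f z * b) / (g z * g z)).
Proof.
  intros Hz Hf Hg. eapply cder_eq; [|apply cder_mult; [apply Hf|]].
  2:{ apply (cder_comp (fun w => / w)%C g z). apply cder_inv, Hz. apply Hg. }
  simpl. field. auto.
Qed.

Lemma cder_unique f z a b : cder f z a -> cder f z b -> a = b.
Proof.
  intros Ha Hb. apply NNPP. intros Hn. apply Cneq_sub in Hn.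
  set (e := Cmod (a - b) / 4). assert (He : 0 < e) by (unfold e; lra).
  destruct (Ha e He) as (d & Hd & H). destruct (Hb e He) as (d' & Hd' & H').
  set (t := Rmin d d' / 2). assert (Ht : 0 < t) by (unfold t; assert (0 < Rmin d d') by (apply Rmin_pos; auto); lra).
  assert (Hmt : Cmod t = t) by (rewrite Cmod_R, Rabs_pos_eq; lra).
  assert (t < d /\ t < d') as [H1 H2].
  { unfold t in *. pose proof (Rmin_l d d'). pose proof (Rmin_r d d'). lra. }
  specialize (H t ltac:(lra)). specialize (H' t ltac:(lra)). rewrite Hmt in *.
  assert (HH : Cmod ((a - b) * t) <= e * t + e * t).
  { replace ((a - b) * t)%C with ((f (z + t)%C - f z - b * t) - (f (z + t)%C - f z - a * t))%C by ring.
    eapply Rle_trans. apply Cmod_minus_le. lra. }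
  rewrite Cmod_mult, Hmt in HH. unfold e in HH. nra.
Qed.

Lemma ccont_comp f g z : ccont g z -> ccont f (g z) -> ccont (fun w => f (g w)) z.
Proof.
  intros Hg Hf e He. destruct (Hf e He) as (d & Hd & H). destruct (Hg d Hd) as (d' & Hd' & H').
  exists d'. auto.
Qed.

Lemma ccont_ulim U (HU : ultrafilter U) f x l :
  ccont f l -> ulim U x l -> ulim U (fun n => f (x n)) (f l).
Proof.
  intros Hf Hx e He. destruct (Hf e He) as (d & Hd & H).
  apply (uf_imp U HU) with (2 := Hx d Hd). auto.
Qed.

Lemma ccont_const c z : ccont (fun _ => c) z.
Proof. eapply cder_cont, cder_const. Qed.

Lemma ccont_id z : ccont (fun w => w) z.
Proof. eapply cder_cont, cder_id. Qed.

Lemma ccont_plus f g z : ccont f z -> ccont g z -> ccont (fun w => f w + g w)%C z.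
Proof.
  intros Hf Hg e He. destruct (Hf (e / 2) ltac:(lra)) as (d & Hd & H).
  destruct (Hg (e / 2) ltac:(lra)) as (d' & Hd' & H').
  exists (Rmin d d'). split. apply Rmin_pos; auto. intros w Hw.
  replace (f w + g w - (f z + g z))%C with ((f w - f z) + (g w - g z))%C by ring.
  eapply Rle_lt_trans. apply Cmod_triangle.
  specialize (H w (Rlt_le_trans _ _ _ Hw (Rmin_l _ _))).
  specialize (H' w (Rlt_le_trans _ _ _ Hw (Rmin_r _ _))). lra.
Qed.

Lemma ccont_mult f g z : ccont f z -> ccont g z -> ccont (fun w => f w * g w)%C z.
Proof.
  intros Hf Hg e He.
  pose proof (Cmod_ge_0 (f z)). pose proof (Cmod_ge_0 (g z)).
  set (m := Cmod (f z) + Cmod (g z) + 1).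
  assert (Hm : 0 < m) by (unfold m; lra).
  set (k := Rmin 1 (e / (2 * m))).
  assert (Hk : 0 < k) by (unfold k; apply Rmin_pos; [lra|apply Rdiv_lt_0_compat; lra]).
  assert (Hk1 : k <= 1) by apply Rmin_l.
  assert (Hk2 : k * (2 * m) <= e) by (apply Rle_div_r; [lra|apply Rmin_r]).
  destruct (Hf k Hk) as (d & Hd & H1). destruct (Hg k Hk) as (d' & Hd' & H').
  exists (Rmin d d'). split. apply Rmin_pos; auto. intros w Hw.
  specialize (H1 w (Rlt_le_trans _ _ _ Hw (Rmin_l _ _))).
  specialize (H' w (Rlt_le_trans _ _ _ Hw (Rmin_r _ _))).
  replace (f w * g w - f z * g z)%C with ((f w - f z) * (g w - g z) + ((f w - f z) * g z + f z * (g w - g z)))%C by ring.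
  eapply Rle_lt_trans. apply Cmod_triangle. eapply Rle_lt_trans. apply Rplus_le_compat_l, Cmod_triangle.
  rewrite !Cmod_mult.
  pose proof (Cmod_ge_0 (f w - f z)). pose proof (Cmod_ge_0 (g w - g z)). unfold m in *. nra.
Qed.

Lemma ccont_opp f z : ccont f z -> ccont (fun w => - f w)%C z.
Proof.
  intros H. destruct (classic (ccont (fun w => (-(1)) * f w)%C z)) as [H'|Hn].
  - intros e He. destruct (H' e He) as (d & Hd & HH). exists d. split; auto. intros w Hw.
    replace (- f w - - f z)%C with (-(1) * f w - -(1) * f z)%C by ring. auto.
  - exfalso. apply Hn. apply ccont_mult; auto using ccont_const.
Qed.

Lemma ccont_minus f g z : ccont f z -> ccont g z -> ccont (fun w => f w - g w)%C z.
Proof. intros. apply ccont_plus; auto using ccont_opp. Qed.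

Lemma ccont_inv (f : C -> C) z : f z <> 0 -> ccont f z -> ccont (fun w => / f w)%C z.
Proof.
  intros Hz Hf. apply (ccont_comp (fun w => / w)%C f). auto. eapply cder_cont, cder_inv, Hz.
Qed.

(** * Integrals along segments and Goursat's lemma *)

(* Coquelicot states equations between integrals over the carrier of a normed module, where [ring]
   does not recognize [R]. *)
Ltac real_eq := match goal with |- @eq _ ?x ?y => change (@eq R x y) end.

Definition pcont (f : R -> C) : Prop :=
  forall t, 0 <= t <= 1 ->
    continuous (fun s => fst (f s)) t /\ continuous (fun s => snd (f s)) t.

Definition Cint (f : R -> C) : C :=
  (RInt (fun t => fst (f t)) 0 1, RInt (fun t => snd (f t)) 0 1).

Lemma pcont_ex_RInt f u v : pcont f -> 0 <= u <= 1 -> 0 <= v <= 1 ->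
  ex_RInt (fun t => fst (f t)) u v /\ ex_RInt (fun t => snd (f t)) u v.
Proof.
  intros H Hu Hv. split; apply (ex_RInt_continuous (V := R_CompleteNormedModule)); intros t Ht; apply H;
  unfold Rmin, Rmax in Ht; destruct (Rle_dec u v); lra.
Qed.

Lemma Cint_plus f g : pcont f -> pcont g -> Cint (fun t => f t + g t)%C = (Cint f + Cint g)%C.
Proof.
  intros Hf Hg.
  destruct (pcont_ex_RInt f 0 1 Hf) as [F1 F2]; try lra.
  destruct (pcont_ex_RInt g 0 1 Hg) as [G1 G2]; try lra.
  unfold Cint, Cplus; simpl. f_equal.
  - rewrite <- (RInt_plus (V := R_CompleteNormedModule)); auto.
  - rewrite <- (RInt_plus (V := R_CompleteNormedModule)); auto.
Qed.

Lemma RInt_lincomb (f g : R -> R) a b p q : ex_RInt f a b -> ex_RInt g a b ->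
  RInt (fun t => p * f t + q * g t) a b = p * RInt f a b + q * RInt g a b.
Proof.
  intros Hf Hg.
  rewrite (RInt_plus (V := R_CompleteNormedModule) (fun t => scal p (f t)) (fun t => scal q (g t))).
  - rewrite !(RInt_scal (V := R_CompleteNormedModule)); auto.
  - apply (ex_RInt_scal (V := R_NormedModule)); auto.
  - apply (ex_RInt_scal (V := R_NormedModule)); auto.
Qed.

Lemma Cint_scal f c : pcont f -> Cint (fun t => c * f t)%C = (c * Cint f)%C.
Proof.
  intros Hf. destruct (pcont_ex_RInt f 0 1 Hf) as [F1 F2]; try lra.
  unfold Cint, Cmult; simpl. f_equal.
  - rewrite <- (RInt_ext (fun t => fst c * fst (f t) + (- snd c) * snd (f t))).
    + rewrite RInt_lincomb; auto. real_eq; ring.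
    + intros; real_eq; ring.
  - apply RInt_lincomb; auto.
Qed.

Lemma Cint_ext f g : (forall t, 0 <= t <= 1 -> f t = g t) -> Cint f = Cint g.
Proof.
  intros H. unfold Cint. f_equal; apply RInt_ext; intros t Ht;
  rewrite Rmin_left, Rmax_right in Ht by lra; rewrite H; auto; lra.
Qed.

(** With [(p, q)] the components of the integral, its squared modulus is the integral of
    [p * fst (f t) + q * snd (f t)], which Cauchy-Schwarz bounds pointwise by [Cmod (Cint f) * M];
    one factor of the modulus is then divided out. *)
Lemma Cint_bound f M : pcont f -> (forall t, 0 <= t <= 1 -> Cmod (f t) <= M) -> Cmod (Cint f) <= M.
Proof.
  intros Hf HM. destruct (pcont_ex_RInt f 0 1 Hf) as [F1 F2]; try lra.
  assert (HM0 : 0 <= M). { eapply Rle_trans; [apply Cmod_ge_0|apply (HM 0); lra]. }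
  set (p := fst (Cint f)). set (q := snd (Cint f)).
  assert (HI : Cmod (Cint f) ^ 2 = RInt (fun t => p * fst (f t) + q * snd (f t)) 0 1).
  { rewrite RInt_lincomb by auto. rewrite Cmod_sqr. fold p q. unfold p, q, Cint; simpl. ring. }
  assert (HB : RInt (fun t => p * fst (f t) + q * snd (f t)) 0 1 <= (1 - 0) * (Cmod (Cint f) * M)).
  { eapply Rle_trans. apply Rle_abs. apply abs_RInt_le_const. lra.
    - apply (ex_RInt_plus (V := R_NormedModule) (fun t => scal p (fst (f t))) (fun t => scal q (snd (f t))));
      apply (ex_RInt_scal (V := R_NormedModule)); auto.
    - intros t Ht. specialize (HM t Ht). pose proof (Cmod_ge_0 (Cint f)).
      apply Rle_trans with (Cmod (Cint f) * Cmod (f t)).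
      2: apply Rmult_le_compat_l; auto.
      apply Rsqr_incr_0_var. 2: apply Rmult_le_pos; auto using Cmod_ge_0.
      rewrite <- Rsqr_abs. unfold Rsqr.
      pose proof (Cmod_sqr (Cint f)) as E1. fold p q in E1. pose proof (Cmod_sqr (f t)) as E2.
      assert (E3 : (Cmod (Cint f) * Cmod (f t)) * (Cmod (Cint f) * Cmod (f t)) =
        (p ^ 2 + q ^ 2) * (fst (f t) ^ 2 + snd (f t) ^ 2)) by (rewrite <- E1, <- E2; ring).
      rewrite E3. pose proof (pow2_ge_0 (p * snd (f t) - q * fst (f t))). nra. }
  rewrite <- HI in HB. pose proof (Cmod_ge_0 (Cint f)).
  destruct (Req_dec (Cmod (Cint f)) 0) as [E|E]; [lra|]. nra.
Qed.

Definition path (a b : C) (t : R) : C := (a + t * (b - a))%C.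

Definition seg (f : C -> C) (a b : C) : C := ((b - a) * Cint (fun t => f (path a b t)))%C.

Definition segcont (f : C -> C) (a b : C) : Prop := forall t, 0 <= t <= 1 -> ccont f (path a b t).

Lemma path_0 a b : path a b 0 = a.
Proof. unfold path. ring. Qed.

Lemma path_1 a b : path a b 1 = b.
Proof. unfold path. ring. Qed.

Lemma path_diff a b s t : (path a b s - path a b t = (s - t)%R * (b - a))%C.
Proof. unfold path. rewrite RtoC_minus. ring. Qed.

Lemma segcont_pcont f a b : segcont f a b -> pcont (fun t => f (path a b t)).
Proof.
  intros H t Ht.
  assert (Hc : forall e, 0 < e -> exists d : posreal, forall s, Rabs (s - t) < d ->
     Cmod (f (path a b s) - f (path a b t)) < e).
  { intros e He. destruct (H t Ht e He) as (d & Hd & HH).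
    pose proof (Cmod_ge_0 (b - a)).
    assert (Hd' : 0 < d / (Cmod (b - a) + 1)) by (apply Rdiv_lt_0_compat; lra).
    exists (mkposreal _ Hd'). simpl. intros s Hs. apply HH. rewrite path_diff, Cmod_mult, Cmod_R.
    apply Rlt_div_r in Hs; [|lra]. pose proof (Rabs_pos (s - t)). nra. }
  split; intros P [e HP]; destruct (Hc e (cond_pos e)) as (d & Hd); exists d; intros s Hs;
  apply HP; specialize (Hd s Hs);
  [pose proof (Rabs_fst_le (f (path a b s) - f (path a b t))) as H1
  |pose proof (Rabs_snd_le (f (path a b s) - f (path a b t))) as H1]; simpl in H1;
  unfold ball; simpl; unfold AbsRing_ball, minus, plus, opp, abs; simpl; lra.
Qed.

Lemma seg_ext f g a b : (forall t, 0 <= t <= 1 -> f (path a b t) = g (path a b t)) -> seg f a b = seg g a b.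
Proof. intros H. unfold seg. f_equal. apply Cint_ext. auto. Qed.

Lemma seg_plus f g a b : segcont f a b -> segcont g a b ->
  seg (fun w => f w + g w)%C a b = (seg f a b + seg g a b)%C.
Proof.
  intros Hf Hg. unfold seg. rewrite (Cint_plus (fun t => f (path a b t)) (fun t => g (path a b t)))
  by (apply segcont_pcont; auto). ring.
Qed.

Lemma seg_scal f c a b : segcont f a b -> seg (fun w => c * f w)%C a b = (c * seg f a b)%C.
Proof.
  intros Hf. unfold seg. rewrite (Cint_scal (fun t => f (path a b t)))
  by (apply segcont_pcont; auto). ring.
Qed.

Lemma seg_bound f a b M : segcont f a b ->
  (forall t, 0 <= t <= 1 -> Cmod (f (path a b t)) <= M) -> Cmod (seg f a b) <= Cmod (b - a) * M.
Proof.
  intros Hf HM. unfold seg. rewrite Cmod_mult. apply Rmult_le_compat_l. apply Cmod_ge_0.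
  apply Cint_bound; auto. apply segcont_pcont; auto.
Qed.

Lemma RInt_reverse (g : R -> R) : ex_RInt g 0 1 -> RInt (fun t => g (1 - t)) 0 1 = RInt g 0 1.
Proof.
  intros Hg.
  pose proof (RInt_comp_lin (V := R_CompleteNormedModule) g (-1) 1 0 1) as H.
  pose proof (ex_RInt_comp_lin (V := R_NormedModule) g (-1) 1 0 1) as X.
  replace (-1 * 0 + 1) with 1 in * by ring. replace (-1 * 1 + 1) with 0 in * by ring.
  specialize (H (ex_RInt_swap _ _ _ Hg)). specialize (X (ex_RInt_swap _ _ _ Hg)).
  rewrite <- (opp_RInt_swap (V := R_CompleteNormedModule) g 0 1) in H by auto.
  rewrite (RInt_ext _ (fun y => -1 * g (-1 * y + 1))) in H by (intros; reflexivity).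
  apply (ex_RInt_scal (V := R_NormedModule)) with (k := -1) in X.
  rewrite (RInt_ext _ (fun y => -1 * (-1 * (-1 * g (-1 * y + 1))))) in H.
  2: { intros. real_eq. ring. }
  rewrite (RInt_scal (V := R_CompleteNormedModule) (fun y => -1 * (-1 * g (-1 * y + 1)))) in H by exact X.
  change (-1 * RInt (fun y => -1 * (-1 * g (-1 * y + 1))) 0 1 = - RInt g 0 1) in H.
  rewrite (RInt_ext _ (fun t => -1 * (-1 * g (-1 * t + 1)))).
  - lra.
  - intros t _. replace (-1 * t + 1) with (1 - t) by ring. real_eq. ring.
Qed.

Lemma seg_swap f a b : segcont f a b -> seg f b a = (- seg f a b)%C.
Proof.
  intros Hf. apply segcont_pcont in Hf.
  destruct (pcont_ex_RInt _ 0 1 Hf) as [F1 F2]; try lra.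
  assert (Hp : forall t, path b a t = path a b (1 - t)).
  { intros t. unfold path. rewrite RtoC_minus. ring. }
  assert (E : Cint (fun t => f (path b a t)) = Cint (fun t => f (path a b t))).
  { unfold Cint. f_equal; [rewrite <- (RInt_reverse _ F1)|rewrite <- (RInt_reverse _ F2)];
    apply RInt_ext; intros t _; rewrite Hp; auto. }
  unfold seg. rewrite E. ring.
Qed.

Definition mid (a b : C) : C := path a b (/ 2).

Lemma RInt_halves (g : R -> R) : ex_RInt g 0 (/ 2) -> ex_RInt g (/ 2) 1 ->
  RInt g 0 1 = / 2 * (RInt (fun t => g (/ 2 * t)) 0 1 + RInt (fun t => g (/ 2 * t + / 2)) 0 1).
Proof.
  intros H1 H2.
  rewrite <- (RInt_Chasles (V := R_CompleteNormedModule) g 0 (/ 2) 1) by auto.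
  pose proof (RInt_comp_lin (V := R_CompleteNormedModule) g (/ 2) 0 0 1) as E1.
  pose proof (ex_RInt_comp_lin (V := R_NormedModule) g (/ 2) 0 0 1) as X1.
  pose proof (RInt_comp_lin (V := R_CompleteNormedModule) g (/ 2) (/ 2) 0 1) as E2.
  pose proof (ex_RInt_comp_lin (V := R_NormedModule) g (/ 2) (/ 2) 0 1) as X2.
  replace (/ 2 * 0 + 0) with 0 in * by ring. replace (/ 2 * 1 + 0) with (/ 2) in * by ring.
  replace (/ 2 * 0 + / 2) with (/ 2) in * by ring. replace (/ 2 * 1 + / 2) with 1 in * by field.
  rewrite <- E1, <- E2 by auto. specialize (X1 H1). specialize (X2 H2).
  apply (ex_RInt_scal (V := R_NormedModule)) with (k := 2) in X1.
  apply (ex_RInt_scal (V := R_NormedModule)) with (k := 2) in X2.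
  assert (Y1 : ex_RInt (fun t => g (/ 2 * t)) 0 1).
  { eapply ex_RInt_ext; [|exact X1]. intros t _. change (2 * (/ 2 * g (/ 2 * t + 0)) = g (/ 2 * t)).
    rewrite Rplus_0_r. field. }
  assert (Y2 : ex_RInt (fun t => g (/ 2 * t + / 2)) 0 1).
  { eapply ex_RInt_ext; [|exact X2]. intros t _.
    change (2 * (/ 2 * g (/ 2 * t + / 2)) = g (/ 2 * t + / 2)). field. }
  rewrite !(RInt_scal (V := R_CompleteNormedModule)).
  - rewrite (RInt_ext (fun y => g (/ 2 * y + 0)) (fun y => g (/ 2 * y))).
    + change (/ 2 * RInt (fun y => g (/ 2 * y)) 0 1 + / 2 * RInt (fun y => g (/ 2 * y + / 2)) 0 1 =
      / 2 * (RInt (fun y => g (/ 2 * y)) 0 1 + RInt (fun y => g (/ 2 * y + / 2)) 0 1)). ring.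
    + intros. rewrite Rplus_0_r. auto.
  - auto.
  - eapply ex_RInt_ext; [|exact Y1]. intros t _. cbn beta. rewrite Rplus_0_r. auto.
Qed.

Lemma path_mid_l a b t : path a (mid a b) t = path a b (/ 2 * t).
Proof. unfold mid, path. rewrite RtoC_mult. ring. Qed.

Lemma path_mid_r a b t : path (mid a b) b t = path a b (/ 2 * t + / 2).
Proof.
  unfold mid, path. rewrite RtoC_plus, RtoC_mult. rewrite RtoC_inv by lra. field.
Qed.

Lemma mid_sub_l a b : (mid a b - a = RtoC (/ 2) * (b - a))%C.
Proof. unfold mid, path. ring. Qed.

Lemma mid_sub_r a b : (b - mid a b = RtoC (/ 2) * (b - a))%C.
Proof. unfold mid, path. rewrite RtoC_inv by lra. field. Qed.

Lemma seg_split f a b : segcont f a b -> seg f a b = (seg f a (mid a b) + seg f (mid a b) b)%C.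
Proof.
  intros Hf. apply segcont_pcont in Hf.
  destruct (pcont_ex_RInt _ 0 (/ 2) Hf) as [F1 F2]; try lra.
  destruct (pcont_ex_RInt _ (/ 2) 1 Hf) as [G1 G2]; try lra.
  assert (E : Cint (fun t => f (path a b t)) =
     (RtoC (/ 2) * (Cint (fun t => f (path a (mid a b) t)) + Cint (fun t => f (path (mid a b) b t))))%C).
  { unfold Cint, Cmult, Cplus; simpl. f_equal.
    - rewrite RInt_halves by auto.
      rewrite (RInt_ext (fun t => fst (f (path a (mid a b) t))) (fun t => fst (f (path a b (/ 2 * t))))).
      rewrite (RInt_ext (fun t => fst (f (path (mid a b) b t))) (fun t => fst (f (path a b (/ 2 * t + / 2))))).
      real_eq; ring. intros; rewrite path_mid_r; auto. intros; rewrite path_mid_l; auto.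
    - rewrite RInt_halves by auto.
      rewrite (RInt_ext (fun t => snd (f (path a (mid a b) t))) (fun t => snd (f (path a b (/ 2 * t))))).
      rewrite (RInt_ext (fun t => snd (f (path (mid a b) b t))) (fun t => snd (f (path a b (/ 2 * t + / 2))))).
      real_eq; ring. intros; rewrite path_mid_r; auto. intros; rewrite path_mid_l; auto. }
  unfold seg. rewrite E, mid_sub_l, mid_sub_r. ring.
Qed.

Lemma cder_path_parts F l a b t :
  cder F (path a b t) l ->
  is_derive (fun s => fst (F (path a b s))) t (fst (l * (b - a))%C) /\
  is_derive (fun s => snd (F (path a b s))) t (snd (l * (b - a))%C).
Proof.
  intros H.
  assert (HH : forall e, 0 < e -> exists d : posreal, forall h, h <> 0 -> Rabs h < d ->
    Cmod (/ h * (F (path a b (t + h)) - F (path a b t)) - l * (b - a)) < e).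
  { intros e He. pose proof (Cmod_ge_0 (b - a)).
    assert (He' : 0 < e / (Cmod (b - a) + 1)) by (apply Rdiv_lt_0_compat; lra).
    destruct (H _ He') as (d & Hd & HF).
    assert (Hd' : 0 < d / (Cmod (b - a) + 1)) by (apply Rdiv_lt_0_compat; lra).
    exists (mkposreal _ Hd'). simpl. intros h Hh0 Hh.
    assert (Hp : (path a b t + h * (b - a))%C = path a b (t + h)) by (unfold path; rewrite RtoC_plus; ring).
    assert (Hm : Cmod (h * (b - a)) = Rabs h * Cmod (b - a)) by (rewrite Cmod_mult, Cmod_R; auto).
    apply Rlt_div_r in Hh; [|lra].
    specialize (HF (h * (b - a))%C). rewrite Hp, Hm in HF.
    assert (Hpos : 0 < Rabs h) by (apply Rabs_pos_lt; auto).
    specialize (HF ltac:(nra)).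
    assert (Hhc : RtoC h <> 0) by (intros E; apply RtoC_inj in E; auto).
    replace (/ h * (F (path a b (t + h)) - F (path a b t)) - l * (b - a))%C with
      (/ h * (F (path a b (t + h)) - F (path a b t) - l * (h * (b - a))))%C by (field; auto).
    rewrite Cmod_mult, Cmod_inv, Cmod_R by auto.
    apply Rle_lt_trans with (/ Rabs h * (e / (Cmod (b - a) + 1) * (Rabs h * Cmod (b - a)))).
    - apply Rmult_le_compat_l; auto. left; apply Rinv_0_lt_compat; auto.
    - replace (/ Rabs h * (e / (Cmod (b - a) + 1) * (Rabs h * Cmod (b - a)))) with
        (e * (Cmod (b - a) / (Cmod (b - a) + 1))) by (field; lra).
      rewrite <- (Rmult_1_r e) at 2. apply Rmult_lt_compat_l; auto. apply Rlt_div_l; lra. }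
  split; apply is_derive_Reals; intros e He; destruct (HH e He) as (d & Hd); exists d; intros h Hh0 Hh;
  specialize (Hd h Hh0 Hh);
  rewrite <- RtoC_inv in Hd by auto;
  match goal with |- context [fst _] =>
    pose proof (Rabs_fst_le (RtoC (/ h) * (F (path a b (t + h)) - F (path a b t)) - l * (b - a))) as H1
  | |- context [snd _] =>
    pose proof (Rabs_snd_le (RtoC (/ h) * (F (path a b (t + h)) - F (path a b t)) - l * (b - a))) as H1
  end;
  (eapply Rle_lt_trans; [|apply Hd]); (eapply Rle_trans; [|apply H1]); right; f_equal; simpl; field; auto.
Qed.

Lemma seg_FTC F f a b :
  (forall t, 0 <= t <= 1 -> cder F (path a b t) (f (path a b t))) -> segcont f a b ->
  seg f a b = (F b - F a)%C.
Proof.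
  intros HF Hf.
  assert (HP : pcont (fun t => f (path a b t))) by (apply segcont_pcont; auto).
  assert (HP' : segcont (fun w => (b - a) * f w)%C a b).
  { intros t Ht. apply ccont_mult. apply ccont_const. auto. }
  apply segcont_pcont in HP'.
  unfold seg. rewrite <- Cint_scal by auto. unfold Cint.
  transitivity (F (path a b 1) - F (path a b 0))%C; [|rewrite path_0, path_1; reflexivity].
  apply injective_projections.
  - apply (is_RInt_unique (V := R_CompleteNormedModule)).
    apply (is_RInt_derive (V := R_CompleteNormedModule) (fun s => fst (F (path a b s)))).
    + intros t Ht. rewrite Rmin_left, Rmax_right in Ht by lra.
      destruct (cder_path_parts F _ a b t (HF t Ht)) as [H _]. rewrite Cmult_comm in H. exact H.
    + intros t Ht. rewrite Rmin_left, Rmax_right in Ht by lra. apply (HP' t Ht).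
  - apply (is_RInt_unique (V := R_CompleteNormedModule)).
    apply (is_RInt_derive (V := R_CompleteNormedModule) (fun s => snd (F (path a b s)))).
    + intros t Ht. rewrite Rmin_left, Rmax_right in Ht by lra.
      destruct (cder_path_parts F _ a b t (HF t Ht)) as [_ H]. rewrite Cmult_comm in H. exact H.
    + intros t Ht. rewrite Rmin_left, Rmax_right in Ht by lra. apply (HP' t Ht).
Qed.

(** Serves to pick the nested triangles of Goursat's lemma: [P] is the invariant at step [n], and
    [R] relates consecutive choices. *)
Lemma dependent_choice {A : Type} (P : nat -> A -> Prop) (R : nat -> A -> A -> Prop) (x0 : A) :
  P 0%nat x0 -> (forall n x, P n x -> exists y, P (S n) y /\ R n x y) ->
  exists s : nat -> A, s 0%nat = x0 /\ forall n, P n (s n) /\ R n (s n) (s (S n)).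
Proof.
  intros H0 Hs.
  pose (s := nat_rect (fun _ => A) x0 (fun n x => epsilon (inhabits x0) (fun y => P (S n) y /\ R n x y))).
  assert (HP : forall n, P n (s n)).
  { induction n; auto. simpl. apply (epsilon_spec (inhabits x0) (fun y => P (S n) y /\ R n (s n) y)). auto. }
  exists s. repeat split; auto.
  apply (epsilon_spec (inhabits x0) (fun y => P (S n) y /\ R n (s n) y)). auto.
Qed.

Lemma pow_half_small e A : 0 < e -> 0 <= A -> exists n, A * (/ 2) ^ n < e.
Proof.
  intros He HA.
  destruct (pow_lt_1_zero (/ 2)) with (y := e / (A + 1)) as (N & HN).
  - rewrite Rabs_pos_eq; lra.
  - apply Rdiv_lt_0_compat; lra.
  - exists N. specialize (HN N (Nat.le_refl N)). rewrite Rabs_pos_eq in HN by (apply pow_le; lra).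
    apply Rlt_div_r in HN; [|lra]. assert (0 <= (/ 2) ^ N) by (apply pow_le; lra). nra.
Qed.

(** * Goursat's lemma for triangles in a closed convex set *)

Definition tri (f : C -> C) (a b c : C) : C := (seg f a b + seg f b c + seg f c a)%C.

Definition convex (K : C -> Prop) : Prop := forall x y t, K x -> K y -> 0 <= t <= 1 -> K (path x y t).

(** Closedness in the form met below: the vertices of nested triangles have an ultralimit, which
    must stay in the set. *)
Definition ulim_closed (K : C -> Prop) : Prop :=
  forall U x l, ultrafilter U -> (forall n, K (x n)) -> ulim U x l -> K l.

Section Goursat.
Variables (K : C -> Prop) (f : C -> C).
Hypothesis HKc : convex K.
Hypothesis HKu : ulim_closed K.
Hypothesis Hf : forall p, K p -> exists l, cder f p l.

Lemma K_segcont a b : K a -> K b -> segcont f a b.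
Proof.
  intros Ha Hb t Ht. destruct (Hf (path a b t)) as (l & Hl). apply HKc; auto. eapply cder_cont, Hl.
Qed.

(** Each edge of the inner triangle is traversed twice, in opposite directions, so these
    contributions cancel. *)
Lemma tri_subdivide a b c : K a -> K b -> K c ->
  tri f a b c = (tri f a (mid a b) (mid c a) + tri f (mid a b) b (mid b c) +
    (tri f (mid c a) (mid b c) c + tri f (mid b c) (mid c a) (mid a b)))%C.
Proof.
  intros Ha Hb Hc.
  assert (Kab : K (mid a b)) by (apply HKc; auto; lra).
  assert (Kbc : K (mid b c)) by (apply HKc; auto; lra).
  assert (Kca : K (mid c a)) by (apply HKc; auto; lra).
  unfold tri.
  rewrite (seg_split f a b), (seg_split f b c), (seg_split f c a) by (apply K_segcont; auto).
  rewrite (seg_swap f (mid b c) (mid a b)), (seg_swap f (mid c a) (mid b c)), (seg_swap f (mid a b) (mid c a)) by (apply K_segcont; auto).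
  ring.
Qed.

Lemma sum4_large (x y z w : C) t : 0 <= t -> 4 * t <= Cmod (x + y + (z + w)) ->
  t <= Cmod x \/ t <= Cmod y \/ t <= Cmod z \/ t <= Cmod w.
Proof.
  intros Ht H. pose proof (Cmod_triangle (x + y) (z + w)).
  pose proof (Cmod_triangle x y). pose proof (Cmod_triangle z w).
  destruct (Rle_dec t (Cmod x)); auto. destruct (Rle_dec t (Cmod y)); auto.
  destruct (Rle_dec t (Cmod z)); auto. destruct (Rle_dec t (Cmod w)); auto. lra.
Qed.

Lemma Cmod_half_scal z : Cmod (RtoC (/ 2) * z) = Cmod z / 2.
Proof. rewrite Cmod_mult, Cmod_R, Rabs_pos_eq; lra. Qed.

Definition small_tri (d : R) (x : C * C * C) : Prop :=
  let '(a, b, c) := x in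
  K a /\ K b /\ K c /\ Cmod (b - a) <= d /\ Cmod (c - b) <= d /\ Cmod (a - c) <= d.

Lemma mid_sub_mid (a b c : C) : (mid a b - mid b c = RtoC (/ 2) * (a - c))%C.
Proof. unfold mid, path. rewrite RtoC_inv by lra. field. Qed.

(** One of the four subtriangles keeps a quarter of the integral. The bound on the displacement of
    the first vertex makes the first vertices of the nested triangles converge geometrically. *)
Lemma tri_step a b c d t : 0 <= t -> small_tri d (a, b, c) -> 4 * t <= Cmod (tri f a b c) ->
  exists x', small_tri (d / 2) x' /\ t <= Cmod (tri f (fst (fst x')) (snd (fst x')) (snd x')) /\
    Cmod (fst (fst x') - a) <= d.
Proof.
  intros Ht (Ha & Hb & Hc & Hab & Hbc & Hca) HT.
  assert (Kab : K (mid a b)) by (apply HKc; auto; lra).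
  assert (Kbc : K (mid b c)) by (apply HKc; auto; lra).
  assert (Kca : K (mid c a)) by (apply HKc; auto; lra).
  assert (Hd : 0 <= d) by (eapply Rle_trans; [apply Cmod_ge_0|apply Hab]).
  assert (E1 : (mid c a - a = RtoC (/ 2) * (c - a))%C) by (unfold mid, path; rewrite RtoC_inv by lra; field).
  assert (E2 : (mid b c - mid c a = RtoC (/ 2) * (b - a))%C) by apply mid_sub_mid.
  assert (E3 : (mid c a - mid a b = RtoC (/ 2) * (c - b))%C) by apply mid_sub_mid.
  assert (E4 : (mid a b - mid b c = RtoC (/ 2) * (a - c))%C) by apply mid_sub_mid.
  assert (M1 : forall x y, Cmod (x - y) <= d -> Cmod (RtoC (/ 2) * (x - y)) <= d / 2).
  { intros x y H. rewrite Cmod_half_scal. lra. }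
  assert (M2 : forall x y, Cmod (x - y) <= d -> Cmod (RtoC (/ 2) * (y - x)) <= d / 2).
  { intros x y H. rewrite Cmod_half_scal, Cmod_sub_sym. lra. }
  assert (S : forall x y, Cmod (x - y) <= d / 2 -> Cmod (y - x) <= d / 2) by (intros; rewrite Cmod_sub_sym; auto).
  assert (F1 : Cmod (mid a b - a) <= d / 2) by (rewrite mid_sub_l; auto).
  assert (F2 : Cmod (b - mid a b) <= d / 2) by (rewrite mid_sub_r; auto).
  assert (F3 : Cmod (mid b c - b) <= d / 2) by (rewrite mid_sub_l; auto).
  assert (F4 : Cmod (c - mid b c) <= d / 2) by (rewrite mid_sub_r; auto).
  assert (F5 : Cmod (mid c a - c) <= d / 2) by (rewrite mid_sub_l; auto).
  assert (F6 : Cmod (a - mid c a) <= d / 2) by (rewrite mid_sub_r; auto).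
  assert (F7 : Cmod (mid b c - mid c a) <= d / 2) by (rewrite E2; auto).
  assert (F8 : Cmod (mid c a - mid a b) <= d / 2) by (rewrite E3; auto).
  assert (F9 : Cmod (mid a b - mid b c) <= d / 2) by (rewrite E4; auto).
  rewrite tri_subdivide in HT by auto.
  destruct (sum4_large _ _ _ _ t Ht HT) as [H|[H|[H|H]]].
  - exists (a, mid a b, mid c a). simpl. repeat split; auto.
    replace (a - a)%C with (RtoC 0) by ring. rewrite Cmod_0; auto.
  - exists (mid a b, b, mid b c). simpl. repeat split; auto. lra.
  - exists (mid c a, mid b c, c). simpl. repeat split; auto. rewrite Cmod_sub_sym; lra.
  - exists (mid b c, mid c a, mid a b). simpl. repeat split; auto.
    pose proof (Cmod_sub_triangle (mid b c) (mid a b) a). rewrite (Cmod_sub_sym (mid b c) (mid a b)) in H0. lra.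
Qed.

Lemma seg_affine p l q a b :
  seg (fun w => q + l * (w - p))%C a b =
    ((q * b + l * ((b - p) * (b - p)) / 2) - (q * a + l * ((a - p) * (a - p)) / 2))%C.
Proof.
  apply (seg_FTC (fun w => q * w + l * ((w - p) * (w - p)) / 2)%C).
  - intros t _. set (z := path a b t).
    assert (H1 : cder (fun w => w - p)%C z (1 - 0)) by (apply cder_minus; [apply cder_id|apply cder_const]).
    eapply cder_eq; [|apply cder_plus; [apply cder_scal, cder_id|]].
    2: { apply cder_ext_all with (fun w => (l / 2) * ((w - p) * (w - p)))%C. { intros w. field. }
         apply cder_scal. apply cder_mult; apply H1. }
    cbn beta. field.
  - intros t _. apply ccont_plus. apply ccont_const. apply ccont_mult. apply ccont_const.
    apply ccont_minus. apply ccont_id. apply ccont_const.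
Qed.

(** Subtracting the affine part of [f] at [p], which has a primitive by [seg_affine] and so
    integrates to 0 around the triangle, leaves a remainder of modulus at most [e * r] on sides of
    length at most [d]. *)
Lemma tri_near p l e r a b c :
  (forall w, Cmod (w - p) <= r -> Cmod (f w - f p - l * (w - p)) <= e * Cmod (w - p)) ->
  0 <= e -> forall d, small_tri d (a, b, c) -> Cmod (a - p) + d <= r ->
  Cmod (tri f a b c) <= 3 * d * (e * r).
Proof.
  intros He He0 d (Ha & Hb & Hc & Hab & Hbc & Hca) Hr.
  pose (g := fun w => (f w - (f p + l * (w - p)))%C).
  assert (Hg : forall x y, segcont f x y -> segcont g x y).
  { intros x y H t Ht. apply ccont_minus. apply H; auto.
    apply ccont_plus. apply ccont_const. apply ccont_mult. apply ccont_const.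
    apply ccont_minus. apply ccont_id. apply ccont_const. }
  assert (HS : forall x y, K x -> K y -> Cmod (x - p) <= r -> Cmod (y - p) <= r -> Cmod (y - x) <= d ->
    Cmod (seg g x y) <= d * (e * r)).
  { intros x y Kx Ky Hx Hy Hxy.
    assert (Hr0 : 0 <= r) by (eapply Rle_trans; [apply Cmod_ge_0|apply Hx]).
    apply Rle_trans with (Cmod (y - x) * (e * r)).
    2: { apply Rmult_le_compat_r; auto. apply Rmult_le_pos; auto. }
    apply seg_bound. apply Hg. apply K_segcont; auto.
    intros t Ht. unfold g.
    assert (Hp : Cmod (path x y t - p) <= r).
    { unfold path. replace (x + t * (y - x) - p)%C with ((1 - t)%R * (x - p) + t * (y - p))%C
        by (rewrite RtoC_minus; ring).
      eapply Rle_trans. apply Cmod_triangle. rewrite !Cmod_mult, !Cmod_R, !Rabs_pos_eq by lra. nra. }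
    replace (f (path x y t) - (f p + l * (path x y t - p)))%C with
      (f (path x y t) - f p - l * (path x y t - p))%C by ring.
    eapply Rle_trans. apply He; auto. apply Rmult_le_compat_l; auto. }
  assert (HE : forall x y, K x -> K y -> seg f x y =
     (seg g x y + ((f p * y + l * ((y - p) * (y - p)) / 2) - (f p * x + l * ((x - p) * (x - p)) / 2)))%C).
  { intros x y Kx Ky. rewrite <- seg_affine. rewrite <- seg_plus.
    - apply seg_ext. intros t _. unfold g. ring.
    - apply Hg, K_segcont; auto.
    - intros t _. apply ccont_plus. apply ccont_const. apply ccont_mult. apply ccont_const.
      apply ccont_minus. apply ccont_id. apply ccont_const. }
  assert (ET : tri f a b c = (seg g a b + seg g b c + seg g c a)%C).
  { unfold tri. rewrite !HE by auto. field. }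
  rewrite ET. eapply Rle_trans. apply Cmod_triangle.
  pose proof (Cmod_triangle (seg g a b) (seg g b c)).
  assert (Ha' : Cmod (a - p) <= r) by (pose proof (Cmod_ge_0 (b - a)); lra).
  assert (Hb' : Cmod (b - p) <= r) by (pose proof (Cmod_sub_triangle b a p); lra).
  assert (Hc' : Cmod (c - p) <= r).
  { pose proof (Cmod_sub_triangle c a p). rewrite (Cmod_sub_sym c a) in H0. lra. }
  pose proof (HS a b Ha Hb Ha' Hb' Hab). pose proof (HS b c Hb Hc Hb' Hc' Hbc).
  pose proof (HS c a Hc Ha Hc' Ha' Hca). lra.
Qed.

Lemma goursat a b c : K a -> K b -> K c -> tri f a b c = 0.
Proof.
  intros Ha Hb Hc. apply Cmod_eq_0.
  set (T := Cmod (tri f a b c)).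
  set (d := Cmod (b - a) + Cmod (c - b) + Cmod (a - c)).
  pose proof (Cmod_ge_0 (b - a)). pose proof (Cmod_ge_0 (c - b)). pose proof (Cmod_ge_0 (a - c)).
  assert (Hd : 0 <= d) by (unfold d; lra).
  assert (HT0 : 0 <= T) by apply Cmod_ge_0.
  destruct (dependent_choice
    (fun n x => small_tri (d * (/ 2) ^ n) x /\ T * (/ 4) ^ n <= Cmod (tri f (fst (fst x)) (snd (fst x)) (snd x)))
    (fun n x y => Cmod (fst (fst y) - fst (fst x)) <= d * (/ 2) ^ n) (a, b, c)) as (s & Hs0 & Hs).
  - simpl. unfold d, T. repeat split; auto; lra.
  - intros n [[a' b'] c'] [Hsm HT].
    destruct (tri_step a' b' c' (d * (/ 2) ^ n) (T * (/ 4) ^ S n)) as (x' & H1' & H2' & H3'); auto.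
    + apply Rmult_le_pos; auto. apply pow_le; lra.
    + simpl in *. lra.
    + exists x'. repeat split; auto.
      replace (d * (/ 2) ^ S n) with (d * (/ 2) ^ n / 2) by (simpl; field). auto.
  - destruct some_ultrafilter as (U & HU).
    destruct (ulim_geometric U HU (fun n => fst (fst (s n))) d (/ 2)) as (p & Hp & Hpn).
    { lra. } { intros n. apply Hs. }
    assert (Kp : K p).
    { apply (HKu U (fun n => fst (fst (s n)))); auto. intros n. destruct (Hs n) as [[Hsm _] _].
      destruct (s n) as [[a' b'] c']. apply Hsm. }
    destruct (Hf p Kp) as (l & Hl).
    assert (Hall : forall e, 0 < e -> T <= 9 * d * d * e).
    { intros e He. destruct (Hl e He) as (d0 & Hd0 & HH).
      destruct (pow_half_small d0 (3 * d) Hd0 ltac:(lra)) as (n & Hn).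
      destruct (Hs n) as [[Hsm HT] _].
      specialize (Hpn n). cbn beta in Hpn.
      destruct (s n) as [[a' b'] c']. simpl fst in *; simpl snd in *.
      assert (Hq : 0 < (/ 2) ^ n) by (apply pow_lt; lra).
      replace (d / (1 - / 2)) with (2 * d) in Hpn by field.
      (* The first vertex is within [2 * d * (/ 2) ^ n] of [p] and the sides are at most
         [d * (/ 2) ^ n], hence the radius [3 * d * (/ 2) ^ n]. Perimeter times error is then of
         order [(/ 4) ^ n], the rate at which the integral may shrink. *)
      assert (HB := tri_near p l e (3 * d * (/ 2) ^ n) a' b' c').
      specialize (HB ltac:(intros w Hw; specialize (HH (w - p)%C ltac:(lra));
        replace (p + (w - p))%C with w in HH by ring; exact HH) ltac:(lra) _ Hsm ltac:(lra)).
      assert (E : (/ 4) ^ n = (/ 2) ^ n * (/ 2) ^ n) by (rewrite <- Rpow_mult_distr; f_equal; lra).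
      rewrite E in HT.
      assert (H4 : T * ((/ 2) ^ n * (/ 2) ^ n) <= (9 * d * d * e) * ((/ 2) ^ n * (/ 2) ^ n)) by nra.
      apply Rmult_le_reg_r in H4; auto. apply Rmult_lt_0_compat; auto. }
    apply Rle_antisym; auto.
    apply Rnot_lt_le. intros HTp.
    specialize (Hall (T / (9 * d * d + 1) / 2)).
    assert (Hden : 0 < 9 * d * d + 1) by nra.
    assert (He : 0 < T / (9 * d * d + 1) / 2) by (apply Rdiv_lt_0_compat; [apply Rdiv_lt_0_compat|]; lra).
    specialize (Hall He).
    replace (9 * d * d * (T / (9 * d * d + 1) / 2)) with (T / 2 * (9 * d * d / (9 * d * d + 1))) in Hall by (field; lra).
    assert (9 * d * d / (9 * d * d + 1) <= 1) by (apply Rle_div_l; lra).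
    assert (0 <= 9 * d * d / (9 * d * d + 1)) by (apply Rdiv_le_0_compat; nra). nra.
Qed.

End Goursat.

(** * Cauchy's formula on a square *)

Definition holo (S : C -> Prop) (f : C -> C) : Prop := forall z, S z -> exists l, cder f z l.

Lemma holo_ccont S f z : holo S f -> S z -> ccont f z.
Proof. intros H Hz. destruct (H z Hz) as (l & Hl). eapply cder_cont, Hl. Qed.

Lemma Cmod_path_le x y r t : Cmod x <= r -> Cmod y <= r -> 0 <= t <= 1 -> Cmod (path x y t) <= r.
Proof.
  intros Hx Hy Ht. unfold path. replace (x + t * (y - x))%C with ((1 - t)%R * x + t * y)%C
    by (rewrite RtoC_minus; ring).
  eapply Rle_trans. apply Cmod_triangle. rewrite !Cmod_mult, !Cmod_R, !Rabs_pos_eq by lra. nra.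
Qed.

(** Real linear forms with coefficients [1] and [-1] describe the half-planes bounded by the sides
    of the contour below. *)
Definition lform (p q : R) (w : C) : R := p * fst w + q * snd w.

Lemma lform_path p q x y t : lform p q (path x y t) = (1 - t) * lform p q x + t * lform p q y.
Proof. unfold lform, path. simpl. ring. Qed.

Lemma halfplane_convex p q c r : convex (fun w => Cmod w <= r /\ c <= lform p q w).
Proof.
  intros x y t [Hx Hx'] [Hy Hy'] Ht. split. apply Cmod_path_le; auto.
  rewrite lform_path. nra.
Qed.

Lemma halfplane_closed p q c r : ulim_closed (fun w => Cmod w <= r /\ c <= lform p q w).
Proof.
  intros U x l HU Hx Hl. split.
  - apply (ulim_Cmod_le U HU x); auto. apply uf_true; auto. intros n; apply Hx.
  - apply (ulimR_ge_l U HU (fun n => lform p q (x n))).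
    + unfold lform. apply ulimR_plus; auto; apply ulimR_mult; auto using ulimR_const, ulim_fst, ulim_snd.
    + apply uf_true; auto. intros n; apply Hx.
Qed.

Section Quad.
Variables (f : C -> C) (z : C).
Hypothesis Hf : holo (fun w : C => disc w /\ w <> z) f.

(** The quadrilateral between the side from [a] to [b] and its copy contracted towards [z] by the
    factor [e] lies in the convex set [K], which avoids [z]; Goursat's lemma applies to the two
    triangles that form it. *)
Lemma quad_deform a b p q e :
  Cmod a <= 3 / 4 -> Cmod b <= 3 / 4 -> Cmod z <= 3 / 4 ->
  lform p q a = 3 / 4 -> lform p q b = 3 / 4 -> lform p q z < 3 / 4 -> 0 < e <= 1 ->
  seg f a b = (seg f a (path z a e) + seg f (path z a e) (path z b e) - seg f b (path z b e))%C /\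
  segcont f (path z a e) (path z b e).
Proof.
  intros Ha Hb Hz La Lb Lz He.
  set (K := fun w => Cmod w <= 3 / 4 /\ lform p q z + e * (3 / 4 - lform p q z) <= lform p q w).
  assert (HK : holo K f).
  { intros w [H1 H2]. apply Hf. split. unfold disc; lra. intros ->. nra. }
  assert (Ka : K a) by (split; [auto|nra]).
  assert (Kb : K b) by (split; [auto|nra]).
  assert (Ka' : K (path z a e)) by (split; [apply Cmod_path_le; auto; lra|rewrite lform_path; nra]).
  assert (Kb' : K (path z b e)) by (split; [apply Cmod_path_le; auto; lra|rewrite lform_path; nra]).
  pose proof (goursat K f (halfplane_convex _ _ _ _) (halfplane_closed _ _ _ _) HK) as G.
  pose proof (K_segcont K f (halfplane_convex _ _ _ _) HK) as S.
  pose proof (G a b (path z b e) Ka Kb Kb') as G1.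
  pose proof (G a (path z b e) (path z a e) Ka Kb' Ka') as G2.
  split; [|apply S; auto].
  unfold tri in G1, G2.
  rewrite (seg_swap f (path z a e) (path z b e)), (seg_swap f a (path z a e)) in G2 by (apply S; auto).
  rewrite (seg_swap f a (path z b e)) in G1 by (apply S; auto).
  set (X := seg f a b) in *. set (Y := seg f b (path z b e)) in *. set (Z := seg f a (path z b e)) in *.
  replace X with ((X + Y + - Z) - Y + Z)%C by ring. rewrite G1.
  replace Z with ((Z + - seg f (path z a e) (path z b e) + - seg f a (path z a e)) +
    seg f (path z a e) (path z b e) + seg f a (path z a e))%C by ring. rewrite G2. ring.
Qed.

Lemma quad_small a b p q e M d :
  Cmod a <= 3 / 4 -> Cmod b <= 3 / 4 -> Cmod z <= 3 / 4 ->
  lform p q a = 3 / 4 -> lform p q b = 3 / 4 -> lform p q z < 3 / 4 -> 0 < e <= 1 ->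
  (forall w, w <> z -> Cmod (w - z) < d -> Cmod (f w) <= M) -> 0 <= M -> 2 * e < d ->
  Cmod (seg f (path z a e) (path z b e)) <= 2 * e * M.
Proof.
  intros Ha Hb Hz La Lb Lz He HM HM0 Hd.
  destruct (quad_deform a b p q e) as [_ Hc]; auto.
  apply Rle_trans with (Cmod (path z b e - path z a e) * M).
  - apply seg_bound; auto. intros t Ht. apply HM.
    + intros E. apply (f_equal (lform p q)) in E. rewrite !lform_path, La, Lb in E. nra.
    + replace (path (path z a e) (path z b e) t - z)%C with (e * (path a b t - z))%C by (unfold path; ring).
      rewrite Cmod_mult, Cmod_R, Rabs_pos_eq by lra.
      pose proof (Cmod_path_le a b _ t Ha Hb Ht). pose proof (Cmod_minus_le (path a b t) z). nra.
  - apply Rmult_le_compat_r; auto.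
    replace (path z b e - path z a e)%C with (e * (b - a))%C by (unfold path; ring).
    rewrite Cmod_mult, Cmod_R, Rabs_pos_eq by lra. pose proof (Cmod_minus_le b a). nra.
Qed.
End Quad.

(** The contour is a square standing on a corner. It lies inside the unit disc and encloses the disc
    of radius [1 / 2]; being made of segments, it needs only integrals of the form [seg]. *)
Definition v0 : C := (3 / 4, 0).
Definition v1 : C := (0, 3 / 4).
Definition v2 : C := (- (3 / 4), 0).
Definition v3 : C := (0, - (3 / 4)).

Definition sq (d : C -> C) : C := (seg d v0 v1 + seg d v1 v2 + seg d v2 v3 + seg d v3 v0)%C.

Definition onsq (w : C) : Prop := exists t, 0 <= t <= 1 /\
  (w = path v0 v1 t \/ w = path v1 v2 t \/ w = path v2 v3 t \/ w = path v3 v0 t).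

Lemma Cmod_pair_le x y r : 0 <= r -> x ^ 2 + y ^ 2 <= r ^ 2 -> Cmod (x, y) <= r.
Proof. intros Hr H. apply Cmod_le_of_sqr; auto. rewrite Cmod_sqr. auto. Qed.

Lemma Cmod_v : Cmod v0 <= 3 / 4 /\ Cmod v1 <= 3 / 4 /\ Cmod v2 <= 3 / 4 /\ Cmod v3 <= 3 / 4.
Proof. repeat split; apply Cmod_pair_le; simpl; lra. Qed.

(* [53 / 100] is just below [3 / (4 sqrt 2)], the distance from 0 to the sides. *)
Lemma onsq_Cmod w : onsq w -> 53 / 100 <= Cmod w <= 3 / 4.
Proof.
  intros (t & Ht & H).
  assert (HH : Cmod w ^ 2 = 9 / 16 * ((1 - t) ^ 2 + t ^ 2)).
  { rewrite Cmod_sqr. destruct H as [H|[H|[H|H]]]; rewrite H; unfold path; simpl; field. }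
  pose proof (Cmod_ge_0 w).
  assert (1 / 2 <= (1 - t) ^ 2 + t ^ 2 <= 1) by (pose proof (pow2_ge_0 (2 * t - 1)); nra).
  split; apply Rnot_lt_le; intros Hlt; nra.
Qed.

Lemma onsq_far w z : onsq w -> Cmod z < 1 / 2 -> 3 / 100 <= Cmod (w - z).
Proof. intros Hw Hz. apply onsq_Cmod in Hw. pose proof (Cmod_sub_le w z). lra. Qed.

Lemma onsq_neq w z : onsq w -> Cmod z < 1 / 2 -> (w - z)%C <> 0.
Proof. intros Hw Hz. pose proof (onsq_far w z Hw Hz). apply Cmod_gt_0. lra. Qed.

Lemma lform_lt p q z : p ^ 2 = 1 -> q ^ 2 = 1 -> Cmod z < 1 / 2 -> lform p q z < 3 / 4.
Proof.
  intros Hp Hq Hz. unfold lform.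
  assert (fst z ^ 2 + snd z ^ 2 < 1 / 4).
  { rewrite <- Cmod_sqr. pose proof (Cmod_ge_0 z). nra. }
  assert ((p * fst z + q * snd z) ^ 2 <= 2 * (fst z ^ 2 + snd z ^ 2)).
  { replace (fst z ^ 2 + snd z ^ 2) with (p ^ 2 * fst z ^ 2 + q ^ 2 * snd z ^ 2) by (rewrite Hp, Hq; ring).
    pose proof (pow2_ge_0 (p * fst z - q * snd z)). nra. }
  nra.
Qed.

(** The contour is contracted to [z] side by side; the connecting segments cancel, and the
    contracted contour has length of order [e] while [f] stays bounded near [z]. Thus a possible
    singularity at [z] is removable for the integral. *)
Lemma sq_vanish f z M d : Cmod z < 1 / 2 -> holo (fun w : C => disc w /\ w <> z) f -> 0 < d ->
  (forall w, w <> z -> Cmod (w - z) < d -> Cmod (f w) <= M) -> sq f = 0.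
Proof.
  intros Hz Hf Hd HM0. apply Cmod_eq_0.
  assert (HM' : exists M', 0 <= M' /\ forall w, w <> z -> Cmod (w - z) < d -> Cmod (f w) <= M').
  { exists (Rabs M). split. apply Rabs_pos. intros. eapply Rle_trans. apply HM0; auto. apply Rle_abs. }
  clear M HM0. destruct HM' as (M & HM0 & HM).
  destruct Cmod_v as (V0 & V1 & V2 & V3).
  assert (Hz' : Cmod z <= 3 / 4) by lra.
  assert (L : forall p q, p ^ 2 = 1 -> q ^ 2 = 1 -> lform p q z < 3 / 4) by (intros; apply lform_lt; auto).
  assert (Hall : forall e, 0 < e <= 1 -> 2 * e < d -> Cmod (sq f) <= 8 * e * M).
  { intros e He Hed.
    assert (E : sq f = (seg f (path z v0 e) (path z v1 e) + seg f (path z v1 e) (path z v2 e)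
       + seg f (path z v2 e) (path z v3 e) + seg f (path z v3 e) (path z v0 e))%C).
    { unfold sq.
      rewrite (proj1 (quad_deform f z Hf v0 v1 1 1 e V0 V1 Hz' ltac:(unfold lform; simpl; lra) ltac:(unfold lform; simpl; lra) ltac:(apply L; lra) He)).
      rewrite (proj1 (quad_deform f z Hf v1 v2 (-1) 1 e V1 V2 Hz' ltac:(unfold lform; simpl; lra) ltac:(unfold lform; simpl; lra) ltac:(apply L; lra) He)).
      rewrite (proj1 (quad_deform f z Hf v2 v3 (-1) (-1) e V2 V3 Hz' ltac:(unfold lform; simpl; lra) ltac:(unfold lform; simpl; lra) ltac:(apply L; lra) He)).
      rewrite (proj1 (quad_deform f z Hf v3 v0 1 (-1) e V3 V0 Hz' ltac:(unfold lform; simpl; lra) ltac:(unfold lform; simpl; lra) ltac:(apply L; lra) He)).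
      ring. }
    rewrite E.
    pose proof (quad_small f z Hf v0 v1 1 1 e M d V0 V1 Hz' ltac:(unfold lform; simpl; lra) ltac:(unfold lform; simpl; lra) ltac:(apply L; lra) He HM HM0 Hed).
    pose proof (quad_small f z Hf v1 v2 (-1) 1 e M d V1 V2 Hz' ltac:(unfold lform; simpl; lra) ltac:(unfold lform; simpl; lra) ltac:(apply L; lra) He HM HM0 Hed).
    pose proof (quad_small f z Hf v2 v3 (-1) (-1) e M d V2 V3 Hz' ltac:(unfold lform; simpl; lra) ltac:(unfold lform; simpl; lra) ltac:(apply L; lra) He HM HM0 Hed).
    pose proof (quad_small f z Hf v3 v0 1 (-1) e M d V3 V0 Hz' ltac:(unfold lform; simpl; lra) ltac:(unfold lform; simpl; lra) ltac:(apply L; lra) He HM HM0 Hed).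
    eapply Rle_trans. apply Cmod_triangle.
    pose proof (Cmod_triangle (seg f (path z v0 e) (path z v1 e) + seg f (path z v1 e) (path z v2 e)) (seg f (path z v2 e) (path z v3 e))).
    pose proof (Cmod_triangle (seg f (path z v0 e) (path z v1 e)) (seg f (path z v1 e) (path z v2 e))).
    lra. }
  apply Rle_antisym; [|apply Cmod_ge_0]. apply Rnot_lt_le. intros Hp.
  set (T := Cmod (sq f)) in *.
  set (e := Rmin 1 (Rmin (d / 4) (T / (16 * (M + 1))))).
  assert (He : 0 < e).
  { unfold e. repeat apply Rmin_pos; try lra. apply Rdiv_lt_0_compat; lra. }
  assert (He1 : e <= 1) by apply Rmin_l.
  assert (He2 : e <= d / 4) by (unfold e; eapply Rle_trans; [apply Rmin_r|apply Rmin_l]).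
  assert (He3 : e <= T / (16 * (M + 1))) by (unfold e; eapply Rle_trans; [apply Rmin_r|apply Rmin_r]).
  apply Rle_div_r in He3; [|lra].
  specialize (Hall e ltac:(lra) ltac:(lra)). nra.
Qed.

Definition scont (d : C -> C) : Prop := forall w, onsq w -> ccont d w.

Lemma scont_segs d : scont d -> segcont d v0 v1 /\ segcont d v1 v2 /\ segcont d v2 v3 /\ segcont d v3 v0.
Proof. intros H. repeat split; intros t Ht; apply H; exists t; auto. Qed.

Lemma sq_ext d d' : (forall w, onsq w -> d w = d' w) -> sq d = sq d'.
Proof.
  intros H. unfold sq. f_equal; [f_equal; [f_equal|]|]; apply seg_ext; intros t Ht; apply H; exists t; auto 6.
Qed.

Lemma sq_plus d d' : scont d -> scont d' -> sq (fun w => d w + d' w)%C = (sq d + sq d')%C.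
Proof.
  intros H H'. apply scont_segs in H. apply scont_segs in H'. unfold sq. rewrite !seg_plus by tauto. ring.
Qed.

Lemma sq_scal d c : scont d -> sq (fun w => c * d w)%C = (c * sq d)%C.
Proof. intros H. apply scont_segs in H. unfold sq. rewrite !seg_scal by tauto. ring. Qed.

Lemma sq_minus d d' : scont d -> scont d' -> sq (fun w => d w - d' w)%C = (sq d - sq d')%C.
Proof.
  intros H H'. rewrite (sq_ext _ (fun w => d w + (- (1)) * d' w)%C) by (intros; ring).
  rewrite sq_plus, sq_scal; auto. ring.
  intros w Hw. apply ccont_mult; auto using ccont_const.
Qed.

(** The factor 8 comes from four sides, each of length below 2. *)
Lemma sq_bound d M : scont d -> (forall w, onsq w -> Cmod (d w) <= M) -> Cmod (sq d) <= 8 * M.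
Proof.
  intros Hc HM. apply scont_segs in Hc. destruct Hc as (C0 & C1 & C2 & C3).
  assert (HM0 : 0 <= M).
  { eapply Rle_trans. apply Cmod_ge_0. apply (HM v0). exists 0. split. lra. left. rewrite path_0; auto. }
  destruct Cmod_v as (V0 & V1 & V2 & V3).
  assert (S : forall a b, Cmod a <= 3 / 4 -> Cmod b <= 3 / 4 -> segcont d a b ->
    (forall t, 0 <= t <= 1 -> Cmod (d (path a b t)) <= M) -> Cmod (seg d a b) <= 2 * M).
  { intros a b Ha Hb Hc HH. eapply Rle_trans. apply seg_bound; eauto.
    apply Rmult_le_compat_r; auto. pose proof (Cmod_minus_le b a). lra. }
  unfold sq.
  pose proof (S v0 v1 V0 V1 C0 ltac:(intros t Ht; apply HM; exists t; auto)).
  pose proof (S v1 v2 V1 V2 C1 ltac:(intros t Ht; apply HM; exists t; auto)).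
  pose proof (S v2 v3 V2 V3 C2 ltac:(intros t Ht; apply HM; exists t; auto)).
  pose proof (S v3 v0 V3 V0 C3 ltac:(intros t Ht; apply HM; exists t; auto 6)).
  pose proof (Cmod_triangle (seg d v0 v1 + seg d v1 v2 + seg d v2 v3) (seg d v3 v0)).
  pose proof (Cmod_triangle (seg d v0 v1 + seg d v1 v2) (seg d v2 v3)).
  pose proof (Cmod_triangle (seg d v0 v1) (seg d v1 v2)). lra.
Qed.

(** The value is 2 pi i; the formulas below divide by [kappa], for which [kappa <> 0] suffices. *)
Definition kappa : C := sq (fun w => / w)%C.

(** By the symmetry of the square all four sides contribute the same integral of [g], whose
    imaginary part is at least 1 because the denominator [(1 - t) ^ 2 + t ^ 2] is at most 1. *)
Lemma kappa_neq_0 : kappa <> 0.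
Proof.
  pose (g := fun t : R => ((2 * t - 1) / ((1 - t) ^ 2 + t ^ 2), 1 / ((1 - t) ^ 2 + t ^ 2)) : C).
  assert (HD : forall t, 0 < (1 - t) ^ 2 + t ^ 2) by (intros; nra).
  assert (Hc : segcont (fun w => / w)%C v0 v1 /\ segcont (fun w => / w)%C v1 v2 /\
    segcont (fun w => / w)%C v2 v3 /\ segcont (fun w => / w)%C v3 v0).
  { apply scont_segs. intros w Hw. apply (ccont_inv (fun w => w)). 2: apply ccont_id.
    apply onsq_Cmod in Hw. apply Cmod_gt_0. lra. }
  assert (S : forall a b, segcont (fun w => / w)%C a b ->
     (forall t, 0 <= t <= 1 -> ((b - a) * / path a b t)%C = g t) -> seg (fun w => / w)%C a b = Cint g).
  { intros a b H HE. unfold seg. rewrite <- Cint_scal by (apply segcont_pcont; auto). apply Cint_ext. auto. }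
  assert (Hpg : pcont g).
  { intros t _. split; apply (ex_derive_continuous (V := R_NormedModule)); unfold g; simpl; auto_derive;
    specialize (HD t); simpl in HD; lra. }
  assert (E : kappa = (4 * Cint g)%C).
  { unfold kappa, sq. rewrite !S; try tauto. ring.
    all: intros t Ht; specialize (HD t); unfold g, path; apply injective_projections; simpl; field; nra. }
  intros E0. rewrite E in E0. apply (f_equal snd) in E0. simpl in E0.
  assert (H1 : 1 <= RInt (fun t => snd (g t)) 0 1).
  { assert (HE : RInt (fun _ => 1) 0 1 = 1).
    { rewrite RInt_const. change ((1 - 0) * 1 = 1). ring. }
    apply Rle_trans with (RInt (fun _ => 1) 0 1). lra. apply RInt_le. lra. apply ex_RInt_const.
    apply (pcont_ex_RInt g 0 1); auto; lra.
    intros t Ht. unfold g. simpl snd. specialize (HD t). apply Rle_div_r; nra. }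
  unfold g in H1; simpl in H1. lra.
Qed.

(** * Cauchy integrals over the square, Cauchy's formula and the estimates it gives *)

Lemma cder_of_quadratic f z l A r : 0 < r ->
  (forall h, Cmod h < r -> Cmod (f (z + h)%C - f z - l * h) <= A * Cmod h ^ 2) -> cder f z l.
Proof.
  intros Hr H e He.
  exists (Rmin r (e / (Rabs A + 1))).
  pose proof (Rabs_pos A). pose proof (Rle_abs A).
  split. { apply Rmin_pos; auto. apply Rdiv_lt_0_compat; lra. }
  intros h Hh.
  assert (Hr1 : Cmod h < r) by (eapply Rlt_le_trans; [apply Hh|apply Rmin_l]).
  assert (Hr2 : Cmod h < e / (Rabs A + 1)) by (eapply Rlt_le_trans; [apply Hh|apply Rmin_r]).
  apply Rlt_div_r in Hr2; [|lra]. specialize (H h Hr1). pose proof (Cmod_ge_0 h).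
  assert (A * Cmod h ^ 2 <= (Rabs A + 1) * Cmod h ^ 2) by (apply Rmult_le_compat_r; nra). nra.
Qed.

Lemma scont_mult d d' : scont d -> scont d' -> scont (fun w => d w * d' w)%C.
Proof. intros H H' w Hw. apply ccont_mult; auto. Qed.

Lemma scont_kernel z : Cmod z < 1 / 2 -> scont (fun w => / (w - z))%C.
Proof.
  intros Hz w Hw. apply (ccont_inv (fun w => w - z)%C). apply onsq_neq; auto.
  apply ccont_minus; auto using ccont_id, ccont_const.
Qed.

(** The bound is the inverse of [53 / 100 - 1 / 2], the gap between the contour and the points
    [z]. *)
Lemma Cmod_kernel w z : onsq w -> Cmod z < 1 / 2 -> Cmod (/ (w - z)) <= 100 / 3.
Proof.
  intros Hw Hz. rewrite Cmod_inv by (apply onsq_neq; auto).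
  pose proof (onsq_far w z Hw Hz). replace (100 / 3) with (/ (3 / 100)) by field. apply Rinv_le_contravar; lra.
Qed.

(** With [A], [B], [D] the kernels at [x], [y], [c], one has [A - B = (x - y) * A * B], and
    [A * B - D * D] splits into two differences proportional to [x - c] and [y - c]. The case
    [y = c] yields the derivative; the general case yields injectivity near [c]. *)
Lemma cauchy_integral_two_points d M x y c : scont d -> (forall w, onsq w -> Cmod (d w) <= M) ->
  Cmod x < 1 / 2 -> Cmod y < 1 / 2 -> Cmod c < 1 / 2 ->
  Cmod (sq (fun w => d w * / (w - x))%C - sq (fun w => d w * / (w - y))%C
        - sq (fun w => d w * (/ (w - c) * / (w - c)))%C * (x - y))
    <= 8 * (M * (100 / 3) ^ 3) * (Cmod (x - c) + Cmod (y - c)) * Cmod (x - y).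
Proof.
  intros Hc HM Hx Hy Hcc.
  pose proof (scont_kernel x Hx) as Kx. pose proof (scont_kernel y Hy) as Ky. pose proof (scont_kernel c Hcc) as Kc.
  assert (HM0 : 0 <= M).
  { eapply Rle_trans. apply Cmod_ge_0. apply (HM v0). exists 0. split. lra. left. rewrite path_0; auto. }
  rewrite <- sq_minus by (apply scont_mult; auto).
  rewrite (Cmult_comm _ (x - y)).
  rewrite <- sq_scal by (repeat apply scont_mult; auto).
  rewrite <- sq_minus.
  2: { intros w Hw. apply ccont_minus; apply ccont_mult; auto. }
  2: { intros w Hw. apply ccont_mult. apply ccont_const. repeat apply ccont_mult; auto. }
  replace (8 * (M * (100 / 3) ^ 3) * (Cmod (x - c) + Cmod (y - c)) * Cmod (x - y)) with
    (8 * (M * ((100 / 3) ^ 3 * (Cmod (x - c) + Cmod (y - c)) * Cmod (x - y)))) by ring.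
  apply sq_bound.
  { intros w Hw. apply ccont_minus. apply ccont_minus; apply ccont_mult; auto.
    apply ccont_mult. apply ccont_const. repeat apply ccont_mult; auto. }
  intros w Hw.
  pose proof (onsq_neq w x Hw Hx). pose proof (onsq_neq w y Hw Hy). pose proof (onsq_neq w c Hw Hcc).
  set (A := (/ (w - x))%C). set (B := (/ (w - y))%C). set (D := (/ (w - c))%C).
  replace (d w * A - d w * B - (x - y) * (d w * (D * D)))%C with
    (d w * ((A * B * D * (x - c) + B * D * D * (y - c)) * (x - y)))%C.
  2: { unfold A, B, D. field. auto. }
  rewrite Cmod_mult. apply Rmult_le_compat; auto using Cmod_ge_0.
  rewrite Cmod_mult. apply Rmult_le_compat_r. apply Cmod_ge_0.
  eapply Rle_trans. apply Cmod_triangle. rewrite !Cmod_mult.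
  pose proof (Cmod_kernel w x Hw Hx) as HA. pose proof (Cmod_kernel w y Hw Hy) as HB. pose proof (Cmod_kernel w c Hw Hcc) as HD.
  fold A in HA. fold B in HB. fold D in HD.
  pose proof (Cmod_ge_0 A). pose proof (Cmod_ge_0 B). pose proof (Cmod_ge_0 D).
  pose proof (Cmod_ge_0 (x - c)). pose proof (Cmod_ge_0 (y - c)).
  assert (Cmod A * Cmod B * Cmod D <= (100 / 3) ^ 3).
  { simpl. rewrite Rmult_1_r, <- Rmult_assoc. repeat apply Rmult_le_compat; auto. apply Rmult_le_pos; auto. }
  assert (Cmod B * Cmod D * Cmod D <= (100 / 3) ^ 3).
  { simpl. rewrite Rmult_1_r, <- Rmult_assoc. repeat apply Rmult_le_compat; auto. apply Rmult_le_pos; auto. }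
  rewrite Rmult_plus_distr_l. apply Rplus_le_compat; apply Rmult_le_compat_r; auto.
Qed.

Lemma cauchy_integral_der d M z : scont d -> (forall w, onsq w -> Cmod (d w) <= M) -> Cmod z < 1 / 2 ->
  cder (fun z => sq (fun w => d w * / (w - z))%C) z (sq (fun w => d w * (/ (w - z) * / (w - z)))%C).
Proof.
  intros Hc HM Hz. apply cder_of_quadratic with (8 * (M * (100 / 3) ^ 3)) (1 / 2 - Cmod z). lra.
  intros h Hh. pose proof (Cmod_triangle z h).
  pose proof (cauchy_integral_two_points d M (z + h) z z Hc HM ltac:(lra) Hz Hz) as H1.
  replace (z + h - z)%C with h in H1 by ring. replace (z - z)%C with (RtoC 0) in H1 by ring.
  rewrite Cmod_0 in H1. lra.
Qed.

Lemma cauchy_integral_der2 d M z : scont d -> (forall w, onsq w -> Cmod (d w) <= M) -> Cmod z < 1 / 2 ->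
  cder (fun z => sq (fun w => d w * (/ (w - z) * / (w - z)))%C) z
    (sq (fun w => d w * (2 * (/ (w - z) * / (w - z) * / (w - z))))%C).
Proof.
  intros Hc HM Hz.
  assert (HM0 : 0 <= M).
  { eapply Rle_trans. apply Cmod_ge_0. apply (HM v0). exists 0. split. lra. left. rewrite path_0; auto. }
  apply cder_of_quadratic with (8 * (M * (5 * (100 / 3) ^ 5))) (1 / 2 - Cmod z). lra.
  intros h Hh. pose proof (Cmod_triangle z h).
  assert (Hzh : Cmod (z + h) < 1 / 2) by lra.
  pose proof (scont_kernel z Hz) as Kz. pose proof (scont_kernel _ Hzh) as Kh.
  rewrite <- sq_minus by (repeat apply scont_mult; auto).
  rewrite (Cmult_comm _ h).
  assert (K3 : scont (fun w => d w * (2 * (/ (w - z) * / (w - z) * / (w - z))))%C).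
  { intros w Hw. apply ccont_mult; auto. apply ccont_mult. apply ccont_const. repeat apply ccont_mult; auto. }
  rewrite <- sq_scal by auto.
  rewrite <- sq_minus.
  2: { intros w Hw. apply ccont_minus; repeat apply ccont_mult; auto. }
  2: { intros w Hw. apply ccont_mult. apply ccont_const. apply K3; auto. }
  replace (8 * (M * (5 * (100 / 3) ^ 5)) * Cmod h ^ 2) with (8 * (M * (5 * (100 / 3) ^ 5 * Cmod h ^ 2))) by ring.
  apply sq_bound.
  { intros w Hw. apply ccont_minus. apply ccont_minus; repeat apply ccont_mult; auto.
    apply ccont_mult. apply ccont_const. apply K3; auto. }
  intros w Hw. pose proof (onsq_neq w z Hw Hz) as N1. pose proof (onsq_neq w _ Hw Hzh) as N2.
  set (A := (/ (w - z))%C). set (B := (/ (w - (z + h)))%C).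
  (* The five kernels account for [(100 / 3) ^ 5], and the linear factor [3 * (w - z) - 2 * h] has
     modulus at most 5. *)
  replace (d w * (B * B) - d w * (A * A) - h * (d w * (2 * (A * A * A))))%C with
    (d w * (A * A * A * B * B * (3 * (w - z) - 2 * h) * (h * h)))%C.
  2: { unfold A, B. field. auto. }
  rewrite Cmod_mult. apply Rmult_le_compat; auto using Cmod_ge_0.
  rewrite (Cmod_mult _ (h * h)). replace (Cmod h ^ 2) with (Cmod (h * h)) by (rewrite Cmod_mult; ring).
  apply Rmult_le_compat_r. apply Cmod_ge_0.
  rewrite Cmod_mult, (Rmult_comm 5). apply Rmult_le_compat; auto using Cmod_ge_0.
  - rewrite !Cmod_mult. simpl. rewrite Rmult_1_r, <- !Rmult_assoc.
    pose proof (Cmod_kernel w z Hw Hz) as HA. pose proof (Cmod_kernel w _ Hw Hzh) as HB.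
    fold A in HA. fold B in HB. pose proof (Cmod_ge_0 A). pose proof (Cmod_ge_0 B).
    repeat apply Rmult_le_compat; auto; repeat apply Rmult_le_pos; auto.
  - eapply Rle_trans. apply Cmod_minus_le. rewrite !Cmod_mult, !Cmod_R, !Rabs_pos_eq by lra.
    pose proof (Cmod_minus_le w z). apply onsq_Cmod in Hw. pose proof (Cmod_ge_0 z). lra.
Qed.

(** The derivative in [z] is the integral of [/ (w - z) ^ 2], which has the primitive [- / (w - z)]
    in [w] and vanishes over the closed contour; so the integral is constant along the segment from
    0 to [z]. *)
Lemma kernel_const z : Cmod z < 1 / 2 -> sq (fun w => / (w - z))%C = kappa.
Proof.
  intros Hz.
  pose (k := fun z => sq (fun w => 1 * / (w - z))%C).
  assert (Hk : forall x, Cmod x < 1 / 2 -> cder k x 0).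
  { intros x Hx. eapply cder_eq; [|apply (cauchy_integral_der (fun _ => 1%C) 1); auto].
    2: { intros w _. apply ccont_const. } 2: { intros. rewrite Cmod_1. lra. }
    pose proof (scont_kernel x Hx) as Kx.
    assert (HF : forall a b, (forall t, 0 <= t <= 1 -> onsq (path a b t)) ->
      seg (fun w => 1 * (/ (w - x) * / (w - x)))%C a b = (- / (b - x) - - / (a - x))%C).
    { intros a b Hab. apply (seg_FTC (fun w => - / (w - x))%C).
      - intros t Ht. specialize (Hab t Ht). pose proof (onsq_neq _ x Hab Hx).
        eapply cder_eq; [|apply cder_opp; apply (cder_comp (fun w => / w)%C (fun w => w - x)%C);
          [apply cder_inv; auto|apply cder_minus; [apply cder_id|apply cder_const]]].
        field. auto.
      - intros t Ht. apply ccont_mult. apply ccont_const. apply ccont_mult; apply Kx; auto. }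
    unfold sq. rewrite !HF. ring.
    all: intros t Ht; exists t; auto 6. }
  assert (E : seg (fun _ => RtoC 0) 0 z = (k z - k 0)%C).
  { apply seg_FTC.
    - intros t Ht. apply Hk.
      eapply Rle_lt_trans; [apply Cmod_path_le with (r := Cmod z)|apply Hz]; auto; try lra.
      rewrite Cmod_0. apply Cmod_ge_0.
    - intros t _. apply ccont_const. }
  assert (E0 : seg (fun _ => RtoC 0) 0 z = 0).
  { rewrite (seg_ext _ (fun _ => 0 * 0)%C) by (intros; ring). rewrite seg_scal. ring.
    intros t _. apply ccont_const. }
  unfold kappa. rewrite (sq_ext _ (fun w => 1 * / (w - z))%C) by (intros; ring).
  rewrite (sq_ext (fun w => / w)%C (fun w => 1 * / (w - 0))%C).
  2: { intros w Hw. replace (w - 0)%C with w by ring. ring. }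
  change (k z = k 0%C). apply Cmod_eq_sub. rewrite <- E, E0. apply Cmod_0.
Qed.

Lemma holo_quotient f z : holo disc f -> holo (fun w : C => disc w /\ w <> z) (fun w => (f w - f z) * / (w - z))%C.
Proof.
  intros Hf w [Hw Hn]. destruct (Hf w Hw) as (l & Hl). eexists.
  apply cder_mult. apply cder_minus. apply Hl. apply cder_const.
  apply (cder_comp (fun w => / w)%C (fun w => w - z)%C). apply cder_inv.
  intros E. apply Hn. apply Cmod_eq_sub. rewrite E. apply Cmod_0.
  apply cder_minus; [apply cder_id|apply cder_const].
Qed.

Lemma holo_disc_scont f : holo disc f -> scont f.
Proof.
  intros Hf w Hw. apply onsq_Cmod in Hw. apply (holo_ccont disc); auto. unfold disc; lra.
Qed.

(** The difference quotient of [f] at [z] is bounded near [z], so [sq_vanish] makes its integral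
    vanish, and [kernel_const] evaluates the part with [f z]. *)
Lemma cauchy_formula f z : holo disc f -> Cmod z < 1 / 2 ->
  sq (fun w => f w * / (w - z))%C = (f z * kappa)%C.
Proof.
  intros Hf Hz.
  destruct (Hf z) as (l & Hl). { unfold disc; lra. }
  destruct (Hl 1 Rlt_0_1) as (d & Hd & HH).
  assert (E : sq (fun w => (f w - f z) * / (w - z))%C = 0).
  { apply sq_vanish with z (Cmod l + 1) d; auto. apply holo_quotient; auto.
    intros w Hn Hw. specialize (HH _ Hw). replace (z + (w - z))%C with w in HH by ring.
    assert (Hwz : (w - z)%C <> 0) by (apply Cmod_gt_0, Cneq_sub; auto).
    apply Cmod_gt_0 in Hwz as Hp.
    rewrite Cmod_mult, Cmod_inv by auto. apply Rle_div_l; auto.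
    pose proof (Cmod_sub_le (f w - f z) (l * (w - z))). rewrite Cmod_mult in H. lra. }
  pose proof (scont_kernel z Hz) as Kz. pose proof (holo_disc_scont f Hf) as Sf.
  rewrite (sq_ext _ (fun w => f w * / (w - z) - f z * / (w - z))%C) in E by (intros; ring).
  rewrite sq_minus, sq_scal, kernel_const in E; auto.
  - replace (sq (fun w => f w * / (w - z))%C) with ((sq (fun w => f w * / (w - z)) - f z * kappa) + f z * kappa)%C by ring.
    rewrite E. ring.
  - apply scont_mult; auto.
  - intros w Hw. apply ccont_mult; auto using ccont_const.
Qed.

Lemma choice_fun {A B : Type} (R : A -> B -> Prop) :
  (forall x, exists y, R x y) -> exists f, forall x, R x (f x).
Proof.
  intros H. exists (fun x => proj1_sig (constructive_indefinite_description _ (H x))).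
  intros x. apply proj2_sig.
Qed.

(** Ultralimits stand in for compactness: a sequence along which the modulus is unbounded, or
    approaches its supremum, has an ultralimit in the closed disc, and continuity carries the values
    over. *)
Lemma compact_max (f : C -> C) r : 0 <= r -> (forall w, Cmod w <= r -> ccont f w) ->
  exists w0, Cmod w0 <= r /\ forall w, Cmod w <= r -> Cmod (f w) <= Cmod (f w0).
Proof.
  intros Hr Hc.
  destruct some_ultrafilter as (U & HU).
  assert (Hlim : forall x : nat -> C, (forall n, Cmod (x n) <= r) ->
    exists l, Cmod l <= r /\ ulimR U (fun n => Cmod (f (x n))) (Cmod (f l))).
  { intros x Hx. destruct (ulim_bound_exists U HU x r) as (l & Hl). apply uf_true; auto.
    assert (Cmod l <= r) by (apply (ulim_Cmod_le U HU x); auto; apply uf_true; auto).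
    exists l. split; auto. apply ulim_Cmod; auto. apply ccont_ulim; auto. }
  assert (Hb : exists M, forall w, Cmod w <= r -> Cmod (f w) <= M).
  { apply NNPP. intros Hn.
    assert (Hx : forall n : nat, exists w, Cmod w <= r /\ INR n < Cmod (f w)).
    { intros n. apply NNPP. intros Hn'. apply Hn. exists (INR n). intros w Hw.
      apply Rnot_lt_le. intros H. apply Hn'. exists w. auto. }
    apply choice_fun in Hx. destruct Hx as (x & Hx).
    destruct (Hlim x) as (l & _ & Hl). intros; apply Hx.
    destruct (archimed_cor1 (/ (Cmod (f l) + 1))) as (N & HN & HN0).
    { apply Rinv_0_lt_compat. pose proof (Cmod_ge_0 (f l)). lra. }
    destruct (uf_ex U HU _ (uf_and U HU _ _ (Hl 1 Rlt_0_1) (uf_eventually U HU N))) as (n & H1 & H2).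
    destruct (Hx n) as [_ H3]. apply Rabs_def2 in H1. apply le_INR in H2.
    assert (Cmod (f l) + 1 < INR N).
    { apply Rinv_lt_cancel; auto. apply lt_0_INR; auto. }
    lra. }
  destruct Hb as (M & HM).
  destruct (completeness (fun s => exists w, Cmod w <= r /\ s = Cmod (f w))) as (s & Hs1 & Hs2).
  - exists M. intros s (w & Hw & ->). auto.
  - exists (Cmod (f 0)), 0. rewrite Cmod_0. auto.
  - assert (Hx : forall n : nat, exists w, Cmod w <= r /\ s - / INR (S n) < Cmod (f w)).
    { intros n. apply NNPP. intros Hn.
      assert (0 < / INR (S n)) by (apply Rinv_0_lt_compat, lt_0_INR; lia).
      assert (s <= s - / INR (S n)); [|lra]. apply Hs2. intros s' (w & Hw & ->).
      apply Rnot_lt_le. intros H'. apply Hn. eauto. }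
    apply choice_fun in Hx. destruct Hx as (x & Hx).
    destruct (Hlim x) as (l & Hl & Hl'). intros; apply Hx.
    exists l. split; auto. intros w Hw. apply Rle_trans with s. apply Hs1; eauto.
    apply Rnot_lt_le. intros Hlt.
    destruct (archimed_cor1 ((s - Cmod (f l)) / 2)) as (N & HN & HN0). lra.
    destruct (uf_ex U HU _ (uf_and U HU _ _ (Hl' ((s - Cmod (f l)) / 2) ltac:(lra)) (uf_eventually U HU N))) as (n & H1 & H2).
    destruct (Hx n) as [_ H3]. apply Rabs_def2 in H1.
    assert (/ INR (S n) <= / INR N).
    { apply Rinv_le_contravar. apply lt_0_INR; auto. apply le_INR. lia. }
    lra.
Qed.

Lemma holo_disc_bounded f r : holo disc f -> 0 <= r < 1 -> exists M, forall w, Cmod w <= r -> Cmod (f w) <= M.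
Proof.
  intros Hf Hr. destruct (compact_max f r) as (w0 & _ & H). lra.
  intros w Hw. apply (holo_ccont disc); auto. unfold disc; lra. eauto.
Qed.

(** After multiplication by [kappa], all three quantities are contour integrals with explicit
    kernels. It matters that [K] is the same for all [f], since the estimates are applied to whole
    sequences of functions. *)
Lemma cauchy_estimates : exists K, 0 < K /\ forall f M, holo disc f ->
  (forall w, onsq w -> Cmod (f w) <= M) ->
  forall x y c l, Cmod x < 1 / 2 -> Cmod y < 1 / 2 -> Cmod c < 1 / 2 -> cder f c l ->
  Cmod (f x) <= K * M /\ Cmod (f x - f y) <= K * M * Cmod (x - y) /\
  Cmod (f x - f y - l * (x - y)) <= K * M * (Cmod (x - c) + Cmod (y - c)) * Cmod (x - y).
Proof.
  pose proof kappa_neq_0 as Hk. pose proof Hk as Hkp. apply Cmod_gt_0 in Hkp.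
  exists (8 * (100 / 3) ^ 3 / Cmod kappa). split.
  { apply Rdiv_lt_0_compat; auto. lra. }
  intros f M Hf HM x y c l Hx Hy Hc Hl.
  pose proof (holo_disc_scont f Hf) as Sf.
  assert (HM0 : 0 <= M).
  { eapply Rle_trans. apply Cmod_ge_0. apply (HM v0). exists 0. split. lra. left. rewrite path_0; auto. }
  assert (Hdiv : forall a B, Cmod (a * kappa) <= 8 * (100 / 3) ^ 3 * B -> Cmod a <= 8 * (100 / 3) ^ 3 / Cmod kappa * B).
  { intros a B H. rewrite Cmod_mult in H.
    replace (8 * (100 / 3) ^ 3 / Cmod kappa * B) with (8 * (100 / 3) ^ 3 * B / Cmod kappa) by (field; lra).
    apply Rle_div_r; auto. }
  assert (El : (l * kappa)%C = sq (fun w => f w * (/ (w - c) * / (w - c)))%C).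
  { apply (cder_unique (fun z => sq (fun w => f w * / (w - z))%C) c).
    - apply cder_ext with (fun z => kappa * f z)%C (1 / 2 - Cmod c). lra.
      + intros w Hw. rewrite cauchy_formula; auto. ring. pose proof (Cmod_sub_le w c). lra.
      + rewrite Cmult_comm. apply cder_scal. auto.
    - apply cauchy_integral_der with M; auto. }
  split; [|split].
  - apply Hdiv. rewrite <- cauchy_formula by auto.
    apply Rle_trans with (8 * (M * (100 / 3))). 2: nra.
    apply sq_bound. apply scont_mult; auto. apply scont_kernel; auto.
    intros w Hw. rewrite Cmod_mult. apply Rmult_le_compat; auto using Cmod_ge_0, Cmod_kernel.
  - rewrite Rmult_assoc. apply Hdiv.
    replace ((f x - f y) * kappa)%C with (f x * kappa - f y * kappa)%C by ring.
    rewrite <- !cauchy_formula by auto.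
    pose proof (scont_kernel x Hx) as Kx. pose proof (scont_kernel y Hy) as Ky.
    rewrite <- sq_minus by (apply scont_mult; auto).
    apply Rle_trans with (8 * (M * ((100 / 3) * (100 / 3) * Cmod (x - y)))).
    2: { assert (0 <= M * Cmod (x - y)) by (apply Rmult_le_pos; auto using Cmod_ge_0). nra. }
    apply sq_bound.
    { intros w Hw. apply ccont_minus; apply ccont_mult; auto. }
    intros w Hw. pose proof (onsq_neq w x Hw Hx). pose proof (onsq_neq w y Hw Hy).
    replace (f w * / (w - x) - f w * / (w - y))%C with (f w * (/ (w - x) * / (w - y) * (x - y)))%C by (field; auto).
    rewrite Cmod_mult. apply Rmult_le_compat; auto using Cmod_ge_0.
    rewrite Cmod_mult. apply Rmult_le_compat_r; auto using Cmod_ge_0.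
    rewrite Cmod_mult. apply Rmult_le_compat; auto using Cmod_ge_0, Cmod_kernel.
  - replace (8 * (100 / 3) ^ 3 / Cmod kappa * M * (Cmod (x - c) + Cmod (y - c)) * Cmod (x - y)) with
      (8 * (100 / 3) ^ 3 / Cmod kappa * (M * (Cmod (x - c) + Cmod (y - c)) * Cmod (x - y))) by ring.
    apply Hdiv.
    replace ((f x - f y - l * (x - y)) * kappa)%C with (f x * kappa - f y * kappa - (l * kappa) * (x - y))%C by ring.
    rewrite El, <- !cauchy_formula by auto.
    eapply Rle_trans. apply cauchy_integral_two_points with (M := M); auto. right; ring.
Qed.

Lemma derivative_cder_0 f f' : holo disc f -> (forall z, Cmod z < 1 / 2 -> cder f z (f' z)) ->
  exists l, cder f' 0 l.
Proof.
  intros Hf Hf'. pose proof kappa_neq_0 as Hk.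
  destruct (holo_disc_bounded f (3 / 4) Hf ltac:(lra)) as (M & HM).
  assert (HM' : forall w, onsq w -> Cmod (f w) <= M) by (intros w Hw; apply HM, onsq_Cmod, Hw).
  pose proof (holo_disc_scont f Hf) as Sf.
  eexists. apply cder_ext with (fun z => / kappa * sq (fun w => f w * (/ (w - z) * / (w - z))))%C (1 / 2). lra.
  - intros z Hz. replace (z - 0)%C with z in Hz by ring.
    apply (cder_unique f z); auto.
    apply cder_ext with (fun z => / kappa * sq (fun w => f w * / (w - z)))%C (1 / 2 - Cmod z). lra.
    + intros w Hw. rewrite cauchy_formula; auto. field; auto. pose proof (Cmod_sub_le w z). lra.
    + apply cder_scal. apply cauchy_integral_der with M; auto.
  - apply cder_scal. apply cauchy_integral_der2 with M; auto. rewrite Cmod_0. lra.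
Qed.

(** Near 0 the quotient is given by the Cauchy integral of [f w / w]: as
    [z / (w * (w - z)) = / (w - z) - / w] and [f 0 = 0], Cauchy's formula at [z] and at 0 shows that
    [z] times it is [f z]. *)
Lemma divide_at_0 f : holo disc f -> f 0 = 0 ->
  exists f1, holo disc f1 /\ forall z, disc z -> f z = (z * f1 z)%C.
Proof.
  intros Hf H0. pose proof kappa_neq_0 as Hk.
  destruct (holo_disc_bounded f (3 / 4) Hf ltac:(lra)) as (M & HM).
  pose proof (holo_disc_scont f Hf) as Sf.
  assert (Hz0 : Cmod 0 < 1 / 2) by (rewrite Cmod_0; lra).
  pose proof (scont_kernel 0 Hz0) as K0.
  pose (g := fun w => (f w * / (w - 0))%C).
  assert (Hg : forall w, onsq w -> Cmod (g w) <= M * (100 / 3)).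
  { intros w Hw. unfold g. rewrite Cmod_mult.
    apply Rmult_le_compat; auto using Cmod_ge_0, Cmod_kernel. apply HM, onsq_Cmod, Hw. }
  assert (Sg : scont g) by (apply scont_mult; auto).
  pose (q := fun z => (/ kappa * sq (fun w => g w * / (w - z)))%C).
  assert (Hq : forall z, Cmod z < 1 / 2 -> exists l, cder q z l).
  { intros z Hz. eexists. apply cder_scal. apply cauchy_integral_der with (M * (100 / 3)); auto. }
  assert (Eq : forall z, Cmod z < 1 / 2 -> f z = (z * q z)%C).
  { intros z Hz. pose proof (scont_kernel z Hz) as Kz. unfold q.
    replace (z * (/ kappa * sq (fun w => g w * / (w - z))))%C with (/ kappa * (z * sq (fun w => g w * / (w - z))))%C by ring.
    rewrite <- sq_scal by (apply scont_mult; auto).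
    rewrite (sq_ext _ (fun w => f w * / (w - z) - f w * / (w - 0))%C).
    - rewrite sq_minus by (apply scont_mult; auto). rewrite !cauchy_formula by auto. rewrite H0. field. auto.
    - intros w Hw. unfold g. pose proof (onsq_neq w z Hw Hz). pose proof (onsq_neq w 0 Hw Hz0) as Hw0.
      replace (w - 0)%C with w in * by ring. field; auto. }
  exists (fun z : C => if excluded_middle_informative (z = RtoC 0) then q 0 else (f z / z)%C).
  split.
  - intros z Hz. destruct (excluded_middle_informative (z = RtoC 0)) as [->|Hn].
    + destruct (Hq 0 Hz0) as (l & Hl). exists l.
      apply cder_ext with q (1 / 2); auto. lra. intros w Hw. replace (w - 0)%C with w in Hw by ring.
      destruct (excluded_middle_informative (w = RtoC 0)) as [->|Hn]; auto.
      rewrite (Eq w Hw). field; auto.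
    + destruct (Hf z Hz) as (l & Hl). eexists.
      apply Cmod_gt_0 in Hn as Hp.
      apply cder_ext with (fun w => f w / w)%C (Cmod z); auto.
      * intros w Hw. destruct (excluded_middle_informative (w = RtoC 0)) as [->|Hn']; auto.
        exfalso. replace (0 - z)%C with (- z)%C in Hw by ring. rewrite Cmod_opp in Hw. lra.
      * apply cder_div; auto. apply Hl. apply cder_id.
  - intros z Hz. destruct (excluded_middle_informative (z = RtoC 0)) as [->|Hn].
    + rewrite H0. ring.
    + field; auto.
Qed.

(** * Local estimates and the identity theorem *)

Definition in_ball (a : C) (r : R) (w : C) : Prop := Cmod (w - a) < r.

Lemma ball_rescale f a r : 0 < r -> holo (in_ball a r) f -> holo disc (fun w => f (a + r * w)%C).
Proof.
  intros Hr Hf w Hw. destruct (Hf (a + r * w)%C) as (l & Hl).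
  { unfold in_ball. replace (a + r * w - a)%C with (r * w)%C by ring.
    rewrite Cmod_mult, Cmod_R, Rabs_pos_eq by lra. unfold disc in Hw. nra. }
  exists (l * (0 + r * 1))%C. apply (cder_comp f (fun w => a + r * w)%C); auto.
  apply cder_plus. apply cder_const. apply cder_scal, cder_id.
Qed.

Lemma ball_rescale_cder f a r w l : cder f (a + r * w)%C l -> cder (fun w => f (a + r * w)%C) w (l * r)%C.
Proof.
  intros Hl. eapply cder_eq; [|apply (cder_comp f (fun w => a + r * w)%C); [apply Hl|]].
  2: { apply cder_plus. apply cder_const. apply cder_scal, cder_id. } ring.
Qed.

Lemma unscale (a x : C) (r : R) : 0 < r -> (a + r * ((x - a) / r))%C = x.
Proof.
  intros Hr. assert (RtoC r <> 0) by (intros E; apply RtoC_inj in E; lra). field. auto.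
Qed.

Lemma Cmod_unscale (a x : C) (r : R) : 0 < r -> Cmod ((x - a) / r) = Cmod (x - a) / r.
Proof.
  intros Hr. assert (RtoC r <> 0) by (intros E; apply RtoC_inj in E; lra).
  rewrite Cmod_div, Cmod_R, Rabs_pos_eq; auto. lra.
Qed.

(** The constant [K] survives the rescaling of [f], [a] and [r]. The second estimate compares [f]
    with its linear part at [c] between any two points; the bound on [l] is read off the first one
    for small increments. *)
Lemma ball_estimates : exists K, 0 < K /\ forall f M a r, 0 < r -> holo (in_ball a r) f ->
  (forall w, in_ball a r w -> Cmod (f w) <= M) ->
  forall x y c l, in_ball a (r / 2) x -> in_ball a (r / 2) y -> in_ball a (r / 2) c -> cder f c l ->
  Cmod (f x - f y) <= K * M / r * Cmod (x - y) /\
  Cmod (f x - f y - l * (x - y)) <= K * M / r ^ 2 * (Cmod (x - c) + Cmod (y - c)) * Cmod (x - y) /\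
  Cmod l <= K * M / r.
Proof.
  destruct cauchy_estimates as (K & HK & HE). exists K. split; auto.
  intros f M a r Hr Hf HM x y c l Hx Hy Hc Hl.
  assert (Hrc : RtoC r <> 0) by (intros E; apply RtoC_inj in E; lra).
  assert (Hsc : forall z, in_ball a (r / 2) z -> Cmod ((z - a) / r) < 1 / 2).
  { intros z Hz. rewrite Cmod_unscale by auto. apply Rlt_div_l; auto. unfold in_ball in Hz. lra. }
  pose proof (HE (fun w => f (a + r * w)%C) M (ball_rescale f a r Hr Hf)) as H.
  assert (HM' : forall w, onsq w -> Cmod (f (a + r * w)%C) <= M).
  { intros w Hw. apply HM. unfold in_ball. replace (a + r * w - a)%C with (r * w)%C by ring.
    rewrite Cmod_mult, Cmod_R, Rabs_pos_eq by lra. apply onsq_Cmod in Hw. nra. }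
  specialize (H HM').
  assert (H0 : forall x y c l, in_ball a (r / 2) x -> in_ball a (r / 2) y -> in_ball a (r / 2) c -> cder f c l ->
    Cmod (f x - f y) <= K * M / r * Cmod (x - y) /\
    Cmod (f x - f y - l * (x - y)) <= K * M / r ^ 2 * (Cmod (x - c) + Cmod (y - c)) * Cmod (x - y)).
  { clear x y c l Hx Hy Hc Hl. intros x y c l Hx Hy Hc Hl.
    specialize (H ((x - a) / r)%C ((y - a) / r)%C ((c - a) / r)%C (l * r)%C (Hsc x Hx) (Hsc y Hy) (Hsc c Hc)).
    cbn beta in H; rewrite !unscale in H by auto.
    destruct H as (_ & H1 & H2).
    { apply ball_rescale_cder. rewrite unscale; auto. }
    assert (Ed : forall u v, ((u - a) / r - (v - a) / r)%C = ((u - v) / r)%C) by (intros; field; auto).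
    rewrite !Ed, Cmod_unscale in H1 by auto. rewrite !Ed, !Cmod_unscale in H2 by auto.
    replace (l * r * ((x - y) / r))%C with (l * (x - y))%C in H2 by (field; auto).
    split.
    - eapply Rle_trans; [apply H1|]. right. field. lra.
    - eapply Rle_trans; [apply H2|]. right. field. lra. }
  destruct (H0 x y c l Hx Hy Hc Hl) as [H1 H2]. split; [|split]; auto.
  apply Rnot_lt_le. intros Hlt.
  destruct (Hl ((Cmod l - K * M / r) / 2) ltac:(lra)) as (d & Hd & HH).
  unfold in_ball in Hc.
  set (t := Rmin d (r / 2 - Cmod (c - a)) / 2).
  assert (Ht : 0 < t). { unfold t. assert (0 < Rmin d (r / 2 - Cmod (c - a))) by (apply Rmin_pos; lra). lra. }
  assert (Ht1 : t < d) by (pose proof (Rmin_l d (r / 2 - Cmod (c - a))); unfold t in *; lra).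
  assert (Ht2 : t < r / 2 - Cmod (c - a)) by (pose proof (Rmin_r d (r / 2 - Cmod (c - a))); unfold t in *; lra).
  assert (Hm : Cmod t = t) by (rewrite Cmod_R, Rabs_pos_eq; lra).
  specialize (HH (RtoC t) ltac:(rewrite Hm; auto)). rewrite Hm in HH.
  assert (Hct : in_ball a (r / 2) (c + t)%C).
  { unfold in_ball. replace (c + t - a)%C with ((c - a) + t)%C by ring.
    eapply Rle_lt_trans. apply Cmod_triangle. lra. }
  destruct (H0 (c + t)%C c c l Hct Hc Hc Hl) as [H3 _].
  replace (c + t - c)%C with (RtoC t) in H3 by ring. rewrite Hm in H3.
  pose proof (Cmod_sub_le (l * t) (f (c + t)%C - f c)).
  rewrite Cmod_sub_sym, Cmod_mult, Hm in H4. nra.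
Qed.

(** Openness and convexity combined: the neighbourhood of the segment has one radius, so finitely
    many balls of that radius lead from [a] to [z]. *)
Definition open_convex (S : C -> Prop) : Prop := forall a z, S a -> S z ->
  exists r, 0 < r /\ forall t w, 0 <= t <= 1 -> in_ball (path a z t) r w -> S w.

Lemma open_convex_nbhd S : open_convex S -> forall a, S a -> exists r, 0 < r /\ forall w, in_ball a r w -> S w.
Proof.
  intros HS a Ha. destruct (HS a a Ha Ha) as (r & Hr & H). exists r. split; auto.
  intros w Hw. apply (H 0). lra. rewrite path_0. auto.
Qed.

Lemma in_ball_open_convex a r : open_convex (in_ball a r).
Proof.
  intros x y Hx Hy. unfold in_ball in *. exists (r - Rmax (Cmod (x - a)) (Cmod (y - a))).
  split. { assert (Rmax (Cmod (x - a)) (Cmod (y - a)) < r) by (apply Rmax_lub_lt; auto). lra. }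
  intros t w Ht Hw. pose proof (Cmod_sub_triangle w (path x y t) a).
  assert (Cmod (path x y t - a) <= Rmax (Cmod (x - a)) (Cmod (y - a))); [|lra].
  replace (path x y t - a)%C with (path (x - a) (y - a) t) by (unfold path; ring).
  apply Cmod_path_le; auto. apply Rmax_l. apply Rmax_r.
Qed.

Lemma disc_open_convex : open_convex disc.
Proof.
  assert (E : forall w, disc w <-> in_ball 0 1 w).
  { intros w. unfold disc, in_ball. replace (w - 0)%C with w by ring. tauto. }
  intros x y Hx Hy. apply E in Hx. apply E in Hy. destruct (in_ball_open_convex 0 1 x y Hx Hy) as (r & Hr & H).
  exists r. split; auto. intros t w Ht Hw. apply E. eauto.
Qed.

Definition uhp (z : C) : Prop := 0 < snd z.

Lemma uhp_open_convex : open_convex uhp.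
Proof.
  intros x y Hx Hy. unfold uhp in *. exists (Rmin (snd x) (snd y)). split. apply Rmin_pos; auto.
  intros t w Ht Hw. unfold in_ball in Hw. pose proof (Rabs_snd_le (w - path x y t)).
  assert (Hp : snd (w - path x y t)%C = snd w - ((1 - t) * snd x + t * snd y)) by (unfold path; simpl; ring).
  rewrite Hp in H. pose proof (Rmin_l (snd x) (snd y)). pose proof (Rmin_r (snd x) (snd y)).
  pose proof (Rle_abs (- (snd w - ((1 - t) * snd x + t * snd y)))). rewrite Rabs_Ropp in H2. nra.
Qed.

Lemma derivative_holo S f f' : open_convex S -> (forall z, S z -> cder f z (f' z)) -> holo S f'.
Proof.
  intros HS Hf z Hz. destruct (open_convex_nbhd S HS z Hz) as (r & Hr & Hb).
  assert (Hrc : RtoC r <> 0) by (intros E; apply RtoC_inj in E; lra).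
  destruct (derivative_cder_0 (fun w => f (z + r * w)%C) (fun w => f' (z + r * w)%C * r)%C) as (l & Hl).
  - apply ball_rescale; auto. intros w Hw. exists (f' w). auto.
  - intros w Hw. apply ball_rescale_cder. apply Hf, Hb. unfold in_ball.
    replace (z + r * w - z)%C with (r * w)%C by ring. rewrite Cmod_mult, Cmod_R, Rabs_pos_eq by lra. nra.
  - exists (l * / r / r)%C.
    apply cder_ext_all with (fun w => (f' (z + r * ((w - z) / r)) * r) / r)%C.
    { intros w. rewrite unscale by auto. field; auto. }
    eapply cder_eq.
    2: { apply cder_mult. 2: apply cder_const.
         apply (cder_comp (fun w => f' (z + r * w)%C * r)%C (fun w => (w - z) / r)%C).
         - replace ((z - z) / r)%C with (RtoC 0) by (field; auto). apply Hl.
         - apply cder_mult. apply cder_minus. apply cder_id. apply cder_const. apply cder_const. }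
    cbn beta. field; auto.
Qed.

(** * The identity theorem *)

Definition zeros_cluster (f : C -> C) (a : C) : Prop :=
  forall d, 0 < d -> exists z, z <> a /\ Cmod (z - a) < d /\ f z = 0.

Lemma zero_of_cluster f a : ccont f a -> zeros_cluster f a -> f a = 0.
Proof.
  intros Hc Hz. apply Cmod_eq_0. apply Rle_antisym; [|apply Cmod_ge_0]. apply Rnot_lt_le. intros Hp.
  destruct (Hc _ Hp) as (d & Hd & H). destruct (Hz d Hd) as (z & _ & Hzd & E).
  specialize (H z Hzd). rewrite E in H. replace (0 - f a)%C with (- f a)%C in H by ring.
  rewrite Cmod_opp in H. lra.
Qed.

(** Zeros clustering at 0 survive division by [z], so [f z = z ^ k * g z] for every [k]. On the
    contour [g] is at most [M / (53 / 100) ^ k], whence [f z] is bounded by a constant times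
    [(Cmod z / (53 / 100)) ^ k], which tends to 0 inside radius [1 / 2]. *)
Lemma identity_at_0 f : holo disc f -> zeros_cluster f 0 -> forall z, Cmod z < 1 / 2 -> f z = 0.
Proof.
  intros Hf Hz0.
  assert (Hk : forall k, exists g, holo disc g /\ zeros_cluster g 0 /\ forall z, disc z -> f z = (Cpow z k * g z)%C).
  { induction k as [|k (g & Hg & Hgz & E)].
    - exists f. repeat split; auto. intros; simpl; ring.
    - assert (Hg0 : g 0 = 0).
      { apply zero_of_cluster; auto. apply (holo_ccont disc); auto. unfold disc. rewrite Cmod_0; lra. }
      destruct (divide_at_0 g Hg Hg0) as (g1 & Hg1 & E1).
      exists g1. repeat split; auto.
      + intros d Hd. destruct (Hgz (Rmin d 1)) as (z & Hz & Hzd & Ez). apply Rmin_pos; lra.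
        exists z. repeat split; auto. eapply Rlt_le_trans; [apply Hzd|apply Rmin_l].
        assert (Hzz : disc z).
        { unfold disc. replace z with (z - 0)%C by ring. eapply Rlt_le_trans; [apply Hzd|apply Rmin_r]. }
        rewrite (E1 z Hzz) in Ez. apply NNPP. intros Hn. apply (Cmult_neq_0 z (g1 z)); auto.
      + intros z Hz. rewrite E by auto. rewrite E1 by auto. simpl. ring. }
  destruct cauchy_estimates as (K & HK & HE).
  destruct (holo_disc_bounded f (3 / 4) Hf ltac:(lra)) as (M & HM).
  assert (HM0 : 0 <= M). { eapply Rle_trans. apply Cmod_ge_0. apply (HM 0). rewrite Cmod_0; lra. }
  intros z Hz.
  set (q := Cmod z / (53 / 100)).
  assert (Hq : 0 <= q < 1).
  { unfold q. pose proof (Cmod_ge_0 z). split. apply Rdiv_le_0_compat; lra. apply Rlt_div_l; lra. }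
  assert (Hb : forall k, Cmod (f z) <= K * M * q ^ k).
  { intros k. destruct (Hk k) as (g & Hg & _ & E).
    destruct (Hg z) as (l & Hl). unfold disc; lra.
    destruct (HE g (M / (53 / 100) ^ k) Hg) with (x := z) (y := z) (c := z) (l := l) as (H & _); auto.
    - intros w Hw. pose proof (onsq_Cmod w Hw) as Hwm.
      assert (Hp : 0 < (53 / 100) ^ k) by (apply pow_lt; lra).
      apply Rle_div_r; auto.
      specialize (HM w ltac:(lra)). rewrite (E w), Cmod_mult, Cmod_pow in HM by (unfold disc; lra).
      assert ((53 / 100) ^ k <= Cmod w ^ k) by (apply pow_incr; lra).
      pose proof (Cmod_ge_0 (g w)). nra.
    - rewrite (E z), Cmod_mult, Cmod_pow by (unfold disc; lra).
      unfold q, Rdiv. rewrite Rpow_mult_distr, pow_inv. unfold Rdiv in H.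
      assert (0 <= Cmod z ^ k) by (apply pow_le, Cmod_ge_0).
      apply Rmult_le_compat_l with (r := Cmod z ^ k) in H; auto. lra. }
  apply Cmod_eq_0. apply Rle_antisym; [|apply Cmod_ge_0]. apply Rnot_lt_le. intros Hp.
  destruct (pow_lt_1_zero q) with (y := Cmod (f z) / (K * M + 1)) as (N & HN).
  - rewrite Rabs_pos_eq; lra.
  - apply Rdiv_lt_0_compat; auto. nra.
  - specialize (HN N (Nat.le_refl N)). specialize (Hb N).
    assert (0 <= q ^ N) by (apply pow_le; lra). rewrite Rabs_pos_eq in HN by auto.
    assert (0 <= K * M) by nra.
    apply Rlt_div_r in HN; [|nra]. nra.
Qed.

Lemma identity_ball f a r : 0 < r -> holo (in_ball a r) f -> zeros_cluster f a ->
  forall z, in_ball a (r / 2) z -> f z = 0.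
Proof.
  intros Hr Hf Hz z Hzb.
  assert (Hrc : RtoC r <> 0) by (intros E; apply RtoC_inj in E; lra).
  rewrite <- (unscale a z r Hr).
  apply (identity_at_0 (fun w => f (a + r * w)%C)).
  - apply ball_rescale; auto.
  - intros d Hd. destruct (Hz (r * d)) as (w & Hw & Hwd & E). nra.
    exists ((w - a) / r)%C. rewrite unscale by auto. repeat split; auto.
    + intros E'. apply Hw. rewrite <- (unscale a w r Hr), E'. ring.
    + replace ((w - a) / r - 0)%C with ((w - a) / r)%C by ring. rewrite Cmod_unscale by auto.
      apply Rlt_div_l; auto. lra.
  - rewrite Cmod_unscale by auto. unfold in_ball in Hzb. apply Rlt_div_l; auto. lra.
Qed.

Lemma zeros_cluster_near (f : C -> C) a r : 0 < r -> (forall z, in_ball a r z -> f z = 0) -> zeros_cluster f a.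
Proof.
  intros Hr H d Hd. set (t := Rmin d r / 2).
  assert (Ht : 0 < t). { unfold t. assert (0 < Rmin d r) by (apply Rmin_pos; auto). lra. }
  assert (Hm : Cmod (a + t - a) = t).
  { replace (a + t - a)%C with (RtoC t) by ring. rewrite Cmod_R, Rabs_pos_eq; lra. }
  pose proof (Rmin_l d r). pose proof (Rmin_r d r).
  exists (a + t)%C. repeat split.
  - intros E. rewrite E in Hm. replace (a - a)%C with (RtoC 0) in Hm by ring. rewrite Cmod_0 in Hm. lra.
  - rewrite Hm. unfold t. lra.
  - apply H. unfold in_ball. rewrite Hm. unfold t in *. lra.
Qed.

(** The zeros spread along the segment from [a] to [z]: with [N] steps shorter than [r / 2], each
    new centre lies in the half-ball where [f] is already known to vanish. *)
Lemma identity_theorem Om f a : open_convex Om -> holo Om f -> Om a -> zeros_cluster f a ->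
  forall z, Om z -> f z = 0.
Proof.
  intros HS Hf Ha Hacc z Hz. destruct (HS a z Ha Hz) as (r & Hr & Hb).
  destruct (archimed_cor1 (r / 2 / (Cmod (z - a) + 1))) as (N & HN & HN0).
  { pose proof (Cmod_ge_0 (z - a)). apply Rdiv_lt_0_compat; lra. }
  assert (HNp : 0 < INR N) by (apply lt_0_INR; auto).
  assert (Hstep : / INR N * Cmod (z - a) < r / 2).
  { pose proof (Cmod_ge_0 (z - a)). apply Rlt_div_r in HN; [|lra].
    assert (0 < / INR N) by (apply Rinv_0_lt_compat; auto). nra. }
  assert (Ht : forall j, (j <= N)%nat -> 0 <= INR j / INR N <= 1).
  { intros j Hj. split. apply Rdiv_le_0_compat; auto. apply pos_INR. apply Rle_div_l; auto.
    apply le_INR in Hj. lra. }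
  assert (Hv : forall j, (j <= N)%nat -> zeros_cluster f (path a z (INR j / INR N)) ->
    forall w, in_ball (path a z (INR j / INR N)) (r / 2) w -> f w = 0).
  { intros j Hj Hzj. apply identity_ball; auto. intros w Hw. apply Hf. apply (Hb (INR j / INR N)); auto. }
  assert (Hj : forall j, (j <= N)%nat -> zeros_cluster f (path a z (INR j / INR N))).
  { induction j as [|j IH].
    - intros _. simpl. replace (0 / INR N) with 0 by (field; lra). rewrite path_0. auto.
    - intros Hj. specialize (IH ltac:(lia)). pose proof (Hv j ltac:(lia) IH) as H0.
      assert (Hd : Cmod (path a z (INR (S j) / INR N) - path a z (INR j / INR N)) < r / 2).
      { rewrite path_diff, Cmod_mult, Cmod_R. rewrite S_INR.
        replace ((INR j + 1) / INR N - INR j / INR N) with (/ INR N) by (field; lra).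
        rewrite Rabs_pos_eq. auto. left; apply Rinv_0_lt_compat; auto. }
      apply zeros_cluster_near with (r / 2 - Cmod (path a z (INR (S j) / INR N) - path a z (INR j / INR N))).
      lra. intros w Hw. apply H0. unfold in_ball in *.
      pose proof (Cmod_sub_triangle w (path a z (INR (S j) / INR N)) (path a z (INR j / INR N))). lra. }
  apply (Hv N (Nat.le_refl N)). apply Hj; auto.
  replace (INR N / INR N) with 1 by (field; lra). rewrite path_1. unfold in_ball.
  replace (z - z)%C with (RtoC 0) by ring. rewrite Cmod_0. lra.
Qed.

(** * Maximum principle and Schwarz-Pick *)

Definition sqn (n : nat) (w : C) : C := Nat.iter n (fun x => x * x)%C w.

(** [sqn n w] is the power of [w] with exponent [2 ^ n]. Where [Cmod (x - 1) <= 1 / 2], the factor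
    [x + 1] has modulus at least [3 / 2], so each squaring expands the distance to 1. *)
Lemma sqn_close_to_1 w : (forall n, Cmod (sqn n w - 1) <= 1 / 2) -> w = 1.
Proof.
  intros H.
  assert (Hn : forall n, (3 / 2) ^ n * Cmod (w - 1) <= Cmod (sqn n w - 1)).
  { induction n as [|n IH]. simpl; lra.
    change (sqn (S n) w) with (sqn n w * sqn n w)%C. set (x := sqn n w) in *.
    replace (x * x - 1)%C with ((x - 1) * (x + 1))%C by ring. rewrite Cmod_mult.
    assert (3 / 2 <= Cmod (x + 1)).
    { pose proof (Cmod_sub_le 2 (- (x - 1))). rewrite Cmod_opp, Cmod_R, Rabs_pos_eq in H0 by lra.
      replace (2 - - (x - 1))%C with (x + 1)%C in H0 by ring. specialize (H n). fold x in H. lra. }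
    simpl. pose proof (Cmod_ge_0 (x - 1)). pose proof (Cmod_ge_0 (w - 1)). nra. }
  apply Cmod_eq_sub. apply Rle_antisym; [|apply Cmod_ge_0]. apply Rnot_lt_le. intros Hp.
  destruct (Pow_x_infinity (3 / 2)) with (b := / Cmod (w - 1)) as (N & HN).
  { rewrite Rabs_pos_eq; lra. }
  specialize (HN N (Nat.le_refl N)). rewrite Rabs_pos_eq in HN by (apply pow_le; lra).
  specialize (Hn N). specialize (H N). apply Rge_le in HN.
  apply Rmult_le_compat_r with (r := Cmod (w - 1)) in HN; [|lra]. rewrite Rinv_l in HN; lra.
Qed.

Lemma sqn_holo n Om f : holo Om f -> holo Om (fun z => sqn n (f z)).
Proof.
  intros Hf. induction n; auto. intros z Hz. destruct (IHn z Hz) as (l & Hl).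
  eexists. apply (cder_mult _ _ z l l Hl Hl).
Qed.

Lemma Cmod_sqn n w : Cmod w <= 1 -> Cmod (sqn n w) <= 1.
Proof.
  intros H. induction n; auto. change (sqn (S n) w) with (sqn n w * sqn n w)%C.
  rewrite Cmod_mult. pose proof (Cmod_ge_0 (sqn n w)). nra.
Qed.

Lemma sqn_1 n : sqn n 1 = 1.
Proof. induction n; auto. change (sqn (S n) 1) with (sqn n 1 * sqn n 1)%C. rewrite IHn. ring. Qed.

(* The powers of [f / f a] are bounded by 1, so Cauchy's estimate bounds their variation near [a]
   uniformly in the exponent. *)
Lemma strong_maximum Om f a : open_convex Om -> holo Om f -> Om a -> (forall z, Om z -> Cmod (f z) <= 1) ->
  Cmod (f a) = 1 -> forall z, Om z -> f z = f a.
Proof.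
  intros HO Hf Ha Hb H1 z Hz.
  assert (Hfa : f a <> 0) by (apply Cmod_gt_0; lra).
  destruct (open_convex_nbhd Om HO a Ha) as (r & Hr & Hball).
  destruct ball_estimates as (K & HK & HE).
  pose (g := fun z => (f z / f a)%C).
  assert (Hg : holo Om g).
  { intros w Hw. destruct (Hf w Hw) as (l & Hl). eexists. apply cder_mult. apply Hl. apply cder_const. }
  assert (Hg1 : forall w, Om w -> Cmod (g w) <= 1).
  { intros w Hw. unfold g. rewrite Cmod_div, H1 by auto. specialize (Hb w Hw). lra. }
  assert (Hga : g a = 1) by (unfold g; field; auto).
  set (d := Rmin (r / 2) (r / (2 * K))).
  assert (Hd : 0 < d) by (unfold d; apply Rmin_pos; [lra|apply Rdiv_lt_0_compat; lra]).
  assert (Hnear : forall w, in_ball a d w -> (f w - f a)%C = 0).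
  { intros w Hw. unfold in_ball in Hw.
    assert (Hw1 : Cmod (w - a) < r / 2) by (eapply Rlt_le_trans; [apply Hw|apply Rmin_l]).
    assert (Hw2 : Cmod (w - a) < r / (2 * K)) by (eapply Rlt_le_trans; [apply Hw|apply Rmin_r]).
    assert (E : g w = 1).
    { apply sqn_close_to_1. intros n.
      assert (Hh : holo (in_ball a r) (fun z => sqn n (g z))).
      { intros x Hx. apply (sqn_holo n Om g Hg). auto. }
      assert (Haa : in_ball a (r / 2) a).
      { unfold in_ball. replace (a - a)%C with (RtoC 0) by ring. rewrite Cmod_0. lra. }
      destruct (Hh a) as (l & Hl). { unfold in_ball in *. lra. }
      destruct (HE (fun z => sqn n (g z)) 1 a r Hr Hh) with (x := w) (y := a) (c := a) (l := l) as (H & _ & _); auto.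
      { intros x Hx. apply Cmod_sqn. auto. }
      cbn beta in H. rewrite Hga, sqn_1 in H. eapply Rle_trans; [apply H|].
      apply Rlt_div_r in Hw2; [|lra]. replace (K * 1 / r * Cmod (w - a)) with (K * Cmod (w - a) / r) by (field; lra).
      apply Rle_div_l; lra. }
    replace (f w) with (g w * f a)%C by (unfold g; field; auto). rewrite E. ring. }
  apply Cmod_eq_sub.
  rewrite (identity_theorem Om (fun z => f z - f a)%C a HO); auto. apply Cmod_0.
  - intros w Hw. destruct (Hf w Hw) as (l & Hl). eexists. apply cder_minus. apply Hl. apply cder_const.
  - apply zeros_cluster_near with d; auto.
Qed.

(** If the quotient [f1] exceeded 1 in modulus at [z], a radius [r] with [/ Cmod (f1 z) < r < 1]
    would make [f1] smaller on the circle of radius [r] than at [z]. The maximum over the disc would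
    then be interior and [f1] constant, against its values on the circle. *)
Lemma schwarz f : holo disc f -> (forall z, disc z -> disc (f z)) -> f 0 = 0 ->
  forall z, disc z -> Cmod (f z) <= Cmod z.
Proof.
  intros Hf Hd H0 z Hz. destruct (divide_at_0 f Hf H0) as (f1 & Hf1 & E).
  rewrite E by auto. rewrite Cmod_mult. rewrite <- (Rmult_1_r (Cmod z)) at 2.
  apply Rmult_le_compat_l. apply Cmod_ge_0. apply Rnot_lt_le. intros Hgt.
  set (r := Rmax (Cmod z) ((1 + / Cmod (f1 z)) / 2)).
  assert (Hinv : 0 < / Cmod (f1 z) < 1).
  { split. apply Rinv_0_lt_compat; lra. rewrite <- Rinv_1. apply Rinv_lt_contravar; lra. }
  assert (Hr1 : r < 1) by (unfold r; apply Rmax_lub_lt; [apply Hz|lra]).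
  assert (Hr2 : Cmod z <= r) by apply Rmax_l.
  assert (Hr3 : / Cmod (f1 z) < r).
  { apply Rlt_le_trans with ((1 + / Cmod (f1 z)) / 2). lra. apply Rmax_r. }
  assert (Hr4 : 1 < Cmod (f1 z) * r).
  { apply Rmult_lt_compat_l with (r := Cmod (f1 z)) in Hr3; [|lra]. rewrite Rinv_r in Hr3; lra. }
  destruct (compact_max f1 r) as (w0 & Hw0 & Hmax). lra.
  { intros w Hw. apply (holo_ccont disc); auto. unfold disc; lra. }
  assert (Hw0d : disc w0) by (unfold disc; lra).
  pose proof (Hmax z Hr2) as Hz'.
  assert (Hcirc : forall w, Cmod w = r -> Cmod (f1 w) < Cmod (f1 w0)).
  { intros w Hw. assert (Hwd : disc w) by (unfold disc; lra).
    pose proof (Hd w Hwd) as Hfw. unfold disc in Hfw. rewrite E, Cmod_mult, Hw in Hfw by auto.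
    assert (0 < r) by lra. nra. }
  destruct (Rle_lt_or_eq_dec _ _ Hw0) as [Hlt|Heq].
  2: { specialize (Hcirc w0 Heq). lra. }
  set (R0 := r - Cmod w0).
  assert (Hball : forall w, in_ball w0 R0 w -> Cmod w <= r).
  { intros w Hw. unfold in_ball, R0 in Hw. pose proof (Cmod_sub_le w w0). lra. }
  assert (Hnz : f1 w0 <> 0) by (apply Cmod_gt_0; lra).
  assert (Hconst : forall w, in_ball w0 R0 w -> (f1 w - f1 w0)%C = 0).
  { intros w Hw.
    assert (Hs : (f1 w / f1 w0 = f1 w0 / f1 w0)%C).
    { apply (strong_maximum (in_ball w0 R0) (fun w => f1 w / f1 w0)%C); auto using in_ball_open_convex.
      - intros x Hx. destruct (Hf1 x) as (l & Hl). { apply Hball in Hx. unfold disc; lra. }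
        eexists. apply cder_mult. apply Hl. apply cder_const.
      - unfold in_ball, R0. replace (w0 - w0)%C with (RtoC 0) by ring. rewrite Cmod_0. lra.
      - intros x Hx. apply Hball in Hx. rewrite Cmod_div by auto. apply Rle_div_l. lra.
        specialize (Hmax x Hx). lra.
      - rewrite Cmod_div by auto. field. lra. }
    replace (f1 w) with (f1 w / f1 w0 * f1 w0)%C by (field; auto). rewrite Hs. field; auto. }
  assert (Hall : (f1 r - f1 w0 = 0)%C).
  { apply (identity_theorem disc (fun w => f1 w - f1 w0)%C w0); auto using disc_open_convex.
    - intros w Hw. destruct (Hf1 w Hw) as (l & Hl). eexists. apply cder_minus. apply Hl. apply cder_const.
    - apply zeros_cluster_near with R0; auto. unfold R0; lra.
    - unfold disc. rewrite Cmod_R, Rabs_pos_eq; lra. }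
  assert (Hrm : Cmod r = r) by (rewrite Cmod_R, Rabs_pos_eq; lra).
  specialize (Hcirc (RtoC r) Hrm).
  assert (E' : f1 r = f1 w0) by (apply Cmod_eq_sub; rewrite Hall; apply Cmod_0).
  rewrite E' in Hcirc. lra.
Qed.

(* Both are [sinh ^ 2] of the hyperbolic distance, which avoids logarithms and square roots. *)
Definition dD (z w : C) : R := Cmod (z - w) ^ 2 / ((1 - Cmod z ^ 2) * (1 - Cmod w ^ 2)).
Definition dH (a b : C) : R := Cmod (a - b) ^ 2 / (4 * snd a * snd b).

Lemma disc_sqr z : disc z -> 0 < 1 - Cmod z ^ 2.
Proof. unfold disc. intros H. pose proof (Cmod_ge_0 z). nra. Qed.

(** It relates [dD] to the pseudo-hyperbolic distance, whose square is [dD / (1 + dD)]. *)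
Lemma mobius_identity (a b : C) :
  Cmod (1 - Cconj a * b) ^ 2 = Cmod (a - b) ^ 2 + (1 - Cmod a ^ 2) * (1 - Cmod b ^ 2).
Proof. rewrite !Cmod_sqr. destruct a, b. unfold Cconj. simpl. ring. Qed.

Lemma mobius_denominator (a b : C) : disc a -> disc b -> (1 - Cconj a * b)%C <> 0.
Proof.
  intros Ha Hb E. pose proof (mobius_identity a b) as H. rewrite E, Cmod_0 in H.
  pose proof (disc_sqr a Ha). pose proof (disc_sqr b Hb). pose proof (pow2_ge_0 (Cmod (a - b))). nra.
Qed.

Definition mobius (a z : C) : C := ((z - a) / (1 - Cconj a * z))%C.

Lemma mobius_disc a z : disc a -> disc z -> disc (mobius a z).
Proof.
  intros Ha Hz. unfold disc, mobius. pose proof (mobius_denominator a z Ha Hz) as Hn.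
  apply Cmod_gt_0 in Hn as Hp. rewrite Cmod_div by auto. apply Rlt_div_l; auto. rewrite Rmult_1_l.
  pose proof (mobius_identity a z) as H. pose proof (disc_sqr a Ha). pose proof (disc_sqr z Hz).
  rewrite (Cmod_sub_sym z a). pose proof (Cmod_ge_0 (a - z)). nra.
Qed.

Lemma mobius_holo a : disc a -> holo disc (mobius a).
Proof.
  intros Ha z Hz. eexists. apply cder_div. apply (mobius_denominator a z); auto.
  apply cder_minus; [apply cder_id|apply cder_const].
  apply cder_minus. apply cder_const. apply cder_scal, cder_id.
Qed.

Lemma mobius_cancel a z : disc a -> disc z -> mobius (- a) (mobius a z) = z.
Proof.
  intros Ha Hz. unfold mobius. pose proof (mobius_denominator a z Ha Hz).
  pose proof (mobius_denominator a a Ha Ha). rewrite Copp_conj. field. split; auto.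
  intros E. apply H0.
  rewrite <- E. ring.
Qed.

Lemma disc_opp a : disc a -> disc (- a).
Proof. unfold disc. rewrite Cmod_opp. auto. Qed.

Lemma holo_comp A B f g : holo A f -> holo B g -> (forall z, A z -> B (f z)) -> holo A (fun z => g (f z)).
Proof.
  intros Hf Hg HAB z Hz. destruct (Hf z Hz) as (l & Hl). destruct (Hg (f z) (HAB z Hz)) as (m & Hm).
  exists (m * l)%C. apply cder_comp; auto.
Qed.

(** Schwarz's lemma is applied to [f] between the automorphisms that move [a] and [f a] to 0;
    [mobius_identity] then turns the pseudo-hyperbolic inequality into one for [dD]. *)
Lemma schwarz_pick f : holo disc f -> (forall z, disc z -> disc (f z)) ->
  forall a b, disc a -> disc b -> dD (f a) (f b) <= dD a b.
Proof.
  intros Hf Hd a b Ha Hb.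
  pose proof (Hd a Ha) as Hfa. pose proof (Hd b Hb) as Hfb.
  pose (F := fun z => mobius (f a) (f (mobius (- a) z))).
  assert (HF : Cmod (F (mobius a b)) <= Cmod (mobius a b)).
  { apply schwarz; auto using mobius_disc.
    - apply (holo_comp disc disc (fun z => f (mobius (- a) z)) (mobius (f a))); auto using mobius_holo, mobius_disc, disc_opp.
      apply (holo_comp disc disc (mobius (- a)) f); auto using mobius_holo, mobius_disc, disc_opp.
    - intros z Hz. apply mobius_disc; auto. apply Hd. auto using mobius_disc, disc_opp.
    - unfold F. replace (mobius (- a) 0) with a.
      + unfold mobius. replace (f a - f a)%C with (RtoC 0) by ring. unfold Cdiv. ring.
      + unfold mobius. field. }
  unfold F in HF. rewrite mobius_cancel in HF by auto. unfold mobius in HF.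
  pose proof (mobius_denominator a b Ha Hb) as N1. pose proof (mobius_denominator _ _ Hfa Hfb) as N2.
  rewrite !Cmod_div in HF by auto. apply Cmod_gt_0 in N1. apply Cmod_gt_0 in N2.
  rewrite (Cmod_sub_sym (f b)), (Cmod_sub_sym b) in HF.
  pose proof (mobius_identity a b) as E1. pose proof (mobius_identity (f a) (f b)) as E2.
  pose proof (disc_sqr a Ha). pose proof (disc_sqr b Hb). pose proof (disc_sqr _ Hfa). pose proof (disc_sqr _ Hfb).
  unfold dD.
  set (p := (1 - Cmod a ^ 2) * (1 - Cmod b ^ 2)) in *.
  set (p' := (1 - Cmod (f a) ^ 2) * (1 - Cmod (f b) ^ 2)) in *.
  assert (Hp : 0 < p) by (apply Rmult_lt_0_compat; auto).
  assert (Hp' : 0 < p') by (apply Rmult_lt_0_compat; auto).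
  set (s := Cmod (1 - Cconj a * b)) in *. set (s' := Cmod (1 - Cconj (f a) * f b)) in *.
  pose proof (Cmod_ge_0 (a - b)). pose proof (Cmod_ge_0 (f a - f b)).
  set (u := Cmod (a - b)) in *. set (u' := Cmod (f a - f b)) in *.
  assert (HF' : u' * s <= u * s').
  { apply Rmult_le_compat_r with (r := s * s') in HF; [|nra].
    replace (u' / s' * (s * s')) with (u' * s) in HF by (field; lra).
    replace (u / s * (s * s')) with (u * s') in HF by (field; lra). auto. }
  assert (H7 : (u' * s) ^ 2 <= (u * s') ^ 2).
  { apply pow_incr. split; auto. apply Rmult_le_pos; lra. }
  rewrite !Rpow_mult_distr, E1, E2 in H7.
  apply Rle_div_l; auto. replace (u ^ 2 / p * p') with (u ^ 2 * p' / p) by (field; lra).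
  apply (proj1 (Rle_div_r (u' ^ 2) _ p Hp)). lra.
Qed.

(** * The upper half-plane *)

(** The Cayley transform that sends 0 to [Ci] and the boundary point 1 to infinity. *)
Definition cay (z : C) : C := (Ci * (1 + z) / (1 - z))%C.
Definition icay (w : C) : C := ((w - Ci) / (w + Ci))%C.

Lemma one_minus_neq z : disc z -> (1 - z)%C <> 0.
Proof.
  intros Hz E. unfold disc in Hz. pose proof (Cmod_sub_le 1 z). rewrite E, Cmod_0, Cmod_1 in H. lra.
Qed.

Lemma plus_Ci_neq w : uhp w -> (w + Ci)%C <> 0.
Proof. intros Hw E. apply (f_equal snd) in E. simpl in E. unfold uhp in Hw. lra. Qed.

Lemma snd_div (a b : C) : b <> 0 -> snd (a / b)%C = (snd a * fst b - fst a * snd b) / Cmod b ^ 2.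
Proof.
  intros Hb. apply Cmod_gt_0 in Hb. rewrite Cmod_sqr. destruct a, b. unfold Cdiv, Cinv. simpl.
  field. pose proof (Cmod_sqr (r1, r2)). simpl in H. nra.
Qed.

Lemma snd_cay z : disc z -> snd (cay z) = (1 - Cmod z ^ 2) / Cmod (1 - z) ^ 2.
Proof.
  intros Hz. unfold cay. rewrite snd_div by (apply one_minus_neq; auto).
  f_equal. rewrite Cmod_sqr. destruct z; simpl; ring.
Qed.

Lemma cay_uhp z : disc z -> uhp (cay z).
Proof.
  intros Hz. unfold uhp. rewrite snd_cay by auto. apply Rdiv_lt_0_compat. apply disc_sqr; auto.
  pose proof (one_minus_neq z Hz) as H. apply Cmod_gt_0 in H. nra.
Qed.

Lemma icay_sqr w : uhp w -> 1 - Cmod (icay w) ^ 2 = 4 * snd w / Cmod (w + Ci) ^ 2.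
Proof.
  intros Hw. pose proof (plus_Ci_neq w Hw) as H. unfold icay. rewrite Cmod_div by auto.
  apply Cmod_gt_0 in H. unfold Rdiv. rewrite Rpow_mult_distr, pow_inv.
  assert (E : Cmod (w - Ci) ^ 2 = Cmod (w + Ci) ^ 2 - 4 * snd w).
  { rewrite !Cmod_sqr. destruct w; simpl; ring. }
  rewrite E. field. lra.
Qed.

Lemma icay_disc w : uhp w -> disc (icay w).
Proof.
  intros Hw. unfold disc. pose proof (icay_sqr w Hw) as E.
  pose proof (plus_Ci_neq w Hw) as H. apply Cmod_gt_0 in H. unfold uhp in Hw.
  assert (0 < 4 * snd w / Cmod (w + Ci) ^ 2) by (apply Rdiv_lt_0_compat; nra).
  pose proof (Cmod_ge_0 (icay w)). nra.
Qed.

Lemma Ci_sqr : (Ci * Ci = -(1))%C.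
Proof. unfold Ci. apply injective_projections; simpl; ring. Qed.

Lemma Ci_neq_0 : Ci <> 0.
Proof. apply Cmod_gt_0. rewrite Cmod_Ci. lra. Qed.

Lemma cay_icay w : uhp w -> cay (icay w) = w.
Proof.
  intros Hw. pose proof (plus_Ci_neq w Hw). pose proof Ci_neq_0. unfold cay, icay.
  replace (1 + (w - Ci) / (w + Ci))%C with (2 * w / (w + Ci))%C by (field; auto).
  replace (1 - (w - Ci) / (w + Ci))%C with (2 * Ci / (w + Ci))%C by (field; auto).
  field. split; auto.
Qed.

Lemma icay_cay z : disc z -> icay (cay z) = z.
Proof.
  intros Hz. pose proof (one_minus_neq z Hz). pose proof Ci_neq_0. unfold cay, icay.
  replace (Ci * (1 + z) / (1 - z) - Ci)%C with (2 * Ci * z / (1 - z))%C by (field; auto).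
  replace (Ci * (1 + z) / (1 - z) + Ci)%C with (2 * Ci / (1 - z))%C by (field; auto).
  field. split; auto.
Qed.

Lemma cay_holo : holo disc cay.
Proof.
  intros z Hz. eexists. apply cder_div. apply one_minus_neq; auto.
  apply cder_scal. apply cder_plus; [apply cder_const|apply cder_id].
  apply cder_minus; [apply cder_const|apply cder_id].
Qed.

Lemma icay_holo : holo uhp icay.
Proof.
  intros z Hz. eexists. apply cder_div. apply plus_Ci_neq; auto.
  apply cder_minus; [apply cder_id|apply cder_const].
  apply cder_plus; [apply cder_id|apply cder_const].
Qed.

Lemma dH_cay z w : disc z -> disc w -> dH (cay z) (cay w) = dD z w.
Proof.
  intros Hz Hw. pose proof (one_minus_neq z Hz) as N1. pose proof (one_minus_neq w Hw) as N2.
  unfold dH, dD. rewrite !snd_cay by auto.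
  replace (cay z - cay w)%C with (2 * Ci * (z - w) / ((1 - z) * (1 - w)))%C by (unfold cay; field; auto).
  rewrite Cmod_div by (apply Cmult_neq_0; auto). rewrite !Cmod_mult, Cmod_Ci, Cmod_R, Rabs_pos_eq by lra.
  pose proof (disc_sqr z Hz). pose proof (disc_sqr w Hw). apply Cmod_gt_0 in N1. apply Cmod_gt_0 in N2.
  field. repeat split; lra.
Qed.

Lemma dD_icay a b : uhp a -> uhp b -> dD (icay a) (icay b) = dH a b.
Proof.
  intros Ha Hb. rewrite <- dH_cay by auto using icay_disc. rewrite !cay_icay; auto.
Qed.

Lemma schwarz_pick_DH f : holo disc f -> (forall z, disc z -> uhp (f z)) ->
  forall a b, disc a -> disc b -> dH (f a) (f b) <= dD a b.
Proof.
  intros Hf Hd a b Ha Hb. rewrite <- dD_icay by auto.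
  apply (schwarz_pick (fun z => icay (f z))); auto using icay_disc.
  apply (holo_comp disc uhp f icay); auto using icay_holo.
Qed.

Lemma schwarz_pick_HH f : holo uhp f -> (forall z, uhp z -> uhp (f z)) ->
  forall a b, uhp a -> uhp b -> dH (f a) (f b) <= dH a b.
Proof.
  intros Hf Hd a b Ha Hb. rewrite <- (dD_icay a b) by auto.
  rewrite <- (cay_icay a Ha) at 1. rewrite <- (cay_icay b Hb) at 1.
  apply (schwarz_pick_DH (fun z => f (cay z))); auto using icay_disc, cay_uhp.
  apply (holo_comp disc uhp cay f); auto using cay_holo, cay_uhp.
Qed.

Lemma schwarz_pick_HD f : holo uhp f -> (forall z, uhp z -> disc (f z)) ->
  forall a b, uhp a -> uhp b -> dD (f a) (f b) <= dH a b.
Proof.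
  intros Hf Hd a b Ha Hb. rewrite <- (dD_icay a b) by auto.
  rewrite <- (cay_icay a Ha) at 1. rewrite <- (cay_icay b Hb) at 1.
  apply (schwarz_pick (fun z => f (cay z))); auto using icay_disc, cay_uhp.
  apply (holo_comp disc uhp cay f); auto using cay_holo, cay_uhp.
Qed.

(** * Hyperbolic estimates and ultralimits of holomorphic maps *)

Lemma in_ball_center a r : 0 < r -> in_ball a r a.
Proof. intros Hr. unfold in_ball. replace (a - a)%C with (RtoC 0) by ring. rewrite Cmod_0. auto. Qed.

Lemma in_ball_le a r s w : r <= s -> in_ball a r w -> in_ball a s w.
Proof. unfold in_ball. lra. Qed.

(** Weierstrass' theorem for ultralimits: the quadratic remainder bound of [ball_estimates] is
    uniform in [n], so it passes to the limit, with the limit of the derivatives as slope. *)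
Lemma ulim_local U (HU : ultrafilter U) (gn : nat -> C -> C) g a r M : 0 < r ->
  U (fun n => holo (in_ball a r) (gn n) /\ forall w, in_ball a r w -> Cmod (gn n w) <= M) ->
  (forall w, in_ball a r w -> ulim U (fun n => gn n w) (g w)) ->
  exists l, cder g a l /\ forall ln, U (fun n => cder (gn n) a (ln n)) -> ulim U ln l.
Proof.
  intros Hr Hb Hg. destruct ball_estimates as (K & HK & HE).
  pose (dn := fun n => epsilon (inhabits (RtoC 0)) (fun l => cder (gn n) a l)).
  assert (Hdn : U (fun n => cder (gn n) a (dn n))).
  { apply (uf_imp U HU) with (2 := Hb). intros n [H _].
    apply (epsilon_spec (inhabits (RtoC 0)) (fun l => cder (gn n) a l)).
    apply H, in_ball_center; auto. }
  assert (Ha : in_ball a (r / 2) a) by (apply in_ball_center; lra).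
  destruct (ulim_bound_exists U HU dn (K * M / r)) as (l & Hl).
  { apply (uf_imp2 U HU _ _ _ Hb Hdn). intros n [H1 H2] H3.
    apply (HE (gn n) M a r Hr H1 H2 a a a (dn n)); auto. }
  exists l. split.
  - apply cder_of_quadratic with (K * M / r ^ 2) (r / 2). lra.
    intros h Hh.
    assert (Hah : in_ball a (r / 2) (a + h)%C).
    { unfold in_ball. replace (a + h - a)%C with h by ring. auto. }
    apply (ulim_Cmod_le U HU (fun n => gn n (a + h)%C - gn n a - dn n * h)%C).
    + apply ulim_minus; auto. apply ulim_minus; auto.
      * apply Hg. eapply in_ball_le; [|apply Hah]. lra.
      * apply Hg. apply in_ball_center; auto.
      * apply ulim_mult; auto. apply ulim_const; auto.
    + apply (uf_imp2 U HU _ _ _ Hb Hdn). intros n [H1 H2] H3.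
      destruct (HE (gn n) M a r Hr H1 H2 (a + h)%C a a (dn n)) as (_ & H & _); auto.
      replace (a + h - a)%C with h in H by ring. replace (a - a)%C with (RtoC 0) in H by ring.
      rewrite Cmod_0 in H. eapply Rle_trans; [apply H|]. right. ring.
  - intros ln Hln e He. apply (uf_imp2 U HU _ _ _ Hdn (uf_and U HU _ _ Hln (Hl e He))).
    intros n H1 [H2 H3]. rewrite (cder_unique _ _ _ _ H2 H1). auto.
Qed.

Lemma dD_sym z w : dD z w = dD w z.
Proof. unfold dD. rewrite Cmod_sub_sym. f_equal. ring. Qed.

Lemma dH_sym z w : dH z w = dH w z.
Proof. unfold dH. rewrite Cmod_sub_sym. f_equal. ring. Qed.

Lemma dH_ge_0 a b : uhp a -> uhp b -> 0 <= dH a b.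
Proof. unfold uhp. intros Ha Hb. unfold dH. apply Rdiv_le_0_compat. apply pow2_ge_0. repeat apply Rmult_lt_0_compat; lra. Qed.

Lemma dD_ge_0 a b : disc a -> disc b -> 0 <= dD a b.
Proof.
  intros Ha Hb. unfold dD. apply Rdiv_le_0_compat. apply pow2_ge_0.
  apply Rmult_lt_0_compat; apply disc_sqr; auto.
Qed.

Lemma dH_eq a b : uhp a -> uhp b -> Cmod (a - b) ^ 2 = dH a b * (4 * snd a * snd b).
Proof. unfold uhp, dH. intros. field. lra. Qed.

Lemma dD_eq a b : disc a -> disc b -> Cmod (a - b) ^ 2 = dD a b * ((1 - Cmod a ^ 2) * (1 - Cmod b ^ 2)).
Proof. unfold dD. intros Ha Hb. apply disc_sqr in Ha. apply disc_sqr in Hb. field. lra. Qed.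

(** Writing [s], [t] for the heights, [(s - t) ^ 2 <= Cmod (a - b) ^ 2 <= 4 * k * s * t] gives
    [s ^ 2 <= (2 + 4 * k) * s * t]. This is a Harnack inequality for heights, and it turns
    hyperbolic bounds into Euclidean ones. *)
Lemma dH_bounds a b k : uhp a -> uhp b -> dH a b <= k ->
  snd a <= (2 + 4 * k) * snd b /\ Cmod (a - b) <= (2 + 4 * k) * snd b.
Proof.
  intros Ha Hb Hk. pose proof (dH_eq a b Ha Hb) as E. pose proof (dH_ge_0 a b Ha Hb) as H0.
  unfold uhp in *. set (s := snd a) in *. set (t := snd b) in *. set (m := Cmod (a - b)) in *.
  assert (Hm : Rabs (s - t) <= m).
  { pose proof (Rabs_snd_le (a - b)) as H. simpl in H. unfold s, t, m, Rminus. auto. }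
  assert (Hm0 : 0 <= m) by apply Cmod_ge_0.
  assert (Est : 0 < s * t) by (apply Rmult_lt_0_compat; auto).
  assert (E' : m ^ 2 <= 4 * k * (s * t)).
  { rewrite E. replace (dH a b * (4 * s * t)) with (4 * dH a b * (s * t)) by ring. nra. }
  assert (Hst : s <= (2 + 4 * k) * t).
  { assert ((s - t) ^ 2 <= m ^ 2) by (rewrite <- (pow2_abs (s - t)); apply pow_incr; split; auto using Rabs_pos).
    apply Rnot_lt_le. intros Hlt.
    assert (s * s <= (2 + 4 * k) * t * s) by nra. nra. }
  split; auto.
  assert (Hk0 : 0 <= k) by lra.
  assert (m ^ 2 <= ((2 + 4 * k) * t) ^ 2).
  { apply Rle_trans with (4 * k * (((2 + 4 * k) * t) * t)).
    - eapply Rle_trans; [apply E'|]. apply Rmult_le_compat_l. lra. apply Rmult_le_compat_r; lra.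
    - nra. }
  assert (0 <= (2 + 4 * k) * t) by nra. nra.
Qed.

(** Half of [1 - Cmod a ^ 2] is at most [Cmod (1 - Cconj a * b)], whose square is [dD a b + 1] times
    the product of the two defects by [mobius_identity]. *)
Lemma dD_bounds a b k : disc a -> disc b -> dD a b <= k -> 1 - Cmod a ^ 2 <= 4 * (k + 1) * (1 - Cmod b ^ 2).
Proof.
  intros Ha Hb Hk. pose proof (mobius_identity a b) as E. rewrite (dD_eq a b) in E by auto.
  pose proof (disc_sqr a Ha) as Pa. pose proof (disc_sqr b Hb) as Pb.
  assert (H1 : (1 - Cmod a ^ 2) / 2 <= Cmod (1 - Cconj a * b)).
  { pose proof (Cmod_sub_le 1 (Cconj a * b)). rewrite Cmod_1, Cmod_mult, Cmod_conj in H.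
    unfold disc in *. pose proof (Cmod_ge_0 a). pose proof (Cmod_ge_0 b). nra. }
  set (p := 1 - Cmod a ^ 2) in *. set (q := 1 - Cmod b ^ 2) in *.
  assert (H2 : (p / 2) ^ 2 <= Cmod (1 - Cconj a * b) ^ 2) by (apply pow_incr; lra).
  rewrite E in H2. assert (Hpq : 0 < p * q) by nra.
  assert (p * p <= p * (4 * (k + 1) * q)) by nra. apply Rmult_le_reg_l in H; auto.
Qed.

Lemma dD_small a e : disc a -> 0 < e -> exists r, 0 < r /\ forall w, in_ball a r w -> disc w /\ dD w a <= e.
Proof.
  intros Ha He. unfold disc in Ha. set (q := 1 - Cmod a).
  assert (Hq : 0 < q) by (unfold q; lra).
  set (m := Rmin 1 e). assert (Hm : 0 < m) by (apply Rmin_pos; lra).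
  assert (Hm1 : m <= 1) by apply Rmin_l. assert (Hm2 : m <= e) by apply Rmin_r.
  exists (m * (q / 2)). split. nra. intros w Hw. unfold in_ball in Hw.
  assert (Hw1 : 1 - Cmod w >= q / 2).
  { pose proof (Cmod_sub_le w a). unfold q in *. nra. }
  assert (Hd : disc w) by (unfold disc; lra). split; auto.
  pose proof (Cmod_ge_0 a). pose proof (Cmod_ge_0 w). pose proof (Cmod_ge_0 (w - a)).
  assert (Ha2 : 1 - Cmod a ^ 2 >= q) by (unfold q; nra).
  assert (Hw2 : 1 - Cmod w ^ 2 >= q / 2) by (unfold disc in Hd; nra).
  assert (H4 : Cmod (w - a) ^ 2 <= (m * (q / 2)) ^ 2) by (apply pow_incr; lra).
  assert (H3 : q / 2 * q <= (1 - Cmod w ^ 2) * (1 - Cmod a ^ 2)) by (apply Rmult_le_compat; lra).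
  unfold dD. apply Rle_div_l. nra.
  assert (m * m <= e) by nra.
  assert (e * (q / 2 * q) <= e * ((1 - Cmod w ^ 2) * (1 - Cmod a ^ 2))) by (apply Rmult_le_compat_l; lra).
  nra.
Qed.

Lemma dH_small a e : uhp a -> 0 < e -> exists r, 0 < r /\ forall w, in_ball a r w -> uhp w /\ dH w a <= e.
Proof.
  intros Ha He. unfold uhp in *. set (s := snd a) in *.
  set (m := Rmin 1 e). assert (Hm : 0 < m) by (apply Rmin_pos; lra).
  assert (Hm1 : m <= 1) by apply Rmin_l. assert (Hm2 : m <= e) by apply Rmin_r.
  exists (m * (s / 2)). split. nra. intros w Hw. unfold in_ball in Hw.
  assert (Hw1 : s / 2 <= snd w).
  { pose proof (Rabs_snd_le (w - a)) as H. simpl in H. fold s in H.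
    apply Rle_lt_trans with (2 := Hw) in H. apply Rabs_def2 in H. nra. }
  split. lra. unfold dH. fold s. apply Rle_div_l. nra.
  pose proof (Cmod_ge_0 (w - a)).
  assert (H4 : Cmod (w - a) ^ 2 <= (m * (s / 2)) ^ 2) by (apply pow_incr; lra).
  assert (m * m <= e) by nra.
  assert (e * (4 * (s / 2) * s) <= e * (4 * snd w * s)) by (apply Rmult_le_compat_l; nra).
  nra.
Qed.

Section UhpLimits.
Variable U : (nat -> Prop) -> Prop.
Hypothesis HU : ultrafilter U.

Lemma ulim_uhp_range y l : ulim U y l -> uhp l ->
  U (fun n => snd l / 2 <= snd (y n) <= 2 * snd l /\ Cmod (y n) <= Cmod l + 1).
Proof.
  intros Hy Hl. unfold uhp in Hl.
  apply (uf_imp2 U HU _ _ _ (Hy (snd l / 2) ltac:(lra)) (Hy 1 Rlt_0_1)).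
  intros n H1 H2. pose proof (Rabs_snd_le (y n - l)) as H. simpl in H.
  apply Rle_lt_trans with (2 := H1) in H. apply Rabs_def2 in H.
  pose proof (Cmod_sub_le (y n) l). lra.
Qed.

(** Bounded hyperbolic distance to a sequence that converges in the half-plane keeps [x n] bounded
    and its height bounded below, so the limit cannot drop to the boundary. *)
Lemma uhp_ulim_exists x y l k : (forall n, uhp (x n)) -> (forall n, uhp (y n)) ->
  (forall n, dH (x n) (y n) <= k) -> ulim U y l -> uhp l -> exists m, ulim U x m /\ uhp m.
Proof.
  intros Hx Hyu Hk Hy Hl.
  assert (Hk0 : 0 <= k) by (eapply Rle_trans; [apply (dH_ge_0 (x 0%nat) (y 0%nat)); auto|auto]).
  pose proof (ulim_uhp_range y l Hy Hl) as HR. unfold uhp in Hl.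
  destruct (ulim_bound_exists U HU x ((2 + 4 * k) * (2 * snd l) + (Cmod l + 1))) as (m & Hm).
  { apply (uf_imp U HU) with (2 := HR). intros n [H1 H2].
    destruct (dH_bounds (x n) (y n) k) as [_ H3]; auto.
    pose proof (Cmod_sub_le (x n) (y n)). nra. }
  exists m. split; auto. unfold uhp.
  apply Rlt_le_trans with (snd l / 2 / (2 + 4 * k)). apply Rdiv_lt_0_compat; lra.
  apply (ulimR_ge_l U HU (fun n => snd (x n))). apply ulim_snd; auto.
  apply (uf_imp U HU) with (2 := HR). intros n [H1 H2].
  destruct (dH_bounds (y n) (x n) k) as [H3 _]; auto. rewrite dH_sym; auto.
  apply Rle_div_l; lra.
Qed.

Lemma ulim_of_dH x y l : (forall n, uhp (x n)) -> (forall n, uhp (y n)) -> ulim U y l -> uhp l ->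
  ulimR U (fun n => dH (x n) (y n)) 0 -> ulim U x l.
Proof.
  intros Hx Hyu Hy Hl Hd e He.
  pose proof (ulim_uhp_range y l Hy Hl) as HR. unfold uhp in Hl.
  (* Once [dH] is below [k], [snd (x n) <= 6 * snd (y n)] and [snd (y n) <= 2 * snd l], so the
     squared distance is at most [96 * q ^ 2 * snd l ^ 2]; the distance is below
     [10 * q * snd l = e / 2]. *)
  set (q := e / (20 * snd l)). assert (Hq : 0 < q) by (apply Rdiv_lt_0_compat; lra).
  set (k := Rmin 1 (q ^ 2)). assert (Hk : 0 < k) by (apply Rmin_pos; nra).
  assert (Hk1 : k <= 1) by apply Rmin_l. assert (Hk2 : k <= q ^ 2) by apply Rmin_r.
  apply (uf_imp2 U HU _ _ _ (uf_and U HU _ _ HR (Hd k Hk)) (Hy (e / 2) ltac:(lra))).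
  intros n [[H1 H2] H3] H4. rewrite Rminus_0_r in H3. apply Rabs_def2 in H3. destruct H3 as [H3 _].
  destruct (dH_bounds (x n) (y n) 1) as [H5 _]; auto. lra.
  pose proof (dH_eq (x n) (y n) (Hx n) (Hyu n)) as E.
  pose proof (dH_ge_0 (x n) (y n) (Hx n) (Hyu n)). pose proof (Hx n) as Hxn. pose proof (Hyu n) as Hyn. unfold uhp in Hxn, Hyn.
  assert (H6 : Cmod (x n - y n) ^ 2 <= (10 * q * snd l) ^ 2).
  { rewrite E. apply Rle_trans with (k * (4 * (6 * snd (y n)) * snd (y n))).
    - apply Rmult_le_compat; try lra; nra.
    - assert (snd (y n) * snd (y n) <= 4 * (snd l * snd l)) by nra.
      assert (0 <= k * (snd l * snd l)) by nra.
      assert (k * (snd l * snd l) <= q ^ 2 * (snd l * snd l)) by (apply Rmult_le_compat_r; nra).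
      assert (k * (snd (y n) * snd (y n)) <= k * (4 * (snd l * snd l))) by (apply Rmult_le_compat_l; lra). nra. }
  assert (H7 : Cmod (x n - y n) <= 10 * q * snd l) by (apply Cmod_le_of_sqr; auto; nra).
  assert (E' : 10 * q * snd l = e / 2) by (unfold q; field; lra).
  pose proof (Cmod_sub_triangle (x n) (y n) l). lra.
Qed.

Lemma ulim_dH x l : ulim U x l -> uhp l -> ulimR U (fun n => dH (x n) l) 0.
Proof.
  intros Hx Hl e He. destruct (dH_small l (e / 2) Hl ltac:(lra)) as (r & Hr & H).
  apply (uf_imp U HU) with (2 := Hx r Hr). intros n Hn. destruct (H (x n) Hn) as [H1 H2].
  rewrite Rminus_0_r, Rabs_pos_eq. lra. apply dH_ge_0; auto.
Qed.

(* [A] with [dA] is the disc or the half-plane with its hyperbolic function. *)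
Lemma ulim_into_uhp_local (A : C -> Prop) (dA : C -> C -> R) (gn : nat -> C -> C) g a :
  (forall a e, A a -> 0 < e -> exists r, 0 < r /\ forall w, in_ball a r w -> A w /\ dA w a <= e) ->
  (forall n, holo A (gn n)) -> (forall n z, A z -> uhp (gn n z)) ->
  (forall n z w, A z -> A w -> dH (gn n z) (gn n w) <= dA z w) ->
  (forall z, A z -> ulim U (fun n => gn n z) (g z)) -> A a -> uhp (g a) ->
  exists r M, 0 < r /\ (forall w, in_ball a r w -> A w) /\
    U (fun n => holo (in_ball a r) (gn n) /\ forall w, in_ball a r w -> Cmod (gn n w) <= M).
Proof.
  intros Hsm Hh Hu Hsp Hlim Ha Hga.
  destruct (Hsm a 1 Ha Rlt_0_1) as (r & Hr & H).
  exists r, (6 * (2 * snd (g a)) + (Cmod (g a) + 1)). split; auto. split. apply H.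
  apply (uf_imp U HU) with (2 := ulim_uhp_range _ _ (Hlim a Ha) Hga).
  intros n [H1 H2]. split. intros w Hw. apply Hh, H, Hw.
  intros w Hw. destruct (H w Hw) as [Hw1 Hw2].
  destruct (dH_bounds (gn n w) (gn n a) 1) as [_ H3]; auto. eapply Rle_trans. apply Hsp; auto. auto.
  pose proof (Cmod_sub_le (gn n w) (gn n a)). lra.
Qed.

Lemma ulim_into_uhp_holo (A : C -> Prop) (dA : C -> C -> R) (gn : nat -> C -> C) g :
  (forall a e, A a -> 0 < e -> exists r, 0 < r /\ forall w, in_ball a r w -> A w /\ dA w a <= e) ->
  (forall n, holo A (gn n)) -> (forall n z, A z -> uhp (gn n z)) ->
  (forall n z w, A z -> A w -> dH (gn n z) (gn n w) <= dA z w) ->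
  (forall z, A z -> ulim U (fun n => gn n z) (g z)) -> (forall z, A z -> uhp (g z)) -> holo A g.
Proof.
  intros Hsm Hh Hu Hsp Hlim Hgu a Ha.
  destruct (ulim_into_uhp_local A dA gn g a) as (r & M & Hr & HA & HB); auto.
  destruct (ulim_local U HU gn g a r M Hr HB) as (l & Hl & _); auto. eauto.
Qed.
End UhpLimits.

(** * Wolff's lemma *)

Lemma Cmod_le_1_of_disc (x : C) : disc x -> 0 < 1 - Cmod x ^ 2 <= 1.
Proof. intros H. split. apply disc_sqr; auto. pose proof (pow2_ge_0 (Cmod x)). lra. Qed.

Lemma dD_scal r p q : 0 <= r <= 1 -> disc p -> disc q -> dD (r * p) (r * q) <= r ^ 2 * dD p q.
Proof.
  intros Hr Hp Hq. apply disc_sqr in Hp. apply disc_sqr in Hq.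
  unfold dD. replace (r * p - r * q)%C with (r * (p - q))%C by ring.
  rewrite !Cmod_mult, !Cmod_R, !Rabs_pos_eq by lra. rewrite !Rpow_mult_distr.
  pose proof (pow2_ge_0 (Cmod p)). pose proof (pow2_ge_0 (Cmod q)).
  assert (Hr2 : 0 <= r ^ 2 <= 1) by nra.
  unfold Rdiv. rewrite Rmult_assoc. apply Rmult_le_compat_l. lra.
  apply Rmult_le_compat_l. apply pow2_ge_0. apply Rinv_le_contravar.
  - apply Rmult_lt_0_compat; auto.
  - apply Rmult_le_compat; nra.
Qed.

(** The map [r * psi] contracts [dD] by the factor [r ^ 2], so its iterates from 0, which stay in
    the disc of radius [r], converge geometrically. *)
Lemma fixed_point_scaled psi r : self_map psi -> 0 < r < 1 -> exists z, Cmod z <= r /\ z = (r * psi z)%C.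
Proof.
  intros [Hh Hd] Hr.
  assert (Hpsi : holo disc psi).
  { intros z Hz. destruct (Hh z Hz) as (l & Hl). exists l. apply cder_iff. auto. }
  pose (x := fun n => Nat.iter n (fun z => r * psi z)%C (RtoC 0)).
  assert (Hxd : forall n, disc (x n) /\ Cmod (x n) <= r).
  { induction n as [|n [IH1 IH2]].
    - simpl. unfold disc. rewrite Cmod_0. lra.
    - simpl. pose proof (Hd _ IH1) as H. unfold disc in *. fold (x n). rewrite Cmod_mult, Cmod_R, Rabs_pos_eq by lra.
      pose proof (Cmod_ge_0 (psi (x n))). split; nra. }
  assert (Hstep : forall n, dD (x (S n)) (x n) <= dD (x 1%nat) (x 0%nat) * (r ^ n) ^ 2).
  { induction n as [|n IH]. simpl; lra.
    change (x (S (S n))) with (r * psi (x (S n)))%C. change (x (S n)) with (r * psi (x n))%C at 2.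
    eapply Rle_trans. apply dD_scal. lra. apply Hd, Hxd. apply Hd, Hxd.
    pose proof (schwarz_pick psi Hpsi Hd _ _ (proj1 (Hxd (S n))) (proj1 (Hxd n))).
    apply Rle_trans with (r ^ 2 * (dD (x 1%nat) (x 0%nat) * (r ^ n) ^ 2)).
    - apply Rmult_le_compat_l. apply pow2_ge_0. lra.
    - simpl. right. ring. }
  set (d0 := dD (x 1%nat) (x 0%nat)) in *.
  assert (Hd0 : 0 <= d0) by (apply dD_ge_0; apply Hxd).
  destruct some_ultrafilter as (U & HU).
  (* The denominators of [dD] are at most 1, so a step is at most the square root of [d0] times
     [r ^ n], and [d0 + 1] dominates that square root. *)
  destruct (ulim_geometric U HU x (d0 + 1) r) as (z & Hz & Hzn). lra.
  { intros n. pose proof (pow_le r n ltac:(lra)). apply Cmod_le_of_sqr. nra.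
    rewrite dD_eq by apply Hxd.
    pose proof (Cmod_le_1_of_disc _ (proj1 (Hxd (S n)))). pose proof (Cmod_le_1_of_disc _ (proj1 (Hxd n))).
    specialize (Hstep n). pose proof (dD_ge_0 _ _ (proj1 (Hxd (S n))) (proj1 (Hxd n))).
    apply Rle_trans with (d0 * (r ^ n) ^ 2 * (1 * 1)).
    - apply Rmult_le_compat; try nra.
    - rewrite Rpow_mult_distr. pose proof (pow2_ge_0 (r ^ n)). nra. }
  assert (Hzr : Cmod z <= r) by (apply (ulim_Cmod_le U HU x); auto; apply uf_true; auto; apply Hxd).
  assert (Hzd : disc z) by (unfold disc; lra).
  exists z. split; auto.
  apply (ulim_unique U HU (fun n => x (S n))).
  - apply ulim_of_bound with (fun n => (d0 + 1) / (1 - r) * r * r ^ n); auto.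
    + apply uf_true; auto. intros n. eapply Rle_trans; [apply Hzn|]. simpl. right. ring.
    + replace 0 with ((d0 + 1) / (1 - r) * r * 0) by ring. apply ulimR_mult; auto using ulimR_const.
      apply ulimR_of_lim; auto. apply is_lim_seq_geom. rewrite Rabs_pos_eq; lra.
  - change (ulim U (fun n => (r * psi (x n))%C) (r * psi z)%C).
    apply ulim_mult; auto using ulim_const. apply ccont_ulim; auto. apply (holo_ccont disc); auto.
Qed.

(** The maps [r n * psi] have fixed points [z n]; their limit [tau] cannot lie in the disc, where
    [psi] would fix it. Schwarz-Pick around [z n] becomes in the limit the invariance of the
    horodiscs at [tau]. *)
Lemma wolff psi : self_map psi -> (forall z, disc z -> psi z <> z) ->
  exists tau, Cmod tau = 1 /\ forall z, disc z ->
    Cmod (tau - psi z) ^ 2 * (1 - Cmod z ^ 2) <= Cmod (tau - z) ^ 2 * (1 - Cmod (psi z) ^ 2).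
Proof.
  intros Hpsi Hfix.
  assert (Hh : holo disc psi).
  { intros z Hz. destruct (proj1 Hpsi z Hz) as (l & Hl). exists l. apply cder_iff. auto. }
  pose (r := fun n : nat => 1 - / INR (n + 2)).
  assert (Hr : forall n, 0 < r n < 1).
  { intros n. unfold r. rewrite plus_INR. simpl. pose proof (pos_INR n).
    assert (0 < / (INR n + (1 + 1)) < 1).
    { split. apply Rinv_0_lt_compat; lra. pose proof (Rinv_lt_contravar 1 (INR n + (1 + 1))) as Hi. rewrite Rinv_1 in Hi. apply Hi; lra. } lra. }
  assert (Hz : forall n, exists z, Cmod z <= r n /\ z = (r n * psi z)%C).
  { intros n. apply fixed_point_scaled; auto. }
  apply choice_fun in Hz. destruct Hz as (z & Hz).
  assert (Hzd : forall n, disc (z n)).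
  { intros n. destruct (Hz n) as [H _]. specialize (Hr n). unfold disc. lra. }
  destruct some_ultrafilter as (U & HU).
  assert (Hrl : ulimR U r 1).
  { apply ulimR_of_lim; auto. unfold r. replace (Finite 1) with (Finite (1 - 0)) by (f_equal; ring).
    apply is_lim_seq_minus'. apply is_lim_seq_const.
    apply (is_lim_seq_incr_n (fun n => / INR n) 2). replace (Finite 0) with (Rbar_inv p_infty) by reflexivity.
    apply is_lim_seq_inv. apply is_lim_seq_INR. discriminate. }
  assert (Hrc : ulim U (fun n => RtoC (r n)) 1) by (apply ulim_real_pair; auto using ulimR_const).
  destruct (ulim_bound_exists U HU z 1) as (tau & Htau).
  { apply uf_true; auto. intros n. specialize (Hzd n). unfold disc in Hzd. lra. }
  assert (Ht1 : Cmod tau <= 1).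
  { apply (ulim_Cmod_le U HU z); auto. apply uf_true; auto. intros n. specialize (Hzd n). unfold disc in Hzd. lra. }
  assert (Ht : Cmod tau = 1).
  { destruct Ht1 as [Hlt|]; auto. exfalso. apply (Hfix tau Hlt).
    apply (ulim_unique U HU z); auto.
    apply ulim_ext with (fun n => r n * psi (z n))%C; auto. intros n. symmetry. apply Hz.
    rewrite <- (Cmult_1_l (psi tau)).
    apply ulim_mult; auto. apply ccont_ulim; auto. apply (holo_ccont disc); auto. }
  exists tau. split; auto. intros w Hw.
  pose proof (proj2 Hpsi w Hw) as Hpw.
  assert (Hswap : forall x, Cmod (tau - x) = Cmod (1 - Cconj tau * x)).
  { intros x. rewrite <- (Rmult_1_l (Cmod (tau - x))). rewrite <- Ht, <- Cmod_conj at 1. rewrite <- Cmod_mult.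
    f_equal. replace (Cconj tau * (tau - x))%C with (tau * Cconj tau - Cconj tau * x)%C by ring.
    rewrite <- Cmod2_conj, Ht. replace (1 ^ 2) with 1 by ring. auto. }
  rewrite !Hswap.
  assert (HM : ulim U (fun n => r n * psi w)%C (1 * psi w)%C) by (apply ulim_mult; auto using ulim_const).
  rewrite Cmult_1_l in HM.
  apply (ulimR_le U HU
    (fun n => Cmod (1 - Cconj (z n) * (r n * psi w)) ^ 2 * (1 - Cmod w ^ 2))
    (fun n => Cmod (1 - Cconj (z n) * w) ^ 2 * (1 - Cmod (r n * psi w) ^ 2))).
  - assert (HL : ulim U (fun n => 1 - Cconj (z n) * (r n * psi w))%C (1 - Cconj tau * psi w)%C).
    { apply ulim_minus; auto using ulim_const. apply ulim_mult; auto.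
      apply ulim_real_pair; auto. apply ulim_fst; auto.
      apply ulimR_ext with (fun n => (-1) * snd (z n)); auto; [intros; simpl; ring|].
      replace (- snd tau) with ((-1) * snd tau) by ring. apply ulimR_mult; auto using ulimR_const, ulim_snd. }
    apply ulimR_mult; auto using ulimR_const. apply ulim_Cmod in HL; auto.
    simpl. apply ulimR_mult; auto. apply ulimR_mult; auto using ulimR_const.
  - assert (HL : ulim U (fun n => 1 - Cconj (z n) * w)%C (1 - Cconj tau * w)%C).
    { apply ulim_minus; auto using ulim_const. apply ulim_mult; auto using ulim_const.
      apply ulim_real_pair; auto. apply ulim_fst; auto.
      apply ulimR_ext with (fun n => (-1) * snd (z n)); auto; [intros; simpl; ring|].
      replace (- snd tau) with ((-1) * snd tau) by ring. apply ulimR_mult; auto using ulimR_const, ulim_snd. }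
    apply ulim_Cmod in HL; auto. apply ulim_Cmod in HM; auto.
    apply ulimR_mult; auto.
    + simpl. apply ulimR_mult; auto. apply ulimR_mult; auto using ulimR_const.
    + apply ulimR_ext with (fun n => 1 + (-1) * (Cmod (r n * psi w) * Cmod (r n * psi w))); auto; [intros; simpl; ring|].
      replace (1 - Cmod (psi w) ^ 2) with (1 + (-1) * (Cmod (psi w) * Cmod (psi w))) by ring.
      apply ulimR_plus; auto using ulimR_const. apply ulimR_mult; auto using ulimR_const. apply ulimR_mult; auto.
  - apply uf_true; auto. intros n.
    pose proof (Hr n) as Hrn.
    assert (Hrw : disc (r n * psi w)%C).
    { unfold disc in *. rewrite Cmod_mult, Cmod_R, Rabs_pos_eq by lra. pose proof (Cmod_ge_0 (psi w)). nra. }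
    (* Schwarz-Pick for [psi] followed by the contraction by [r n], using that [z n] is fixed.
       Rewritten through [1 - Cconj (z n) * x], the inequality survives the limit, in which
       [1 - Cmod (z n) ^ 2] tends to 0. *)
    assert (HD : dD (z n) (r n * psi w) <= dD (z n) w).
    { rewrite (proj2 (Hz n)) at 1. eapply Rle_trans. apply dD_scal. lra. apply Hpsi, Hzd. auto.
      pose proof (schwarz_pick psi Hh (proj2 Hpsi) _ _ (Hzd n) Hw).
      pose proof (dD_ge_0 _ _ (proj2 Hpsi _ (Hzd n)) Hpw).
      assert (Hr2 : 0 <= r n ^ 2 <= 1) by nra. nra. }
    rewrite !mobius_identity, !dD_eq by auto.
    pose proof (disc_sqr _ Hw) as P1. pose proof (disc_sqr _ Hrw) as P2. pose proof (disc_sqr _ (Hzd n)) as P3.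
    set (p1 := 1 - Cmod w ^ 2) in *. set (p2 := 1 - Cmod (r n * psi w) ^ 2) in *. set (p3 := 1 - Cmod (z n) ^ 2) in *.
    assert (0 < p3 * p2 * p1) by (repeat apply Rmult_lt_0_compat; auto). nra.
Qed.

(** * The hyperbolic model of a parabolic map *)

Lemma holomorphic_iff f : holomorphic f <-> holo disc f.
Proof.
  split; intros H z Hz; destruct (H z Hz) as (l & Hl); exists l; apply cder_iff; auto.
Qed.

Lemma self_map_holo f : self_map f -> holo disc f.
Proof. intros [H _]. apply holomorphic_iff; auto. Qed.

(** [icay] is defined on the closed half-plane and maps it into the closed disc, with real points
    going to the circle; a real value is thus an interior maximum of the modulus of [icay (u w)]. *)
Lemma im_zero_const Om u a : open_convex Om -> holo Om u -> (forall z, Om z -> 0 <= snd (u z)) ->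
  Om a -> snd (u a) = 0 -> forall z, Om z -> u z = u a.
Proof.
  intros HO Hu Him Ha H0 z Hz.
  assert (Hne : forall w, Om w -> (u w + Ci)%C <> 0).
  { intros w Hw E. apply (f_equal snd) in E. simpl in E. specialize (Him w Hw). lra. }
  assert (Hsq : forall w, Om w -> Cmod (u w + Ci) ^ 2 = Cmod (u w - Ci) ^ 2 + 4 * snd (u w)).
  { intros w _. rewrite !Cmod_sqr. destruct (u w); simpl; ring. }
  assert (HE : icay (u z) = icay (u a)).
  { apply (strong_maximum Om (fun w => icay (u w)) a); auto.
    - intros w Hw. destruct (Hu w Hw) as (l & Hl). eexists. apply cder_div. apply Hne; auto.
      apply cder_minus; [apply Hl|apply cder_const]. apply cder_plus; [apply Hl|apply cder_const].
    - intros w Hw. unfold icay. pose proof (Hne w Hw) as Hn. apply Cmod_gt_0 in Hn as Hp.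
      rewrite Cmod_div by auto. apply Rle_div_l; auto. rewrite Rmult_1_l.
      specialize (Hsq w Hw). specialize (Him w Hw). pose proof (Cmod_ge_0 (u w - Ci)). nra.
    - unfold icay. pose proof (Hne a Ha) as Hn. apply Cmod_gt_0 in Hn as Hp.
      rewrite Cmod_div by auto. specialize (Hsq a Ha). rewrite H0 in Hsq.
      assert (E : Cmod (u a + Ci) = Cmod (u a - Ci)).
      { pose proof (Cmod_ge_0 (u a - Ci)). nra. }
      rewrite <- E. field. lra. }
  pose proof (Hne z Hz) as Nz. pose proof (Hne a Ha) as Na. unfold icay in HE.
  assert (H2 : ((u z - Ci) * (u a + Ci) = (u a - Ci) * (u z + Ci))%C).
  { replace ((u z - Ci) * (u a + Ci))%C with ((u z - Ci) / (u z + Ci) * ((u z + Ci) * (u a + Ci)))%C by (field; auto).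
    rewrite HE. field; auto. }
  apply Cmod_eq_sub.
  replace (u z - u a)%C with (((u z - Ci) * (u a + Ci) - (u a - Ci) * (u z + Ci)) / (2 * Ci))%C
    by (field; apply Ci_neq_0).
  rewrite H2. replace ((u a - Ci) * (u z + Ci) - (u a - Ci) * (u z + Ci))%C with (RtoC 0) by ring.
  unfold Cdiv. rewrite Cmult_0_l. apply Cmod_0.
Qed.

Lemma uhp_shift w (t : R) : uhp w -> uhp (w + t)%C.
Proof. unfold uhp. simpl. lra. Qed.

(* Schwarz-Pick against the points [p + m b] with [m] large compares imaginary parts. *)
Lemma im_compare (w w' p p' : C) (b : R) : b <> 0 -> uhp w -> uhp w' -> uhp p -> uhp p' ->
  (forall m : nat, dH w' (p' + INR m * b) <= dH w (p + INR m * b)) ->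
  snd w * snd p <= snd w' * snd p'.
Proof.
  intros Hb Hw Hw' Hp Hp' H. unfold uhp in *.
  apply Rnot_lt_le. intros Hlt.
  set (A := Cmod (w' - p')). set (B := Cmod (w - p)).
  assert (Hm : forall m : nat, ((INR m * Rabs b) - A) ^ 2 * (snd w * snd p) <= (INR m * Rabs b + B) ^ 2 * (snd w' * snd p') \/ INR m * Rabs b < A).
  { intros m. specialize (H m). set (t := INR m * Rabs b).
    destruct (Rlt_le_dec t A) as [|HtA]; [right; auto|left].
    assert (Ht : Cmod (INR m * b) = t).
    { rewrite Cmod_mult, !Cmod_R. rewrite (Rabs_pos_eq (INR m)) by apply pos_INR. auto. }
    assert (L1 : t - A <= Cmod (w' - (p' + INR m * b))).
    { pose proof (Cmod_sub_le (INR m * b) ((w' - p') - (w' - (p' + INR m * b)))).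
      pose proof (Cmod_minus_le (w' - p') (w' - (p' + INR m * b))).
      replace (INR m * b - ((w' - p') - (w' - (p' + INR m * b))))%C with (RtoC 0) in H0 by ring.
      rewrite Cmod_0, Ht in H0. fold A in H1. lra. }
    assert (L2 : Cmod (w - (p + INR m * b)) <= t + B).
    { replace (w - (p + INR m * b))%C with ((w - p) - INR m * b)%C by ring.
      pose proof (Cmod_minus_le (w - p) (INR m * b)). rewrite Ht in H0. fold B in H0. lra. }
    unfold dH in H.
    replace (snd (p' + INR m * b)%C) with (snd p') in H by (simpl; ring).
    replace (snd (p + INR m * b)%C) with (snd p) in H by (simpl; ring).
    assert (Q1 : 0 < 4 * snd w' * snd p') by (repeat apply Rmult_lt_0_compat; lra).
    assert (Q2 : 0 < 4 * snd w * snd p) by (repeat apply Rmult_lt_0_compat; lra).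
    assert (H2 : (t - A) ^ 2 <= Cmod (w' - (p' + INR m * b)) ^ 2) by (apply pow_incr; lra).
    assert (H3 : Cmod (w - (p + INR m * b)) ^ 2 <= (t + B) ^ 2) by (apply pow_incr; split; auto using Cmod_ge_0).
    assert (H4 : (t - A) ^ 2 / (4 * snd w' * snd p') <= (t + B) ^ 2 / (4 * snd w * snd p)).
    { eapply Rle_trans; [|eapply Rle_trans; [apply H|]]; apply Rmult_le_compat_r; auto;
      left; apply Rinv_0_lt_compat; auto. }
    apply Rmult_le_compat_r with (r := (4 * snd w' * snd p') * (4 * snd w * snd p)) in H4; [|nra].
    replace ((t - A) ^ 2 / (4 * snd w' * snd p') * (4 * snd w' * snd p' * (4 * snd w * snd p))) with
      (16 * ((t - A) ^ 2 * (snd w * snd p)) / 4) in H4 by (field; lra).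
    replace ((t + B) ^ 2 / (4 * snd w * snd p) * (4 * snd w' * snd p' * (4 * snd w * snd p))) with
      (16 * ((t + B) ^ 2 * (snd w' * snd p')) / 4) in H4 by (field; lra).
    lra. }
  set (P := snd w * snd p) in *. set (Q := snd w' * snd p') in *.
  assert (HQ : 0 < Q) by (apply Rmult_lt_0_compat; auto).
  assert (HA : 0 <= A) by apply Cmod_ge_0. assert (HB : 0 <= B) by apply Cmod_ge_0.
  assert (Hbp : 0 < Rabs b) by (apply Rabs_pos_lt; auto).
  (* Expanding the first alternative gives [t ^ 2 * (P - Q) <= 2 * t * (A * P + B * Q) + B ^ 2 * Q].
     For [1 <= t] the quotient in [T] makes this fail, and the summand [A] excludes the second
     alternative [t < A]. *)
  set (T := A + 1 + (2 * (A + B) * P + B ^ 2 * Q + 2 * B * Q) / (P - Q) + 1).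
  destruct (archimed_cor1 (Rabs b / (Rabs T + 1))) as (N & HN & HN0).
  { apply Rdiv_lt_0_compat; auto. pose proof (Rabs_pos T). lra. }
  assert (HNp : 0 < INR N) by (apply lt_0_INR; auto).
  assert (HT : T < INR N * Rabs b).
  { pose proof (Rabs_pos T). pose proof (Rle_abs T). apply Rlt_div_r in HN; [|lra].
    apply Rmult_lt_compat_l with (r := INR N) in HN; auto.
    rewrite <- Rmult_assoc, Rinv_r in HN by lra. lra. }
  set (t := INR N * Rabs b) in *.
  assert (HX : 0 <= (2 * (A + B) * P + B ^ 2 * Q + 2 * B * Q) / (P - Q)).
  { apply Rdiv_le_0_compat; [|lra]. assert (0 < P) by lra. pose proof (pow2_ge_0 B). nra. }
  destruct (Hm N) as [H1|H1]; fold t in H1.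
  2: { unfold T in HT. lra. }
  assert (Ht1 : 1 <= t) by (unfold T in HT; lra).
  assert (H5 : (2 * (A + B) * P + B ^ 2 * Q + 2 * B * Q) <= t * (P - Q)).
  { apply Rle_div_l; [lra|]. unfold T in HT. lra. }
  assert (H6 : t * (2 * (A + B) * P + B ^ 2 * Q + 2 * B * Q) <= t * (t * (P - Q))) by (apply Rmult_le_compat_l; lra).
  assert (0 < P) by lra.
  assert (H7 : t * t * (P - Q) <= 2 * t * A * P + 2 * t * B * Q + B ^ 2 * Q - A ^ 2 * P) by nra.
  pose proof (pow2_ge_0 B). pose proof (pow2_ge_0 A).
  assert (B ^ 2 * Q <= t * (B ^ 2 * Q)) by (assert (0 <= B ^ 2 * Q) by nra; nra).
  assert (0 <= A ^ 2 * P) by nra. assert (0 <= t * B * P) by (repeat apply Rmult_le_pos; lra).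
  assert (H11 : t * t * (P - Q) = t * (2 * (A + B) * P + B ^ 2 * Q + 2 * B * Q) -> False).
  { intros E.
    assert (t = (2 * (A + B) * P + B ^ 2 * Q + 2 * B * Q) / (P - Q)); [|unfold T in HT; lra].
    apply Rmult_eq_reg_r with (t * (P - Q)).
    2: { apply Rgt_not_eq. apply Rmult_lt_0_compat; lra. }
    replace ((2 * (A + B) * P + B ^ 2 * Q + 2 * B * Q) / (P - Q) * (t * (P - Q))) with
      (t * (2 * (A + B) * P + B ^ 2 * Q + 2 * B * Q)) by (field; lra). lra. }
  apply H11. lra.
Qed.

Lemma dH_close l r : uhp l -> 0 < r -> exists e d, 0 < e /\ 0 < d /\
  forall a b, uhp a -> uhp b -> Cmod (b - l) < d -> dH a b <= e -> Cmod (a - l) < r.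
Proof.
  intros Hl Hr. unfold uhp in Hl.
  set (s := snd l) in *.
  set (q := r / (20 * s)). assert (Hq : 0 < q) by (apply Rdiv_lt_0_compat; lra).
  exists (Rmin 1 (q ^ 2)), (Rmin s (r / 2)).
  assert (Hk : 0 < Rmin 1 (q ^ 2)) by (apply Rmin_pos; nra).
  split; auto. split. apply Rmin_pos; lra.
  pose proof (Rmin_l 1 (q ^ 2)) as K1. pose proof (Rmin_r 1 (q ^ 2)) as K2.
  set (k := Rmin 1 (q ^ 2)) in *.
  intros a b Ha Hb Hbl Hd.
  assert (H1 : Cmod (b - l) < s) by (eapply Rlt_le_trans; [apply Hbl|apply Rmin_l]).
  assert (H2 : Cmod (b - l) < r / 2) by (eapply Rlt_le_trans; [apply Hbl|apply Rmin_r]).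
  assert (H3 : snd b <= 2 * s).
  { pose proof (Rabs_snd_le (b - l)) as H. simpl in H. fold s in H.
    apply Rle_lt_trans with (2 := H1) in H. apply Rabs_def2 in H. lra. }
  destruct (dH_bounds a b 1) as [H5 _]; auto. lra.
  pose proof (dH_eq a b Ha Hb) as E. pose proof (dH_ge_0 a b Ha Hb). unfold uhp in Ha, Hb.
  assert (H6 : Cmod (a - b) ^ 2 <= (10 * q * s) ^ 2).
  { rewrite E. apply Rle_trans with (k * (4 * (6 * snd b) * snd b)).
    - rewrite !Rmult_assoc. apply Rmult_le_compat; try lra; nra.
    - assert (snd b * snd b <= 4 * (s * s)) by nra.
      assert (k * (s * s) <= q ^ 2 * (s * s)) by (apply Rmult_le_compat_r; nra).
      assert (k * (snd b * snd b) <= k * (4 * (s * s))) by (apply Rmult_le_compat_l; lra). nra. }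
  assert (H7 : Cmod (a - b) <= 10 * q * s) by (apply Cmod_le_of_sqr; auto; nra).
  assert (E' : 10 * q * s = r / 2) by (unfold q; field; lra).
  pose proof (Cmod_sub_triangle a b l). lra.
Qed.

(** The two-point estimate is uniform in [n], and the derivatives at [a] converge to [l]. With
    [l <> 0] and [e] below [Cmod l], the maps [gn n] are therefore injective on one ball for
    [U]-almost all [n], as in Hurwitz' theorem. *)
Lemma ulim_two_points U (HU : ultrafilter U) (gn : nat -> C -> C) g a r M l e : 0 < r -> 0 < e ->
  U (fun n => holo (in_ball a r) (gn n) /\ forall w, in_ball a r w -> Cmod (gn n w) <= M) ->
  (forall w, in_ball a r w -> ulim U (fun n => gn n w) (g w)) -> cder g a l ->
  exists s, 0 < s /\ s <= r /\ U (fun n => forall x y, in_ball a s x -> in_ball a s y ->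
    Cmod (gn n x - gn n y - l * (x - y)) <= e * Cmod (x - y)).
Proof.
  intros Hr He Hb Hg Hl. destruct ball_estimates as (K & HK & HE).
  destruct (ulim_local U HU gn g a r M Hr Hb Hg) as (l' & Hl' & Hln).
  assert (l' = l) by (eapply cder_unique; eauto). subst l'.
  pose (dn := fun n => epsilon (inhabits (RtoC 0)) (fun l => cder (gn n) a l)).
  assert (Hdn : U (fun n => cder (gn n) a (dn n))).
  { apply (uf_imp U HU) with (2 := Hb). intros n [H _].
    apply (epsilon_spec (inhabits (RtoC 0)) (fun l => cder (gn n) a l)).
    apply H, in_ball_center; auto. }
  set (A := Rabs (K * M / r ^ 2)). assert (HA : 0 <= A) by apply Rabs_pos.
  set (s := Rmin (r / 2) (e / (4 * (A + 1)))).
  assert (Hs : 0 < s) by (apply Rmin_pos; [lra|apply Rdiv_lt_0_compat; lra]).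
  assert (Hs1 : s <= r / 2) by apply Rmin_l.
  assert (Hs2 : s * (4 * (A + 1)) <= e) by (apply Rle_div_r; [lra|apply Rmin_r]).
  exists s. split; auto. split. lra.
  apply (uf_imp2 U HU _ _ _ Hb (uf_and U HU _ _ Hdn (Hln dn Hdn (e / 2) ltac:(lra)))).
  intros n [H1 H2] [H3 H4] x y Hx Hy.
  destruct (HE (gn n) M a r Hr H1 H2 x y a (dn n)) as (_ & H & _); auto.
  { eapply in_ball_le; eauto. } { eapply in_ball_le; eauto. } { apply in_ball_center; lra. }
  replace (gn n x - gn n y - l * (x - y))%C with
    ((gn n x - gn n y - dn n * (x - y)) + (dn n - l) * (x - y))%C by ring.
  eapply Rle_trans. apply Cmod_triangle. rewrite Cmod_mult.
  unfold in_ball in Hx, Hy. pose proof (Cmod_ge_0 (x - y)).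
  assert (H5 : K * M / r ^ 2 * (Cmod (x - a) + Cmod (y - a)) <= e / 2).
  { apply Rle_trans with (A * (Cmod (x - a) + Cmod (y - a))).
    - apply Rmult_le_compat_r. pose proof (Cmod_ge_0 (x - a)). pose proof (Cmod_ge_0 (y - a)). lra. apply Rle_abs.
    - nra. }
  apply Rmult_le_compat_r with (r := Cmod (x - y)) in H5; auto.
  assert (Cmod (dn n - l) * Cmod (x - y) <= e / 2 * Cmod (x - y)) by (apply Rmult_le_compat_r; lra).
  lra.
Qed.

Lemma iterate_S_r (f : C -> C) n z : iterate f (S n) z = iterate f n (f z).
Proof. unfold iterate. induction n; simpl; auto. f_equal. exact IHn. Qed.

Lemma iterate_disc f n z : self_map f -> disc z -> disc (iterate f n z).
Proof. intros [_ H] Hz. induction n; simpl; auto. Qed.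

Lemma self_map_compose f g : self_map f -> self_map g -> self_map (compose f g).
Proof.
  intros Hf Hg. split.
  - apply holomorphic_iff. apply (holo_comp disc disc g f); auto using self_map_holo. apply Hg.
  - intros z Hz. apply Hf, Hg, Hz.
Qed.

Lemma self_map_iterate f n : self_map f -> self_map (iterate f n).
Proof.
  intros Hf. induction n.
  - split; auto. apply holomorphic_iff. intros z _. exists 1%C. apply cder_id.
  - exact (self_map_compose f (iterate f n) Hf IHn).
Qed.

Lemma centralizer_iterate_comm f psi n z : self_map f -> centralizer f psi -> disc z ->
  iterate f n (psi z) = psi (iterate f n z).
Proof.
  intros Hf [_ Hc] Hz. induction n; auto. simpl. change (f (iterate f n (psi z)) = psi (f (iterate f n z))).
  rewrite IHn. symmetry. apply Hc. apply iterate_disc; auto.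
Qed.

Lemma DW_limit f tau z : Denjoy_Wolff_point f tau -> disc z ->
  forall e, 0 < e -> exists N, forall n, (N <= n)%nat -> Cmod (iterate f n z - tau) < e.
Proof.
  intros [_ H] Hz e He. destruct (H z Hz) as (d & Hd). destruct (Hd (mkposreal e He)) as (N & HN).
  exists N. intros n Hn. apply (HN n Hn z Hz).
  replace (z - z)%C with (RtoC 0) by ring. rewrite Cmod_0. apply cond_pos.
Qed.

Lemma DW_no_fixed_point f tau z : Denjoy_Wolff_point f tau -> Cmod tau = 1 -> disc z -> f z <> z.
Proof.
  intros H Ht Hz E. unfold disc in Hz.
  destruct (DW_limit f tau z H Hz (1 - Cmod z) ltac:(lra)) as (N & HN).
  specialize (HN N (Nat.le_refl N)).
  assert (Hi : iterate f N z = z).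
  { clear HN. induction N as [|N IH]; [reflexivity|]. change (f (iterate f N z) = z). rewrite IH. exact E. }
  rewrite Hi, Cmod_sub_sym in HN. pose proof (Cmod_sub_le tau z). lra.
Qed.

Lemma angular_derivative_eps f sigma l M e : angular_derivative f sigma l -> 1 < M -> 0 < e ->
  exists d, 0 < d /\ forall z, disc z -> Cmod (z - sigma) < d -> Cmod (z - sigma) < M * (1 - Cmod z) ->
    Cmod ((f z - sigma) / (z - sigma) - l) < e.
Proof.
  intros H HM He.
  (* Balls of the product structure and balls of the modulus differ by a factor of at most [sqrt 2],
     hence the margin [e / 2]. *)
  assert (He' : 0 < e / 2) by lra.
  destruct (H M HM (fun w => Cmod (w - l) < e)) as (d & Hd).
  - exists (mkposreal _ He'). intros y Hy. apply C_NormedModule_mixin_compat2 in Hy. simpl in Hy.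
    change (Cmod (y - l) < sqrt 2 * (e / 2)) in Hy.
    assert (sqrt 2 <= 2). { rewrite <- (sqrt_Rsqr 2) at 2 by lra. apply sqrt_le_1_alt. unfold Rsqr. lra. }
    nra.
  - exists d. split. apply cond_pos. intros z Hz Hzd Hst. apply (Hd z).
    + apply C_NormedModule_mixin_compat1. exact Hzd.
    + split; auto.
Qed.

Lemma pseudo_hyperbolic_sqr z w : disc z -> disc w -> pseudo_hyperbolic_dist z w < 1 /\ pseudo_hyperbolic_dist z w ^ 2 <= dD z w.
Proof.
  intros Hz Hw. unfold pseudo_hyperbolic_dist.
  pose proof (mobius_denominator w z Hw Hz) as Hn. apply Cmod_gt_0 in Hn as Hp.
  rewrite Cmod_div by auto. pose proof (mobius_identity w z) as E. rewrite (Cmod_sub_sym w z) in E.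
  pose proof (disc_sqr z Hz) as Pz. pose proof (disc_sqr w Hw) as Pw. pose proof (Cmod_ge_0 (z - w)) as H0.
  split.
  - apply Rlt_div_l; auto. nra.
  - unfold Rdiv. rewrite Rpow_mult_distr, pow_inv, E. unfold dD.
    apply Rmult_le_compat_l. apply pow2_ge_0. apply Rinv_le_contravar.
    + apply Rmult_lt_0_compat; auto.
    + pose proof (pow2_ge_0 (Cmod (z - w))). lra.
Qed.

(** The quotient is the hyperbolic tangent of [l], and the pseudo-hyperbolic distance is the
    hyperbolic tangent of [hyperbolic_dist]; its square is at most [dD]. *)
Lemma hyperbolic_dist_lower z w l : disc z -> disc w -> 0 < l -> l < hyperbolic_dist z w ->
  ((exp (2 * l) - 1) / (exp (2 * l) + 1)) ^ 2 <= dD z w.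
Proof.
  intros Hz Hw Hl H. unfold hyperbolic_dist in H.
  destruct (pseudo_hyperbolic_sqr z w Hz Hw) as [H1 H2].
  assert (H0 : 0 <= pseudo_hyperbolic_dist z w) by apply Cmod_ge_0.
  set (p := pseudo_hyperbolic_dist z w) in *.
  eapply Rle_trans; [|apply H2].
  assert (HE : 1 < exp (2 * l)). { rewrite <- exp_0. apply exp_increasing. lra. }
  apply pow_incr. split. apply Rdiv_le_0_compat; lra.
  assert (H3 : exp (2 * l) < (1 + p) / (1 - p)).
  { rewrite <- (exp_ln ((1 + p) / (1 - p))). apply exp_increasing; lra. apply Rdiv_lt_0_compat; lra. }
  apply Rlt_div_r in H3; [|lra]. apply Rle_div_l; [lra|]. nra.
Qed.

(** A constant [s] that commutes with [phi] would have a fixed point of [phi] as its value;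
    constancy near [z] already means constancy on the disc. *)
Lemma centralizer_nonconstant phi s z d : (forall z, disc z -> phi z <> z) -> self_map phi -> centralizer phi s ->
  disc z -> 0 < d -> exists z', Cmod (z' - z) < d /\ disc z' /\ s z' <> s z.
Proof.
  intros Hfix Hphi Hs Hz Hd. apply NNPP. intros Hno.
  assert (Hc : forall w, disc w -> (s w - s z)%C = 0).
  { destruct (open_convex_nbhd disc disc_open_convex z Hz) as (r & Hr & Hb).
    apply (identity_theorem disc (fun w => s w - s z)%C z); auto using disc_open_convex.
    - intros w Hw. destruct (self_map_holo s (proj1 Hs) w Hw) as (l & Hl).
      eexists. apply cder_minus; [apply Hl|apply cder_const].
    - apply zeros_cluster_near with (Rmin d r). apply Rmin_pos; auto.
      intros w Hw. apply NNPP. intros Hn. apply Hno. exists w. unfold in_ball in Hw. repeat split.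
      + eapply Rlt_le_trans; [apply Hw|apply Rmin_l].
      + apply Hb. eapply Rlt_le_trans; [apply Hw|apply Rmin_r].
      + intros E. apply Hn. rewrite E. ring. }
  assert (Hc' : forall w, disc w -> s w = s z).
  { intros w Hw. apply Cmod_eq_sub. rewrite Hc; auto. apply Cmod_0. }
  apply (Hfix (s z)). apply (proj1 Hs); auto.
  destruct Hs as [_ Hs]. specialize (Hs z Hz). unfold compose in Hs. rewrite <- Hs. apply Hc'. apply Hphi; auto.
Qed.

(** Near [z] the values of [s] come arbitrarily close to [s z] without being equal to it, so the
    zeros of [F1 - F2] cluster at [s z]. *)
Lemma identity_after_centralizer phi s F1 F2 z d : (forall z, disc z -> phi z <> z) -> self_map phi -> centralizer phi s ->
  holo disc F1 -> holo disc F2 -> disc z -> 0 < d -> (forall w, in_ball z d w -> F1 (s w) = F2 (s w)) ->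
  forall w, disc w -> F1 w = F2 w.
Proof.
  intros Hfix Hphi Hs H1 H2 Hz Hd HE w Hw. apply Cmod_eq_sub.
  rewrite (identity_theorem disc (fun w => F1 w - F2 w)%C (s z)); auto using disc_open_convex.
  - apply Cmod_0.
  - intros x Hx. destruct (H1 x Hx) as (l1 & L1). destruct (H2 x Hx) as (l2 & L2).
    eexists. apply cder_minus; eauto.
  - apply (proj1 Hs); auto.
  - intros e He.
    destruct (holo_ccont disc s z (self_map_holo s (proj1 Hs)) Hz e He) as (d' & Hd' & Hc).
    destruct (centralizer_nonconstant phi s z (Rmin d d') Hfix Hphi Hs Hz) as (z' & Hz' & _ & Hn).
    { apply Rmin_pos; auto. }
    exists (s z'). repeat split; auto.
    + apply Hc. eapply Rlt_le_trans; [apply Hz'|apply Rmin_r].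
    + rewrite HE. ring. eapply Rlt_le_trans; [apply Hz'|apply Rmin_l].
Qed.

Lemma centralizer_self phi : self_map phi -> centralizer phi phi.
Proof. intros H. split; auto. intros z _. reflexivity. Qed.

Lemma centralizer_compose phi f g : centralizer phi f -> centralizer phi g -> centralizer phi (compose f g).
Proof.
  intros [Hf Cf] [Hg Cg]. split. apply self_map_compose; auto.
  intros z Hz. unfold compose. specialize (Cg z Hz). unfold compose in Cg. rewrite Cg.
  apply (Cf (g z)). apply Hg; auto.
Qed.

Lemma centralizer_iterate phi f n : centralizer phi f -> centralizer phi (iterate f n).
Proof.
  intros Hf. induction n.
  - split. apply (self_map_iterate f 0 (proj1 Hf)). intros z _. reflexivity.
  - exact (centralizer_compose phi f (iterate f n) Hf IHn).
Qed.

(* [G psi] is the action of [psi] on the half-plane; [h] need not be surjective, so that [G psi]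
   does not come from [h psi = G psi h] alone. *)
Record hyperbolic_model (phi h : C -> C) (b : R) (G : (C -> C) -> C -> C) : Prop := {
  hm_b : b <> 0;
  hm_holo : holo disc h;
  hm_uhp : forall z, disc z -> uhp (h z);
  hm_phi : forall z, disc z -> h (phi z) = (h z + b)%C;
  hm_G_holo : forall psi, centralizer phi psi -> holo uhp (G psi);
  hm_G_uhp : forall psi w, centralizer phi psi -> uhp w -> uhp (G psi w);
  hm_G : forall psi z, centralizer phi psi -> disc z -> h (psi z) = G psi (h z);
  hm_G_commute : forall psi1 psi2 w, centralizer phi psi1 -> centralizer phi psi2 ->
    commute_on_disc psi1 psi2 -> uhp w -> G psi1 (G psi2 w) = G psi2 (G psi1 w);
  hm_G_phi : forall w, uhp w -> G phi w = (w + b)%C;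
  hm_eventually : forall p q, disc p -> disc q -> h p = h q -> exists n, iterate phi n p = iterate phi n q;
  hm_faithful : forall f g, centralizer phi f -> centralizer phi g ->
    (forall z, disc z -> h (f z) = h (g z)) -> eq_on_disc f g
}.

(** * Construction of the model from one orbit of [phi] *)

Section Model.
Variables (phi : C -> C) (tau z0 : C) (c0 : R).
Hypothesis Hself : self_map phi.
Hypothesis Htau : Cmod tau = 1.
Hypothesis HDW : Denjoy_Wolff_point phi tau.
Hypothesis Hang : angular_derivative phi tau 1.
Hypothesis Hz0 : disc z0.
Hypothesis Hc0 : 0 < c0.
Hypothesis Hstep : exists N, forall n, (N <= n)%nat -> c0 <= dD (iterate phi n z0) (iterate phi (S n) z0).

(** The rotation moves [tau] to 1, so that the Cayley transform sends [tau] to infinity. *)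
Definition ct (z : C) : C := cay (Cconj tau * z).
Definition ict (w : C) : C := (tau * icay w)%C.

Lemma tau_conj : (tau * Cconj tau = 1)%C.
Proof. rewrite <- Cmod2_conj, Htau. replace (1 ^ 2) with 1 by ring. auto. Qed.

Lemma disc_rot z : disc z -> disc (Cconj tau * z).
Proof. unfold disc. rewrite Cmod_mult, Cmod_conj, Htau. lra. Qed.

Lemma ct_uhp z : disc z -> uhp (ct z).
Proof. intros Hz. apply cay_uhp, disc_rot; auto. Qed.

Lemma ict_disc w : uhp w -> disc (ict w).
Proof. intros Hw. apply icay_disc in Hw. unfold disc, ict in *. rewrite Cmod_mult, Htau. lra. Qed.

Lemma ct_ict w : uhp w -> ct (ict w) = w.
Proof.
  intros Hw. unfold ct, ict. replace (Cconj tau * (tau * icay w))%C with (tau * Cconj tau * icay w)%C by ring.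
  rewrite tau_conj, Cmult_1_l. apply cay_icay; auto.
Qed.

Lemma ict_ct z : disc z -> ict (ct z) = z.
Proof.
  intros Hz. unfold ct, ict. rewrite icay_cay by (apply disc_rot; auto).
  replace (tau * (Cconj tau * z))%C with (tau * Cconj tau * z)%C by ring. rewrite tau_conj. ring.
Qed.

Lemma dH_ct z w : disc z -> disc w -> dH (ct z) (ct w) = dD z w.
Proof.
  intros Hz Hw. unfold ct. rewrite dH_cay by (apply disc_rot; auto). unfold dD.
  replace (Cconj tau * z - Cconj tau * w)%C with (Cconj tau * (z - w))%C by ring.
  rewrite !Cmod_mult, Cmod_conj, Htau, !Rmult_1_l. auto.
Qed.

Lemma ct_holo : holo disc ct.
Proof.
  apply (holo_comp disc disc (fun z => Cconj tau * z)%C cay); auto using cay_holo, disc_rot.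
  intros z _. eexists. apply cder_scal, cder_id.
Qed.

Lemma ict_holo : holo uhp ict.
Proof. intros w Hw. destruct (icay_holo w Hw) as (l & Hl). eexists. apply cder_scal. apply Hl. Qed.

Lemma Cmod_rot z : Cmod (1 - Cconj tau * z) = Cmod (tau - z).
Proof.
  rewrite <- (Rmult_1_l (Cmod (1 - _))). rewrite <- Htau at 1. rewrite <- Cmod_mult. f_equal.
  replace (tau * (1 - Cconj tau * z))%C with (tau - tau * Cconj tau * z)%C by ring. rewrite tau_conj. ring.
Qed.

Lemma tau_sub_pos z : disc z -> 0 < Cmod (tau - z).
Proof. unfold disc. intros Hz. pose proof (Cmod_sub_le tau z). lra. Qed.

Lemma snd_ct z : disc z -> snd (ct z) = (1 - Cmod z ^ 2) / Cmod (tau - z) ^ 2.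
Proof.
  intros Hz. unfold ct. rewrite snd_cay by (apply disc_rot; auto).
  rewrite Cmod_rot, Cmod_mult, Cmod_conj, Htau, Rmult_1_l. auto.
Qed.

Lemma orbit_disc n : disc (iterate phi n z0).
Proof. apply iterate_disc; auto. Qed.

(** [snd (ct z)] is the quantity whose level sets are the horocycles at [tau]. Wolff's lemma gives
    the inequality at some boundary point [s]; along the orbit of [z] it bounds [Cmod (s - z) ^ 2]
    by a multiple of [1 - Cmod z ^ 2], which tends to 0, so the orbit converges to [s] and
    [s = tau]. *)
Lemma julia z : disc z -> snd (ct z) <= snd (ct (phi z)).
Proof.
  intros Hz.
  destruct (wolff phi Hself) as (s & Hs & HW).
  { intros w Hw. apply DW_no_fixed_point with tau; auto. }
  assert (Es : s = tau).
  { set (A := Cmod (s - z) ^ 2 / (1 - Cmod z ^ 2)).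
    assert (Hn : forall n, Cmod (s - iterate phi n z) ^ 2 <= A * (1 - Cmod (iterate phi n z) ^ 2)).
    { pose proof (disc_sqr z Hz). induction n as [|n IH].
      - unfold A. right. simpl. field. simpl in H. lra.
      - assert (Hd : disc (iterate phi n z)) by (apply iterate_disc; auto).
        pose proof (HW _ Hd) as H1. pose proof (disc_sqr _ Hd).
        change (iterate phi (S n) z) with (phi (iterate phi n z)).
        pose proof (disc_sqr _ (proj2 Hself _ Hd)).
        set (p := 1 - Cmod (iterate phi n z) ^ 2) in *. set (q := 1 - Cmod (phi (iterate phi n z)) ^ 2) in *.
        apply Rmult_le_reg_r with p; auto. nra. }
    destruct some_ultrafilter as (U & HU).
    assert (HL : ulim U (fun n => iterate phi n z) tau).
    { intros e He. apply uf_ev; auto. apply DW_limit; auto. }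
    assert (H0 : Cmod (s - tau) ^ 2 <= A * (1 + (-1) * Cmod tau ^ 2)).
    { apply (ulimR_le U HU (fun n => Cmod (s - iterate phi n z) ^ 2) (fun n => A * (1 + (-1) * Cmod (iterate phi n z) ^ 2))).
      - simpl. apply ulimR_mult; auto; [|apply ulimR_mult; auto using ulimR_const];
        apply (ulim_Cmod U HU (fun n => s - iterate phi n z)%C); auto; apply ulim_minus; auto using ulim_const.
      - apply ulimR_mult; auto using ulimR_const. apply ulimR_plus; auto using ulimR_const.
        apply ulimR_mult; auto using ulimR_const. simpl. apply ulimR_mult; auto using ulim_Cmod.
        apply ulimR_mult; auto using ulim_Cmod, ulimR_const.
      - apply uf_true; auto. intros n. specialize (Hn n). lra. }
    rewrite Htau in H0. apply Cmod_eq_sub. pose proof (Cmod_ge_0 (s - tau)). nra. }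
  subst s. pose proof (HW z Hz) as H. pose proof (proj2 Hself z Hz) as Hpz.
  rewrite !snd_ct by auto.
  pose proof (tau_sub_pos z Hz). pose proof (tau_sub_pos _ Hpz).
  apply Rle_div_l. nra.
  replace ((1 - Cmod (phi z) ^ 2) / Cmod (tau - phi z) ^ 2 * Cmod (tau - z) ^ 2) with
    ((1 - Cmod (phi z) ^ 2) * Cmod (tau - z) ^ 2 / Cmod (tau - phi z) ^ 2) by (field; lra).
  assert (Hq : Cmod (tau - phi z) ^ 2 > 0) by nra.
  apply (proj1 (Rle_div_r (1 - Cmod z ^ 2) _ _ Hq)). lra.
Qed.

Definition Zn (n : nat) : C := ct (iterate phi n z0).
Definition xn (n : nat) : R := fst (Zn n).
Definition yn (n : nat) : R := snd (Zn n).

Lemma yn_pos n : 0 < yn n.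
Proof. apply ct_uhp, orbit_disc. Qed.

Lemma Zn_uhp n : uhp (Zn n).
Proof. apply ct_uhp, orbit_disc. Qed.

Lemma dD_iterate n z w : disc z -> disc w -> dD (iterate phi n z) (iterate phi n w) <= dD z w.
Proof.
  intros Hz Hw. apply (schwarz_pick (iterate phi n)); auto.
  - apply self_map_holo, self_map_iterate; auto.
  - intros x Hx. apply iterate_disc; auto.
Qed.

(* If the imaginary parts grew geometrically, the orbit would converge to [tau] inside a Stolz
   region, where the angular derivative 1 makes consecutive steps negligible. *)
Lemma yn_ratio e N : 0 < e -> exists n, (N <= n)%nat /\ yn (S n) < (1 + e) * yn n.
Proof.
  intros He. apply NNPP. intros Hno.
  assert (Hg : forall n, (N <= n)%nat -> (1 + e) * yn n <= yn (S n)).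
  { intros n Hn. apply Rnot_lt_le. intros H. apply Hno. eauto. }
  clear Hno.
  set (k0 := dD z0 (phi z0)).
  assert (Hk0 : 0 <= k0) by (apply dD_ge_0; auto; apply Hself; auto).
  set (c := 2 + 4 * k0).
  assert (Hinc : forall n, Cmod (Zn n - Zn (S n)) <= c * yn (S n)).
  { intros n. apply (dH_bounds (Zn n) (Zn (S n)) k0); auto using Zn_uhp.
    unfold Zn. rewrite dH_ct by apply orbit_disc. rewrite iterate_S_r. apply dD_iterate; auto. apply Hself; auto. }
  (* The cone condition [Cmod (Zn n) <= A * yn n] is inherited from step to step: heights gain the
     factor [1 + e], and [c <= A * e / (1 + e)] leaves room for the increment [c * yn (S n)]. *)
  set (A := Rmax (Cmod (Zn N) / yn N) (c * (1 + e) / e)).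
  assert (HA1 : Cmod (Zn N) <= A * yn N) by (apply Rle_div_l; [apply yn_pos|apply Rmax_l]).
  assert (HA2 : c * (1 + e) <= A * e) by (apply Rle_div_l; [auto|apply Rmax_r]).
  assert (HAp : 0 < A). { assert (0 < c * (1 + e)) by (unfold c; nra). nra. }
  assert (Hbig : forall n, (N <= n)%nat -> Cmod (Zn n) <= A * yn n).
  { intros n Hn. induction Hn as [|n Hn IH]; auto.
    specialize (Hinc n). specialize (Hg n Hn). pose proof (yn_pos n). pose proof (yn_pos (S n)).
    pose proof (Cmod_sub_le (Zn (S n)) (Zn n)). rewrite (Cmod_sub_sym (Zn (S n)) (Zn n)) in H1.
    assert (H2 : (1 + e) * (A * yn n) <= A * yn (S n)) by nra.
    assert (H3 : c * (1 + e) * yn (S n) <= A * e * yn (S n)) by (apply Rmult_le_compat_r; lra).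
    apply Rmult_le_reg_l with (1 + e). lra. nra. }
  (* With this [eta] a step is less than [e / (1 + e)] times [yn (S n)], whereas growth by the
     factor [1 + e] needs at least that much. *)
  set (eta := e / (1 + e) / (4 * (A + 1))).
  assert (Heta : 0 < eta) by (repeat apply Rdiv_lt_0_compat; lra).
  destruct (angular_derivative_eps phi tau 1 (2 * A + 2) eta Hang ltac:(lra) Heta) as (d & Hd & HH).
  destruct (DW_limit phi tau z0 HDW Hz0 (Rmin d 1)) as (N1 & HN1). apply Rmin_pos; lra.
  set (n := (N + N1)%nat).
  assert (Hn : (N <= n)%nat) by (unfold n; lia).
  pose proof (HN1 n ltac:(unfold n; lia)) as Hn1. pose proof (HN1 (S n) ltac:(unfold n; lia)) as Hn2.
  pose proof (orbit_disc n) as Dn. pose proof (orbit_disc (S n)) as Dm.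
  set (z := iterate phi n z0) in *. set (z' := iterate phi (S n) z0) in *.
  assert (Hzt : Cmod (z - tau) < d /\ Cmod (z - tau) < 1).
  { pose proof (Rmin_l d 1). pose proof (Rmin_r d 1). lra. }
  assert (Hzt' : Cmod (z' - tau) < 1) by (pose proof (Rmin_r d 1); lra).
  set (u := (Cconj tau * z)%C). set (u' := (Cconj tau * z')%C).
  assert (Eu : Cmod (1 - u) = Cmod (z - tau)) by (unfold u; rewrite Cmod_rot; apply Cmod_sub_sym).
  assert (Eu' : Cmod (1 - u') = Cmod (z' - tau)) by (unfold u'; rewrite Cmod_rot; apply Cmod_sub_sym).
  assert (Du : disc u) by (apply disc_rot; auto). assert (Du' : disc u') by (apply disc_rot; auto).
  assert (Mu : Cmod u = Cmod z) by (unfold u; rewrite Cmod_mult, Cmod_conj, Htau; ring).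
  assert (Nu : (1 - u)%C <> 0) by (apply one_minus_neq; auto).
  assert (Nu' : (1 - u')%C <> 0) by (apply one_minus_neq; auto).
  apply Cmod_gt_0 in Nu as Pu. apply Cmod_gt_0 in Nu' as Pu'.
  assert (P1 : forall x, Cmod (1 - x) < 1 -> 1 <= Cmod (1 + x)).
  { intros x Hx. pose proof (Cmod_sub_le 2 (1 - x)). rewrite Cmod_R, Rabs_pos_eq in H by lra.
    replace (2 - (1 - x))%C with (1 + x)%C in H by ring. lra. }
  assert (EZ : forall x, disc x -> Cmod (cay x) = Cmod (1 + x) / Cmod (1 - x)).
  { intros x Hx. unfold cay. rewrite Cmod_div by (apply one_minus_neq; auto). rewrite Cmod_mult, Cmod_Ci. f_equal. ring. }
  (* Near [tau] one has [1 <= Cmod (1 + u)], so the cone condition in the half-plane reads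
     [Cmod (1 - u) <= A * (1 - Cmod z ^ 2)], a Stolz region in the disc. *)
  assert (HStolz : Cmod (z - tau) < (2 * A + 2) * (1 - Cmod z)).
  { specialize (Hbig n Hn). unfold yn, Zn in Hbig. fold z in Hbig. rewrite snd_ct in Hbig by auto.
    unfold ct in Hbig. fold u in Hbig. rewrite EZ in Hbig by auto.
    rewrite <- Cmod_rot in Hbig. fold u in Hbig.
    specialize (P1 u ltac:(lra)). unfold disc in Dn. pose proof (Cmod_ge_0 z).
    apply Rmult_le_compat_r with (r := Cmod (1 - u) ^ 2) in Hbig; [|nra].
    replace (Cmod (1 + u) / Cmod (1 - u) * Cmod (1 - u) ^ 2) with (Cmod (1 + u) * Cmod (1 - u)) in Hbig by (field; lra).
    replace (A * ((1 - Cmod z ^ 2) / Cmod (1 - u) ^ 2) * Cmod (1 - u) ^ 2) with (A * (1 - Cmod z ^ 2)) in Hbig by (field; lra).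
    assert (Cmod (1 - u) <= A * (1 - Cmod z ^ 2)) by nra.
    assert (1 - Cmod z ^ 2 <= 2 * (1 - Cmod z)) by nra. nra. }
  specialize (HH z Dn (proj1 Hzt) HStolz). change (phi z) with z' in HH.
  assert (Hzn : (z - tau)%C <> 0) by (apply Cmod_gt_0; lra).
  replace ((z' - tau) / (z - tau) - 1)%C with ((z' - z) / (z - tau))%C in HH by (field; auto).
  rewrite Cmod_div in HH by auto. assert (Hzp : Cmod (z - tau) > 0) by lra.
  apply (proj1 (Rlt_div_l _ _ _ Hzp)) in HH.
  assert (Ed : Cmod (Zn (S n) - Zn n) = 2 * Cmod (z' - z) / (Cmod (1 - u') * Cmod (1 - u))).
  { unfold Zn, ct. fold z z' u u'.
    replace (cay u' - cay u)%C with (2 * Ci * (u' - u) / ((1 - u') * (1 - u)))%C by (unfold cay; field; auto).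
    rewrite Cmod_div by (apply Cmult_neq_0; auto). rewrite !Cmod_mult, Cmod_Ci, Cmod_R, Rabs_pos_eq by lra.
    replace (u' - u)%C with (Cconj tau * (z' - z))%C by (unfold u, u'; ring).
    rewrite Cmod_mult, Cmod_conj, Htau. field. lra. }
  assert (Hd1 : Cmod (Zn (S n) - Zn n) <= 2 * eta * Cmod (Zn (S n))).
  { rewrite Ed. unfold Zn, ct. fold z'. fold u'. rewrite EZ by auto.
    specialize (P1 u' ltac:(lra)).
    apply Rle_div_l. nra. rewrite <- Eu in HH.
    replace (2 * eta * (Cmod (1 + u') / Cmod (1 - u')) * (Cmod (1 - u') * Cmod (1 - u))) with
      (2 * (eta * Cmod (1 - u)) * Cmod (1 + u')) by (field; lra).
    assert (0 < eta * Cmod (1 - u)) by nra. nra. }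
  specialize (Hg n Hn). pose proof (Hbig (S n) ltac:(lia)) as HB. pose proof (yn_pos (S n)) as Y1.
  assert (Hd2 : yn (S n) - yn n <= Cmod (Zn (S n) - Zn n)).
  { pose proof (Rabs_snd_le (Zn (S n) - Zn n)) as H. simpl in H.
    eapply Rle_trans; [|apply H]. apply Rle_abs. }
  assert (Hd3 : yn (S n) - yn n <= 2 * eta * (A * yn (S n))).
  { assert (2 * eta * Cmod (Zn (S n)) <= 2 * eta * (A * yn (S n))) by (apply Rmult_le_compat_l; lra). lra. }
  assert (E5 : eta * (4 * (A + 1)) = e / (1 + e)) by (unfold eta; field; lra).
  assert (E6 : 2 * eta * A < e / (1 + e)) by nra.
  assert (E7 : yn n <= yn (S n) / (1 + e)).
  { apply (proj1 (Rle_div_r (yn n) _ (1 + e) ltac:(lra))). lra. }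
  assert (E8 : yn (S n) / (1 + e) = yn (S n) - e / (1 + e) * yn (S n)) by (field; lra).
  nra.
Qed.

Lemma yn_mono n : yn n <= yn (S n).
Proof. apply julia, orbit_disc. Qed.

(** By [yn_ratio] the ratio is close to 1 only for infinitely many [n]; the corresponding decreasing
    sets are put into the ultrafilter. The lower bound 1 comes from [julia]. *)
Lemma model_ultrafilter : exists U, ultrafilter U /\ ulimR U (fun n => yn (S n) / yn n) 1.
Proof.
  destruct (ultrafilter_exists (fun k n => yn (S n) < (1 + / INR (S k)) * yn n)) as (U & HU & HP).
  - intros k n H. eapply Rlt_le_trans; [apply H|]. apply Rmult_le_compat_r. left; apply yn_pos.
    apply Rplus_le_compat_l. apply Rinv_le_contravar. apply lt_0_INR; lia. apply le_INR; lia.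
  - intros k N. apply yn_ratio. apply Rinv_0_lt_compat. apply lt_0_INR; lia.
  - exists U. split; auto. intros e He.
    destruct (archimed_cor1 e He) as (k & Hk & Hk0).
    apply (uf_imp U HU) with (2 := HP k). intros n Hn. pose proof (yn_pos n). pose proof (yn_mono n).
    assert (H1 : 1 <= yn (S n) / yn n) by (apply (proj1 (Rle_div_r 1 _ (yn n) H)); lra).
    assert (H2 : yn (S n) / yn n < 1 + / INR (S k)) by (apply Rlt_div_l; auto).
    assert (/ INR (S k) <= / INR k). { apply Rinv_le_contravar. apply lt_0_INR; auto. apply le_INR; lia. }
    apply Rabs_def1; lra.
Qed.

Variable U : (nat -> Prop) -> Prop.
Hypothesis HU : ultrafilter U.
Hypothesis Hratio : ulimR U (fun n => yn (S n) / yn n) 1.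

Definition UL (x : nat -> C) : C := epsilon (inhabits (RtoC 0)) (ulim U x).

Lemma UL_spec x : (exists l, ulim U x l) -> ulim U x (UL x).
Proof. apply (epsilon_spec (inhabits (RtoC 0)) (ulim U x)). Qed.

(** The affine automorphism of the half-plane that takes the orbit point [Zn n] to [Ci]; [usc] is
    its inverse, and both preserve [dH]. *)
Definition sc (n : nat) (w : C) : C := ((w - xn n) / yn n)%C.
Definition usc (n : nat) (w : C) : C := (xn n + yn n * w)%C.

Lemma yn_neq n : RtoC (yn n) <> 0.
Proof. intros E. apply RtoC_inj in E. pose proof (yn_pos n). lra. Qed.

Lemma snd_sc n w : snd (sc n w) = snd w / yn n.
Proof.
  unfold sc, Cdiv. rewrite <- RtoC_inv by (apply Rgt_not_eq, yn_pos). simpl.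
  field. apply Rgt_not_eq, yn_pos.
Qed.

Lemma sc_uhp n w : uhp w -> uhp (sc n w).
Proof. unfold uhp. rewrite snd_sc. intros. apply Rdiv_lt_0_compat; auto. apply yn_pos. Qed.

Lemma snd_usc n w : snd (usc n w) = yn n * snd w.
Proof. unfold usc. simpl. ring. Qed.

Lemma usc_uhp n w : uhp w -> uhp (usc n w).
Proof. unfold uhp. rewrite snd_usc. intros. apply Rmult_lt_0_compat; auto. apply yn_pos. Qed.

Lemma usc_sc n w : usc n (sc n w) = w.
Proof. unfold sc, usc. field. apply yn_neq. Qed.

Lemma dH_usc n v w : dH (usc n v) (usc n w) = dH v w.
Proof.
  unfold dH. rewrite !snd_usc. replace (usc n v - usc n w)%C with (yn n * (v - w))%C by (unfold usc; ring).
  pose proof (yn_pos n). rewrite Cmod_mult, Cmod_R, Rabs_pos_eq, Rpow_mult_distr by lra. unfold Rdiv.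
  replace (4 * (yn n * snd v) * (yn n * snd w)) with (yn n ^ 2 * (4 * snd v * snd w)) by ring.
  rewrite Rinv_mult. set (X := / (4 * snd v * snd w)). field. lra.
Qed.

Lemma dH_sc n v w : dH (sc n v) (sc n w) = dH v w.
Proof. rewrite <- (dH_usc n), !usc_sc. auto. Qed.

Lemma usc_holo n : holo uhp (usc n).
Proof. intros w _. eexists. apply cder_plus. apply cder_const. apply cder_scal, cder_id. Qed.

Lemma sc_holo n : holo uhp (sc n).
Proof.
  intros w _. eexists. apply cder_mult. apply cder_minus. apply cder_id. apply cder_const. apply cder_const.
Qed.

Definition hn (n : nat) (z : C) : C := sc n (ct (iterate phi n z)).
(** The map [psi] read in the [n]-th rescaled coordinate. It acts on the whole half-plane, and so
    does its limit [G psi], while [h] only sees the image of the disc. *)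
Definition pn (psi : C -> C) (n : nat) (w : C) : C := sc n (ct (psi (ict (usc n w)))).

Lemma hn_uhp n z : disc z -> uhp (hn n z).
Proof. intros Hz. apply sc_uhp, ct_uhp, iterate_disc; auto. Qed.

Lemma hn_holo n : holo disc (hn n).
Proof.
  apply (holo_comp disc uhp (fun z => ct (iterate phi n z)) (sc n)); auto using sc_holo.
  - apply (holo_comp disc disc (iterate phi n) ct); auto using ct_holo.
    apply self_map_holo, self_map_iterate; auto. intros z Hz; apply iterate_disc; auto.
  - intros z Hz. apply ct_uhp, iterate_disc; auto.
Qed.

Lemma hn_dH n z w : disc z -> disc w -> dH (hn n z) (hn n w) = dD (iterate phi n z) (iterate phi n w).
Proof. intros Hz Hw. unfold hn. rewrite dH_sc, dH_ct; auto using iterate_disc. Qed.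

Lemma hn_sp n z w : disc z -> disc w -> dH (hn n z) (hn n w) <= dD z w.
Proof. intros Hz Hw. rewrite hn_dH by auto. apply dD_iterate; auto. Qed.

Lemma Ci_uhp : uhp Ci.
Proof. unfold uhp. simpl. lra. Qed.

Lemma hn_z0 n : hn n z0 = Ci.
Proof.
  unfold hn. fold (Zn n). unfold sc. pose proof (yn_neq n).
  replace (Zn n - xn n)%C with (yn n * Ci)%C.
  - field. auto.
  - unfold xn, yn. destruct (Zn n) as [x y]. unfold Ci. apply injective_projections; simpl; ring.
Qed.

Lemma pn_arg_disc n w : uhp w -> disc (ict (usc n w)).
Proof. intros Hw. apply ict_disc, usc_uhp; auto. Qed.

Lemma pn_uhp psi n w : self_map psi -> uhp w -> uhp (pn psi n w).
Proof. intros Hp Hw. apply sc_uhp, ct_uhp, Hp, pn_arg_disc; auto. Qed.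

Lemma ict_usc_holo n : holo uhp (fun w => ict (usc n w)).
Proof. apply (holo_comp uhp uhp (usc n) ict); auto using usc_holo, ict_holo, usc_uhp. Qed.

Lemma pn_holo psi n : self_map psi -> holo uhp (pn psi n).
Proof.
  intros Hp. apply (holo_comp uhp uhp (fun w => ct (psi (ict (usc n w)))) (sc n)); auto using sc_holo.
  - apply (holo_comp uhp disc (fun w => psi (ict (usc n w))) ct); auto using ct_holo.
    + apply (holo_comp uhp disc (fun w => ict (usc n w)) psi); auto using ict_usc_holo, self_map_holo, pn_arg_disc.
    + intros z Hz. apply Hp, pn_arg_disc; auto.
  - intros z Hz. apply ct_uhp, Hp, pn_arg_disc; auto.
Qed.

Lemma pn_sp psi n v w : self_map psi -> uhp v -> uhp w -> dH (pn psi n v) (pn psi n w) <= dH v w.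
Proof. intros Hp. apply schwarz_pick_HH. apply pn_holo; auto. intros; apply pn_uhp; auto. Qed.

Lemma pn_hn psi n z : centralizer phi psi -> disc z -> pn psi n (hn n z) = hn n (psi z).
Proof.
  intros Hp Hz. unfold pn, hn. rewrite usc_sc, ict_ct by (apply iterate_disc; auto).
  rewrite centralizer_iterate_comm; auto.
Qed.

Lemma ulimR_squeeze (a c : nat -> R) : (forall n, 0 <= a n <= c n) -> ulimR U c 0 -> ulimR U a 0.
Proof.
  intros H Hc e He. apply (uf_imp U HU) with (2 := Hc e He). intros n Hn. specialize (H n).
  rewrite Rminus_0_r in *. rewrite Rabs_pos_eq in * by lra. lra.
Qed.

(** By Schwarz-Pick, replacing the fixed point [l] by points [x n] tending to it changes the values
    by a hyperbolic distance that tends to 0; this allows limits of compositions. *)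
Lemma ulim_through (fn : nat -> C -> C) x l m : (forall n w, uhp w -> uhp (fn n w)) ->
  (forall n v w, uhp v -> uhp w -> dH (fn n v) (fn n w) <= dH v w) ->
  ulim U (fun n => fn n l) m -> uhp m -> (forall n, uhp (x n)) -> ulim U x l -> uhp l ->
  ulim U (fun n => fn n (x n)) m.
Proof.
  intros Hu Hsp Hm Hmu Hx Hxl Hl.
  apply (ulim_of_dH U HU _ (fun n => fn n l)); auto.
  apply ulimR_squeeze with (fun n => dH (x n) l). 2: apply ulim_dH; auto.
  intros n. split; auto using dH_ge_0.
Qed.

Definition h (z : C) : C := UL (fun n => hn n z).
Definition G (psi : C -> C) (w : C) : C := UL (fun n => pn psi n w).

Lemma h_lim z : disc z -> ulim U (fun n => hn n z) (h z) /\ uhp (h z).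
Proof.
  intros Hz.
  destruct (uhp_ulim_exists U HU (fun n => hn n z) (fun _ => Ci) Ci (dD z z0)) as (l & Hl & Hu);
    auto using hn_uhp, Ci_uhp, ulim_const.
  - intros n. rewrite <- (hn_z0 n). apply hn_sp; auto.
  - assert (H : ulim U (fun n => hn n z) (h z)) by (apply UL_spec; eauto).
    split; auto. rewrite <- (ulim_unique U HU _ _ _ Hl H). auto.
Qed.

Lemma h_z0 : h z0 = Ci.
Proof.
  apply (ulim_unique U HU (fun n => hn n z0)). apply h_lim; auto.
  apply ulim_ext with (fun _ => Ci); auto using ulim_const. intros; symmetry; apply hn_z0.
Qed.

(** At [Ci] the values are [hn n (psi z0)], which converge in the half-plane; at [w] they stay
    within [dH w Ci] of these. *)
Lemma G_lim psi w : centralizer phi psi -> uhp w -> ulim U (fun n => pn psi n w) (G psi w) /\ uhp (G psi w).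
Proof.
  intros Hp Hw.
  assert (Hpz : disc (psi z0)) by (apply Hp; auto).
  destruct (h_lim _ Hpz) as [L1 L2].
  destruct (uhp_ulim_exists U HU (fun n => pn psi n w) (fun n => hn n (psi z0)) (h (psi z0)) (dH w Ci)) as (l & Hl & Hu).
  - intros n. apply pn_uhp; auto. apply Hp.
  - intros n. apply hn_uhp; auto.
  - intros n. rewrite <- pn_hn, hn_z0 by auto. apply pn_sp; auto using Ci_uhp. apply Hp.
  - exact L1.
  - exact L2.
  - assert (H : ulim U (fun n => pn psi n w) (G psi w)) by (apply UL_spec; eauto).
    split; auto. rewrite <- (ulim_unique U HU _ _ _ Hl H). auto.
Qed.

Lemma h_holo : holo disc h.
Proof.
  apply (ulim_into_uhp_holo U HU disc dD hn h).
  - apply dD_small.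
  - apply hn_holo.
  - intros; apply hn_uhp; auto.
  - intros; apply hn_sp; auto.
  - intros; apply h_lim; auto.
  - intros; apply h_lim; auto.
Qed.

Lemma G_holo psi : centralizer phi psi -> holo uhp (G psi).
Proof.
  intros Hp. apply (ulim_into_uhp_holo U HU uhp dH (pn psi) (G psi)).
  - apply dH_small.
  - intros; apply pn_holo, Hp.
  - intros; apply pn_uhp; auto; apply Hp.
  - intros; apply pn_sp; auto; apply Hp.
  - intros; apply G_lim; auto.
  - intros; apply G_lim; auto.
Qed.

Lemma G_through psi x l : centralizer phi psi -> (forall n, uhp (x n)) -> ulim U x l -> uhp l ->
  ulim U (fun n => pn psi n (x n)) (G psi l).
Proof.
  intros Hp Hx Hxl Hl. apply ulim_through with l; auto; try apply G_lim; auto.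
  - intros; apply pn_uhp; auto; apply Hp.
  - intros; apply pn_sp; auto; apply Hp.
Qed.

Lemma h_G psi z : centralizer phi psi -> disc z -> h (psi z) = G psi (h z).
Proof.
  intros Hp Hz. destruct (h_lim z Hz) as [H1 H2].
  apply (ulim_unique U HU (fun n => hn n (psi z))). apply h_lim, Hp; auto.
  apply ulim_ext with (fun n => pn psi n (hn n z)); auto. intros; apply pn_hn; auto.
  apply G_through; auto using hn_uhp.
Qed.

Lemma G_commute psi1 psi2 w : centralizer phi psi1 -> centralizer phi psi2 -> commute_on_disc psi1 psi2 ->
  uhp w -> G psi1 (G psi2 w) = G psi2 (G psi1 w).
Proof.
  intros H1 H2 Hc Hw.
  apply (ulim_unique U HU (fun n => pn psi1 n (pn psi2 n w))).
  - apply G_through; auto; try (apply G_lim; auto). intros; apply pn_uhp; auto; apply H2.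
  - apply ulim_ext with (fun n => pn psi2 n (pn psi1 n w)); auto.
    + intros n. unfold pn. pose proof (pn_arg_disc n w Hw) as Hd.
      rewrite !usc_sc, !ict_ct by (try apply H1; try apply H2; auto).
      specialize (Hc _ Hd). unfold compose in Hc. rewrite Hc. auto.
    + apply G_through; auto; try (apply G_lim; auto). intros; apply pn_uhp; auto; apply H1.
Qed.

Lemma hn_phi_z0 n : hn n (phi z0) = sc n (Zn (S n)).
Proof. unfold hn, Zn. rewrite <- iterate_S_r. auto. Qed.

Definition b : R := fst (h (phi z0)).

Lemma phi_z0_disc : disc (phi z0).
Proof. apply Hself; auto. Qed.

(** The height of [hn n (phi z0)] is [yn (S n) / yn n], which tends to 1 along [U]. *)
Lemma h_phi_z0 : h (phi z0) = (Ci + b)%C.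
Proof.
  destruct (h_lim (phi z0) phi_z0_disc) as [H1 _].
  assert (H2 : snd (h (phi z0)) = 1).
  { apply (ulimR_unique U HU (fun n => snd (hn n (phi z0)))). apply ulim_snd; auto.
    apply ulimR_ext with (fun n => yn (S n) / yn n); auto. intros n. rewrite hn_phi_z0, snd_sc. auto. }
  unfold b. destruct (h (phi z0)) as [x y]. simpl in *. subst y. unfold Ci. apply injective_projections; simpl; ring.
Qed.

(** Otherwise [hn n (phi z0)] would tend to [Ci]; but its distance to [Ci = hn n z0] is the [n]-th
    step of the orbit, which is at least [c0] for large [n]. *)
Lemma b_neq_0 : b <> 0.
Proof.
  intros E. pose proof h_phi_z0 as H. rewrite E in H. rewrite Cplus_0_r in H.
  destruct (h_lim (phi z0) phi_z0_disc) as [H1 _]. rewrite H in H1.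
  pose proof (ulim_dH U HU _ _ H1 Ci_uhp) as H2.
  destruct Hstep as (N & HN).
  destruct (uf_ex U HU _ (uf_and U HU _ _ (H2 c0 Hc0) (uf_eventually U HU N))) as (n & H3 & H4).
  specialize (HN n H4). rewrite <- (hn_z0 n), hn_dH in H3 by (auto using phi_z0_disc).
  rewrite <- iterate_S_r, dD_sym, Rminus_0_r in H3. apply Rabs_def2 in H3. lra.
Qed.

(** By [julia] the difference [G phi w - w] has nonnegative imaginary part, and at [Ci = h z0] it is
    the real number [b]; hence it is constant. *)
Lemma G_phi w : uhp w -> G phi w = (w + b)%C.
Proof.
  intros Hw. pose proof (centralizer_self phi Hself) as Hp.
  assert (E : (G phi w - w = G phi Ci - Ci)%C).
  { apply (im_zero_const uhp (fun w => G phi w - w)%C Ci); auto using uhp_open_convex, Ci_uhp.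
    - intros x Hx. destruct (G_holo phi Hp x Hx) as (l & Hl). eexists. apply cder_minus; [apply Hl|apply cder_id].
    - intros x Hx. simpl. assert (snd x <= snd (G phi x)); [|lra].
      apply (ulimR_ge_l U HU (fun n => snd (pn phi n x))). apply ulim_snd; auto. apply G_lim; auto.
      apply uf_true; auto. intros n. unfold pn. rewrite snd_sc.
      apply (proj1 (Rle_div_r (snd x) _ _ (yn_pos n))).
      eapply Rle_trans; [|apply julia, pn_arg_disc; auto]. rewrite ct_ict by (apply usc_uhp; auto).
      rewrite snd_usc. lra.
    - rewrite <- h_z0 at 1. rewrite <- h_G by auto. rewrite h_phi_z0. simpl. ring. }
  replace (G phi w) with ((G phi w - w) + w)%C by ring. rewrite E.
  rewrite <- h_z0 at 1. rewrite <- h_G by auto. rewrite h_phi_z0. ring.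
Qed.

Lemma h_phi z : disc z -> h (phi z) = (h z + b)%C.
Proof.
  intros Hz. rewrite h_G by (auto using centralizer_self). apply G_phi. apply h_lim; auto.
Qed.

Lemma h_iterate n z : disc z -> h (iterate phi n z) = (h z + INR n * b)%C.
Proof.
  intros Hz. induction n as [|n IH].
  - simpl. ring.
  - change (iterate phi (S n) z) with (phi (iterate phi n z)). rewrite h_phi by (apply iterate_disc; auto).
    rewrite IH, S_INR, RtoC_plus. ring.
Qed.

(* [Fn n] inverts [hn n] up to the fixed map [h]; it tends to the identity, so that [h] is
   eventually injective along the orbit. *)
Definition Fn (n : nat) (w : C) : C := (h (ict (usc n w)) - INR n * b)%C.

Lemma Fn_uhp n w : uhp w -> uhp (Fn n w).
Proof.
  intros Hw. destruct (h_lim _ (pn_arg_disc n w Hw)) as [_ H]. unfold uhp, Fn in *. simpl. lra.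
Qed.

Lemma Fn_holo n : holo uhp (Fn n).
Proof.
  intros w Hw. destruct (holo_comp uhp disc (fun w => ict (usc n w)) h (ict_usc_holo n) h_holo (pn_arg_disc n) w Hw) as (l & Hl).
  eexists. apply cder_minus; [apply Hl|apply cder_const].
Qed.

Lemma Fn_sp n v w : uhp v -> uhp w -> dH (Fn n v) (Fn n w) <= dH v w.
Proof. apply schwarz_pick_HH. apply Fn_holo. intros; apply Fn_uhp; auto. Qed.

Lemma Fn_hn n z : disc z -> Fn n (hn n z) = h z.
Proof.
  intros Hz. unfold Fn, hn. rewrite usc_sc, ict_ct by (apply iterate_disc; auto).
  rewrite h_iterate by auto. ring.
Qed.

(** The limit [L] fixes the image of [h], in particular all points [Ci + m * b]. Against these,
    [im_compare] shows that [L] lowers no imaginary part; as [L] fixes [Ci], the difference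
    [L w - w] is constant and equal to 0. *)
Lemma Fn_lim w : uhp w -> ulim U (fun n => Fn n w) w.
Proof.
  pose (L := fun w => UL (fun n => Fn n w)).
  assert (HL : forall w, uhp w -> ulim U (fun n => Fn n w) (L w) /\ uhp (L w)).
  { intros x Hx.
    destruct (uhp_ulim_exists U HU (fun n => Fn n x) (fun _ => Ci) Ci (dH x Ci)) as (l & Hl & Hu);
      auto using Fn_uhp, Ci_uhp, ulim_const.
    - intros n. rewrite <- h_z0 at 1. rewrite <- (Fn_hn n z0 Hz0), hn_z0. apply Fn_sp; auto using Ci_uhp.
    - assert (H : ulim U (fun n => Fn n x) (L x)) by (apply UL_spec; eauto).
      split; auto. rewrite <- (ulim_unique U HU _ _ _ Hl H). auto. }
  assert (HLh : holo uhp L).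
  { apply (ulim_into_uhp_holo U HU uhp dH Fn L).
    - apply dH_small.
    - apply Fn_holo.
    - intros; apply Fn_uhp; auto.
    - intros; apply Fn_sp; auto.
    - intros; apply HL; auto.
    - intros; apply HL; auto. }
  assert (HLfix : forall z, disc z -> L (h z) = h z).
  { intros z Hz. destruct (h_lim z Hz) as [H1 H2].
    apply (ulim_unique U HU (fun n => Fn n (h z))). apply HL; auto.
    apply (ulim_of_dH U HU _ (fun n => Fn n (hn n z))); auto using Fn_uhp, hn_uhp.
    - apply ulim_ext with (fun _ => h z); auto using ulim_const. intros; symmetry; apply Fn_hn; auto.
    - apply ulimR_squeeze with (fun n => dH (hn n z) (h z)). 2: apply ulim_dH; auto.
      intros n. split. apply dH_ge_0; auto using Fn_uhp, hn_uhp. rewrite dH_sym. apply Fn_sp; auto using hn_uhp. }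
  assert (HLm : forall m : nat, L (Ci + INR m * b)%C = (Ci + INR m * b)%C).
  { intros m. rewrite <- h_z0, <- h_iterate by auto. apply HLfix, iterate_disc; auto. }
  assert (Hmu : forall m : nat, uhp (Ci + INR m * b)%C).
  { intros m. unfold uhp. simpl. lra. }
  intros Hw.
  assert (E : (L w - w = L Ci - Ci)%C).
  { apply (im_zero_const uhp (fun w => L w - w)%C Ci); auto using uhp_open_convex, Ci_uhp.
    - intros x Hx. destruct (HLh x Hx) as (l & Hl). eexists. apply cder_minus; [apply Hl|apply cder_id].
    - intros x Hx. simpl.
      assert (snd x * snd Ci <= snd (L x) * snd Ci).
      { apply (im_compare x (L x) Ci Ci b); auto using Ci_uhp, b_neq_0. apply HL; auto.
        intros m. rewrite <- HLm at 1. apply schwarz_pick_HH; auto. intros; apply HL; auto. }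
      simpl in H. lra.
    - rewrite <- h_z0, HLfix by auto. simpl. ring. }
  assert (EL : L w = w).
  { replace (L w) with ((L w - w) + w)%C by ring. rewrite E, <- h_z0, HLfix by auto. ring. }
  pose proof (proj1 (HL w Hw)) as H. rewrite EL in H. exact H.
Qed.

(** The limit of [Fn n] is the identity, of slope 1, so the two-point estimate with error [1 / 2]
    separates points on a ball that does not depend on [n]. *)
Lemma Fn_injective w : uhp w -> exists s, 0 < s /\
  U (fun n => forall x y, in_ball w s x -> in_ball w s y -> Fn n x = Fn n y -> x = y).
Proof.
  intros Hw.
  destruct (ulim_into_uhp_local U HU uhp dH Fn (fun w => w) w) as (r & M & Hr & HA & HB); auto using Fn_lim.
  - apply dH_small.
  - apply Fn_holo.
  - intros; apply Fn_uhp; auto.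
  - intros; apply Fn_sp; auto.
  - destruct (ulim_two_points U HU Fn (fun w => w) w r M 1 (1 / 2) Hr ltac:(lra) HB) as (s & Hs & _ & HS).
    + intros x Hx. apply Fn_lim; auto.
    + apply cder_id.
    + exists s. split; auto. apply (uf_imp U HU) with (2 := HS). intros n Hn x y Hx Hy E.
      specialize (Hn x y Hx Hy). rewrite E in Hn.
      replace (Fn n y - Fn n y - 1 * (x - y))%C with (- (x - y))%C in Hn by ring. rewrite Cmod_opp in Hn.
      apply Cmod_eq_sub. pose proof (Cmod_ge_0 (x - y)). lra.
Qed.

Lemma hn_injective n p q : disc p -> disc q -> hn n p = hn n q -> iterate phi n p = iterate phi n q.
Proof.
  intros Hp Hq E. unfold hn in E. apply (f_equal (usc n)) in E. rewrite !usc_sc in E.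
  apply (f_equal ict) in E. rewrite !ict_ct in E by (apply iterate_disc; auto). auto.
Qed.

(** For suitable [n] both [hn n p] and [hn n q] lie in the ball around [h p] on which [Fn n] is
    injective, and [Fn n] maps them to the common value [h p = h q]. *)
Lemma h_eventually p q : disc p -> disc q -> h p = h q -> exists n, iterate phi n p = iterate phi n q.
Proof.
  intros Hp Hq E. destruct (h_lim p Hp) as [H1 H2]. destruct (h_lim q Hq) as [H3 _]. rewrite <- E in H3.
  destruct (Fn_injective (h p) H2) as (s & Hs & HS).
  destruct (uf_ex U HU _ (uf_and U HU _ _ HS (uf_and U HU _ _ (H1 s Hs) (H3 s Hs)))) as (n & H4 & H5 & H6).
  exists n. apply hn_injective; auto. apply H4; auto. rewrite !Fn_hn; auto.
Qed.

(** The argument of [h_eventually], with one [n] for all points near [z0]: Schwarz-Pick keeps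
    [hn n (f w)] and [hn n (g w)] in the ball where [Fn n] is injective. So [f] and [g] agree on the
    values of [iterate phi n] near [z0], and hence everywhere. *)
Lemma h_faithful f g : centralizer phi f -> centralizer phi g ->
  (forall z, disc z -> h (f z) = h (g z)) -> eq_on_disc f g.
Proof.
  intros Hf Hg E.
  assert (Hfz : disc (f z0)) by (apply Hf; auto). assert (Hgz : disc (g z0)) by (apply Hg; auto).
  destruct (h_lim _ Hfz) as [H1 H2]. destruct (h_lim _ Hgz) as [H3 _]. rewrite <- E in H3 by auto.
  destruct (Fn_injective _ H2) as (s & Hs & HS).
  destruct (dH_close _ s H2 Hs) as (e & d & He & Hd & HC).
  destruct (dD_small z0 e Hz0 He) as (r & Hr & Hsm).
  destruct (uf_ex U HU _ (uf_and U HU _ _ HS (uf_and U HU _ _ (H1 d Hd) (H3 d Hd)))) as (n & H4 & H5 & H6).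
  unfold eq_on_disc. apply (identity_after_centralizer phi (iterate phi n) f g z0 r); auto using self_map_holo.
  - intros z Hz. apply DW_no_fixed_point with tau; auto.
  - apply centralizer_iterate, centralizer_self; auto.
  - apply self_map_holo, Hf.
  - apply self_map_holo, Hg.
  - intros w Hw. destruct (Hsm w Hw) as [Hwd Hwe].
    assert (Hfw : disc (f w)) by (apply Hf; auto). assert (Hgw : disc (g w)) by (apply Hg; auto).
    rewrite <- !centralizer_iterate_comm by auto. apply hn_injective; auto. apply H4.
    + apply HC with (hn n (f z0)); auto using hn_uhp. eapply Rle_trans; [apply hn_sp; auto|].
      eapply Rle_trans; [apply schwarz_pick; auto|auto]. apply self_map_holo, Hf. apply Hf.
    + apply HC with (hn n (g z0)); auto using hn_uhp. eapply Rle_trans; [apply hn_sp; auto|].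
      eapply Rle_trans; [apply schwarz_pick; auto|auto]. apply self_map_holo, Hg. apply Hg.
    + rewrite !Fn_hn by auto. apply E; auto.
Qed.

Lemma model_properties : hyperbolic_model phi h b G.
Proof.
  constructor; auto using b_neq_0, h_holo, h_phi, G_holo, h_G, G_commute, G_phi, h_eventually, h_faithful.
  - intros; apply h_lim; auto.
  - intros; apply G_lim; auto.
Qed.

End Model.

Theorem hyperbolic_model_exists phi : parabolic phi -> positive_hyperbolic_step phi ->
  exists h b G, hyperbolic_model phi h b G.
Proof.
  intros (Hself & tau & HDW & Htau & Hang) (z0 & Hz0 & l & Hl & Hlim).
  (* [q] is the hyperbolic tangent of [l / 2], which the hyperbolic steps eventually exceed. *)
  set (q := (exp (2 * (l / 2)) - 1) / (exp (2 * (l / 2)) + 1)).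
  assert (HE : 1 < exp (2 * (l / 2))). { rewrite <- exp_0. apply exp_increasing. lra. }
  assert (Hq : 0 < q) by (apply Rdiv_lt_0_compat; lra).
  assert (Hstep : exists N, forall n, (N <= n)%nat -> q ^ 2 <= dD (iterate phi n z0) (iterate phi (S n) z0)).
  { apply is_lim_seq_spec in Hlim. destruct (Hlim (mkposreal (l / 2) ltac:(lra))) as (N & HN).
    exists N. intros n Hn. specialize (HN n Hn).
    change (Rabs (hyperbolic_dist (iterate phi n z0) (iterate phi (S n) z0) - l) < l / 2) in HN. apply Rabs_def2 in HN.
    apply hyperbolic_dist_lower; try lra; apply iterate_disc; auto. }
  destruct (model_ultrafilter phi tau z0 Hself Htau HDW Hang Hz0) as (U & HU & Hr).
  eexists _, _, _. eapply (model_properties phi tau z0 (q ^ 2)); eauto. nra.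
Qed.

(** * Self-maps of the half-plane commuting with a translation *)

Definition cderiv (f : C -> C) (z : C) : C := epsilon (inhabits (RtoC 0)) (fun l => cder f z l).

Lemma cderiv_spec S f z : holo S f -> S z -> cder f z (cderiv f z).
Proof. intros Hf Hz. apply (epsilon_spec (inhabits (RtoC 0)) (fun l => cder f z l)). apply Hf; auto. Qed.

Lemma cderiv_holo S f : open_convex S -> holo S f -> holo S (cderiv f).
Proof. intros HS Hf. apply (derivative_holo S f); auto. intros z Hz. apply (cderiv_spec S); auto. Qed.

Lemma mean_value S f x y M : open_convex S -> holo S f -> (forall t, 0 <= t <= 1 -> S (path x y t)) ->
  (forall t, 0 <= t <= 1 -> Cmod (cderiv f (path x y t)) <= M) -> Cmod (f y - f x) <= M * Cmod (y - x).
Proof.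
  intros HS Hf Hp HM.
  assert (Hc : segcont (cderiv f) x y).
  { intros t Ht. apply (holo_ccont S). apply cderiv_holo; auto. auto. }
  rewrite <- (seg_FTC f (cderiv f)); auto.
  - rewrite Rmult_comm. apply seg_bound; auto.
  - intros t Ht. apply (cderiv_spec S); auto.
Qed.

Lemma snd_path x y t : snd (path x y t) = (1 - t) * snd x + t * snd y.
Proof. unfold path. simpl. ring. Qed.

Lemma path_snd_ge x y t s : 0 <= t <= 1 -> s <= snd x -> s <= snd y -> s <= snd (path x y t).
Proof. intros. rewrite snd_path. nra. Qed.

Definition decays (f : C -> C) (m : nat) : Prop :=
  exists A, 0 <= A /\ forall w, uhp w -> Cmod (f w) <= A / snd w ^ m.

(** Cauchy's estimate on the ball of radius [snd w / 2], where heights are at least [snd w / 2],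
    gains one power of the height. *)
Lemma decays_cderiv f m : holo uhp f -> decays f m -> decays (cderiv f) (S m).
Proof.
  intros Hf (A & HA & Hb). destruct ball_estimates as (K & HK & HE).
  exists (K * A * 2 ^ S m). split. { assert (0 < 2 ^ S m) by (apply pow_lt; lra). apply Rmult_le_pos; nra. }
  intros w Hw. pose proof Hw as Hs. unfold uhp in Hs.
  assert (Hball : forall x, in_ball w (snd w / 2) x -> snd w / 2 <= snd x).
  { intros x Hx. unfold in_ball in Hx. pose proof (Rabs_snd_le (x - w)) as H. simpl in H.
    apply Rle_lt_trans with (2 := Hx) in H. apply Rabs_def2 in H. lra. }
  destruct (HE f (A / (snd w / 2) ^ m) w (snd w / 2)) with (x := w) (y := w) (c := w) (l := cderiv f w) as (_ & _ & H);
    try (apply in_ball_center; lra); auto; try lra.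
  - intros x Hx. apply Hf. apply Hball in Hx. unfold uhp. lra.
  - intros x Hx. apply Hball in Hx. eapply Rle_trans. apply Hb. unfold uhp. lra.
    apply Rmult_le_compat_l; auto. apply Rinv_le_contravar. apply pow_lt. lra. apply pow_incr. lra.
  - apply (cderiv_spec uhp); auto.
  - eapply Rle_trans; [apply H|]. right.
    replace (snd w) with (2 * (snd w / 2)) at 3 by field. rewrite Rpow_mult_distr. simpl.
    assert (snd w ^ m <> 0) by (apply pow_nonzero; lra).
    assert ((snd w / 2) ^ m <> 0) by (apply pow_nonzero; lra).
    assert (2 ^ m <> 0) by (apply pow_nonzero; lra).
    field. repeat split; auto; lra.
Qed.

Section Shift.
Variable b : R.
Hypothesis Hb : b <> 0.

Definition periodic (f : C -> C) : Prop := forall w, uhp w -> f (w + b)%C = f w.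

Lemma cderiv_periodic f : holo uhp f -> periodic f -> periodic (cderiv f).
Proof.
  intros Hf Hp w Hw. pose proof Hw as Hs. unfold uhp in Hs. apply (cder_unique f w).
  - apply cder_ext with (fun x => f (x + b)%C) (snd w); auto.
    + intros x Hx. apply Hp. pose proof (Rabs_snd_le (x - w)) as H. simpl in H.
      apply Rle_lt_trans with (2 := Hx) in H. apply Rabs_def2 in H. unfold uhp. lra.
    + replace (cderiv f (w + b)%C) with (cderiv f (w + b)%C * (1 + 0))%C by ring.
      apply (cder_comp f (fun x => x + b)%C). apply (cderiv_spec uhp); auto. apply uhp_shift; auto.
      apply cder_plus; [apply cder_id|apply cder_const].
  - apply (cderiv_spec uhp); auto.
Qed.

(* The derivative of a periodic function has mean zero over a period, so it is bounded by the
   second derivative on the same horizontal line. *)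
Lemma decays_mean_zero f m : holo uhp f -> periodic f -> decays (cderiv (cderiv f)) m -> decays (cderiv f) m.
Proof.
  intros Hf Hp (A & HA & HB). exists (Rabs b * A). split. { apply Rmult_le_pos; auto. apply Rabs_pos. }
  intros w Hw. pose proof Hw as Hs. unfold uhp in Hs.
  pose proof (cderiv_holo uhp f uhp_open_convex Hf) as Hf1.
  assert (Hline : forall s t, 0 <= s <= 1 -> 0 <= t <= 1 -> snd (path w (path w (w + b)%C s) t) = snd w).
  { intros s t Hs' Ht. rewrite !snd_path. simpl. ring. }
  assert (Hd : forall s, 0 <= s <= 1 -> Cmod (cderiv f (path w (w + b)%C s) - cderiv f w) <= A / snd w ^ m * Rabs b).
  { intros s Hs'. eapply Rle_trans. apply (mean_value uhp (cderiv f) w) with (M := A / snd w ^ m); auto using uhp_open_convex.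
    - intros t Ht. unfold uhp. rewrite Hline; auto.
    - intros t Ht. rewrite <- (Hline s t) by auto. apply HB. unfold uhp. rewrite Hline; auto.
    - apply Rmult_le_compat_l. apply Rdiv_le_0_compat; auto. apply pow_lt; auto.
      unfold path. replace (w + s * (w + b - w) - w)%C with (s * b)%C by ring.
      rewrite Cmod_mult, !Cmod_R, Rabs_pos_eq by lra. pose proof (Rabs_pos b). nra. }
  assert (Hup : forall t, 0 <= t <= 1 -> uhp (path w (w + b)%C t)).
  { intros t Ht. unfold uhp. rewrite snd_path. simpl. nra. }
  assert (Hseg : seg (fun x => cderiv f x - cderiv f w)%C w (w + b)%C = (- (b * cderiv f w))%C).
  { rewrite (seg_FTC (fun x => f x - cderiv f w * x)%C).
    - rewrite Hp by auto. ring.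
    - intros t Ht. apply cder_minus. apply (cderiv_spec uhp); auto.
      eapply cder_eq; [|apply cder_scal, cder_id]. ring.
    - intros t Ht. apply ccont_minus. apply (holo_ccont uhp); auto. apply ccont_const. }
  assert (H : Cmod (b * cderiv f w) <= Rabs b * (A / snd w ^ m * Rabs b)).
  { rewrite <- Cmod_opp, <- Hseg.
    replace (Rabs b) with (Cmod (w + b - w)) at 1.
    2: { replace (w + b - w)%C with (RtoC b) by ring. apply Cmod_R. }
    apply seg_bound; auto. intros t Ht. apply ccont_minus. apply (holo_ccont uhp); auto. apply ccont_const. }
  rewrite Cmod_mult, Cmod_R in H. apply Rmult_le_reg_l in H. 2: apply Rabs_pos_lt; auto.
  eapply Rle_trans; [apply H|]. right. unfold Rdiv. ring.
Qed.

Lemma periodic_reduce f w : periodic f -> uhp w -> exists w', snd w' = snd w /\ Rabs (fst w') <= Rabs b /\ f w' = f w.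
Proof.
  intros Hp Hw.
  assert (Hnat : forall n x, uhp x -> f (x + INR n * b)%C = f x).
  { induction n as [|n IH]; intros x Hx.
    - simpl. f_equal. ring.
    - rewrite S_INR, RtoC_plus. replace (x + (INR n + 1) * b)%C with ((x + INR n * b) + b)%C by ring.
      rewrite Hp. auto. unfold uhp in *. simpl. lra. }
  set (m := Int_part (fst w / b)).
  exists (w - IZR m * b)%C.
  assert (Hs : snd (w - IZR m * b)%C = snd w) by (simpl; ring).
  split; auto. split.
  - destruct (base_Int_part (fst w / b)) as [H1 H2]. fold m in H1, H2.
    replace (fst (w - IZR m * b)%C) with ((fst w / b - IZR m) * b) by (simpl; field; auto).
    rewrite Rabs_mult. rewrite (Rabs_pos_eq (fst w / b - IZR m)) by lra. pose proof (Rabs_pos b). nra.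
  - destruct (Z.le_gt_cases 0 m) as [Hm|Hm].
    + assert (E : IZR m = INR (Z.to_nat m)) by (rewrite INR_IZR_INZ, Z2Nat.id; auto).
      rewrite E in *. rewrite <- (Hnat (Z.to_nat m)). f_equal. ring. unfold uhp. rewrite Hs. auto.
    + assert (E : IZR m = - INR (Z.to_nat (- m))).
      { rewrite INR_IZR_INZ, Z2Nat.id by lia. rewrite opp_IZR. ring. }
      rewrite E in *. rewrite RtoC_opp. rewrite <- (Hnat (Z.to_nat (- m)) w) by auto. f_equal. ring.
Qed.

Definition tends_to (f : C -> C) (l : C) (A Y : R) : Prop :=
  forall w y, Y <= y -> y <= snd w -> Cmod (f w - l) <= A / y.

(** The bound uses a common lower bound [y] of the heights, so that it applies to two points at
    different heights. *)
Definition lipschitz_decay (f : C -> C) (A Y : R) : Prop :=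
  forall w w' y, Y <= y -> y <= snd w -> y <= snd w' -> Cmod (f w - f w') <= A / y ^ 2 * Cmod (w - w').

(** Periodicity upgrades the decay of the derivative to cubic order. Vertical variation is then at
    most [A / y ^ 2], and horizontal variation is bounded over one period, which gives a limit [l]
    with quadratic rate. *)
Lemma periodic_disc_valued V : holo uhp V -> periodic V -> (forall w, uhp w -> disc (V w)) ->
  exists l A, disc l /\ 0 <= A /\
    (forall w y, 1 <= y -> y <= snd w -> Cmod (V w - l) <= A / y ^ 2) /\ lipschitz_decay V A 1.
Proof.
  intros HV Hp Hd.
  assert (D0 : decays V 0).
  { exists 1. split. lra. intros w Hw. specialize (Hd w Hw). unfold disc in Hd. simpl. lra. }
  pose proof (cderiv_holo uhp V uhp_open_convex HV) as H1.
  pose proof (cderiv_holo uhp _ uhp_open_convex H1) as H2.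
  (* Boundedness and three Cauchy estimates give cubic decay of the third derivative; the mean-zero
     argument, used twice, brings it down to the first. *)
  assert (D3 : decays (cderiv V) 3).
  { apply decays_mean_zero; auto. apply decays_mean_zero; auto. apply cderiv_periodic; auto.
    apply decays_cderiv; auto. apply decays_cderiv; auto. apply decays_cderiv; auto. }
  destruct D3 as (A & HA & HB).
  assert (HL : forall w w' y, 0 < y -> y <= snd w -> y <= snd w' -> Cmod (V w - V w') <= A / y ^ 3 * Cmod (w - w')).
  { intros w w' y Hy Hw Hw'. apply (mean_value uhp); auto using uhp_open_convex.
    - intros t Ht. unfold uhp. pose proof (path_snd_ge w' w t y Ht Hw' Hw). lra.
    - intros t Ht. pose proof (path_snd_ge w' w t y Ht Hw' Hw).
      eapply Rle_trans. apply HB. unfold uhp; lra. apply Rmult_le_compat_l; auto.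
      apply Rinv_le_contravar. apply pow_lt; auto. apply pow_incr. lra. }
  (* Inverting [w = -1/v] turns the cubic decay into a Lipschitz bound at the origin. *)
  assert (Hv : forall y y', 0 < y -> y <= y' -> Cmod (V (y * Ci)%C - V (y' * Ci)%C) <= A / y ^ 2).
  { intros y y' Hy Hyy.
    assert (Hm : forall v, uhp v -> uhp (- / v)%C).
    { intros v Hv. unfold uhp in *. simpl. apply Ropp_0_gt_lt_contravar.
      rewrite Rdiv_opp_l. apply Ropp_0_lt_gt_contravar. apply Rdiv_lt_0_compat; auto. destruct v as [x1 x2]; simpl in *; nra. }
    assert (Hne : forall v, uhp v -> v <> 0).
    { intros v Hv E. rewrite E in Hv. unfold uhp in Hv. simpl in Hv. lra. }
    assert (Hder : forall v, uhp v -> cder (fun v => V (- / v)%C) v (cderiv V (- / v)%C * - (- / (v * v)))%C).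
    { intros v Hv. apply (cder_comp V (fun v => - / v)%C). apply (cderiv_spec uhp); auto.
      apply cder_opp, cder_inv; auto. }
    assert (Hh : holo uhp (fun v => V (- / v)%C)) by (intros v Hv; eauto).
    assert (Hi : forall s, 0 < s -> (- / (s * Ci) = (/ s)%R * Ci)%C).
    { intros s Hs. rewrite RtoC_inv by lra.
      assert (RtoC s <> 0) by (intros E; apply RtoC_inj in E; lra). pose proof Ci_neq_0.
      replace (/ s * Ci)%C with (/ s * (Ci * Ci) / Ci)%C by (field; auto). rewrite Ci_sqr. field; auto. }
    assert (Hi1 : 0 < / y) by (apply Rinv_0_lt_compat; auto).
    assert (Hi2 : 0 < / y') by (apply Rinv_0_lt_compat; lra).
    assert (Hi3 : / y' <= / y) by (apply Rinv_le_contravar; lra).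
    replace (y * Ci)%C with (- / ((/ y)%R * Ci))%C by (rewrite Hi, Rinv_inv by auto; auto).
    replace (y' * Ci)%C with (- / ((/ y')%R * Ci))%C by (rewrite Hi, Rinv_inv by auto; auto).
    eapply Rle_trans. apply (mean_value uhp (fun v => V (- / v)%C) ((/ y')%R * Ci)%C ((/ y)%R * Ci)%C) with (M := A / y); auto using uhp_open_convex.
    - intros t Ht. unfold uhp. rewrite snd_path. simpl. nra.
    - intros t Ht. set (s := (1 - t) * / y' + t * / y).
      assert (Hs : 0 < s) by (unfold s; nra). assert (Hs1 : s <= / y) by (unfold s; nra).
      replace (path ((/ y')%R * Ci) ((/ y)%R * Ci) t)%C with (s * Ci)%C.
      2: { unfold path, s. rewrite RtoC_plus, !RtoC_mult, RtoC_minus. ring. }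
      assert (Hsu : uhp (s * Ci)%C) by (unfold uhp; simpl; lra).
      replace (cderiv (fun v => V (- / v)%C) (s * Ci)%C) with (cderiv V (- / (s * Ci))%C * - (- / ((s * Ci) * (s * Ci))))%C.
      2: { apply (cder_unique (fun v => V (- / v)%C) (s * Ci)%C); auto. apply (cderiv_spec uhp); auto. }
      replace (- - / (s * Ci * (s * Ci)))%C with (/ (s * Ci * (s * Ci)))%C by ring.
      rewrite Cmod_mult, Cmod_inv, !Cmod_mult, Cmod_Ci, Cmod_R, Rabs_pos_eq, Hi by (try apply Cmult_neq_0; auto; lra).
      assert (HB1 : Cmod (cderiv V ((/ s)%R * Ci)%C) <= A / (/ s) ^ 3).
      { replace (/ s) with (snd ((/ s)%R * Ci)%C) at 2 by (simpl; ring). apply HB. rewrite <- Hi by auto. auto. }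
      apply Rle_trans with (A / (/ s) ^ 3 * / (s * 1 * (s * 1))).
      + apply Rmult_le_compat_r; auto. left. apply Rinv_0_lt_compat. nra.
      + replace (A / (/ s) ^ 3 * / (s * 1 * (s * 1))) with (A * s) by (field; lra).
        apply Rmult_le_compat_l; auto.
    - replace ((/ y)%R * Ci - (/ y')%R * Ci)%C with ((/ y - / y')%R * Ci)%C by (rewrite RtoC_minus; ring).
      rewrite Cmod_mult, Cmod_Ci, Cmod_R, Rabs_pos_eq by lra.
      replace (A / y ^ 2) with (A / y * / y) by (field; lra). apply Rmult_le_compat_l.
      apply Rdiv_le_0_compat; auto. lra. }
  destruct some_ultrafilter as (U & HU).
  assert (HnC : forall y, 0 < y -> uhp (y * Ci)%C) by (intros y Hy; unfold uhp; simpl; lra).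
  destruct (ulim_bound_exists U HU (fun n => V (INR (S n) * Ci)%C) 1) as (l & Hl).
  { apply uf_true; auto. intros n. assert (uhp (INR (S n) * Ci)%C) by (apply HnC, lt_0_INR; lia).
    specialize (Hd _ H). unfold disc in Hd. lra. }
  assert (Hvl : forall y, 0 < y -> Cmod (V (y * Ci)%C - l) <= A / y ^ 2).
  { intros y Hy. apply (ulim_Cmod_le U HU (fun n => V (y * Ci)%C - V (INR (S n) * Ci)%C)%C).
    apply ulim_minus; auto using ulim_const.
    destruct (archimed_cor1 (/ y)) as (N & HN & HN0). apply Rinv_0_lt_compat; auto.
    apply uf_ev; auto. exists N. intros n Hn. apply Hv; auto.
    apply Rinv_lt_cancel in HN; [|apply lt_0_INR; auto]. apply Rle_trans with (INR N). lra. apply le_INR. lia. }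
  (* Schwarz-Pick along the imaginary axis keeps [1 - Cmod (V (y * Ci)) ^ 2] above [c / (y + 4)],
     while a limit of modulus at least 1 would push it below [2 * A / y ^ 2]. The chosen [y] makes
     the two incompatible. *)
  assert (Hl1 : disc l).
  { unfold disc. apply Rnot_le_lt. intros Hge.
    set (c := 1 - Cmod (V Ci) ^ 2).
    assert (HCi : uhp Ci) by (unfold uhp; simpl; lra).
    assert (Hc : 0 < c) by (apply disc_sqr, Hd; auto).
    set (y := 10 * A / c + 1). assert (Hy : 1 <= y). { assert (0 <= 10 * A / c) by (apply Rdiv_le_0_compat; lra). unfold y; lra. }
    assert (Hyu : uhp (y * Ci)%C) by (apply HnC; lra).
    assert (HdH : dH Ci (y * Ci)%C <= y / 4).
    { unfold dH. replace (Ci - y * Ci)%C with ((1 - y)%R * Ci)%C by (rewrite RtoC_minus; ring).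
      rewrite Cmod_mult, Cmod_Ci, Cmod_R. rewrite Rmult_1_r, pow2_abs. simpl snd.
      apply Rle_div_l; [lra|]. nra. }
    assert (HD : c <= 4 * (y / 4 + 1) * (1 - Cmod (V (y * Ci)%C) ^ 2)).
    { apply dD_bounds; auto. eapply Rle_trans; [apply schwarz_pick_HD; auto|auto]. }
    pose proof (Hvl y ltac:(lra)) as H. pose proof (Cmod_sub_le l (V (y * Ci)%C)) as H'.
    rewrite (Cmod_sub_sym l) in H'. pose proof (Hd _ Hyu) as Hdy. unfold disc in Hdy.
    set (m := Cmod (V (y * Ci)%C)) in *. assert (Hm0 : 0 <= m) by apply Cmod_ge_0.
    assert (H3 : 1 - m ^ 2 <= 2 * (A / y ^ 2)) by nra.
    assert (H4 : c <= (y + 4) * (2 * (A / y ^ 2))).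
    { eapply Rle_trans; [apply HD|]. replace (4 * (y / 4 + 1)) with (y + 4) by field. apply Rmult_le_compat_l; lra. }
    apply Rmult_le_compat_r with (r := y ^ 2) in H4; [|nra].
    replace ((y + 4) * (2 * (A / y ^ 2)) * y ^ 2) with (2 * A * (y + 4)) in H4 by (field; lra).
    assert (H5 : c * y ^ 2 <= 10 * A * y) by nra.
    assert (H6 : c * y = 10 * A + c) by (unfold y; field; lra).
    assert (c * y ^ 2 = (10 * A + c) * y) by (rewrite <- H6; ring). nra. }
  exists l, (A * (Rabs b + 1)).
  pose proof (Rabs_pos b) as Hbp.
  split; auto. split. { apply Rmult_le_pos; lra. } split.
  - intros w y Hy Hw.
    assert (Hwu : uhp w) by (unfold uhp; lra).
    destruct (periodic_reduce V w Hp Hwu) as (w' & E1 & E2 & E3). rewrite <- E3.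
    pose proof (HL w' (snd w * Ci)%C (snd w) ltac:(lra) ltac:(lra) ltac:(simpl; lra)) as G1.
    pose proof (Hvl (snd w) ltac:(lra)) as G2.
    pose proof (Cmod_sub_triangle (V w') (V (snd w * Ci)%C) l) as G3.
    assert (G4 : Cmod (w' - snd w * Ci) = Rabs (fst w')).
    { rewrite <- E1. replace (w' - snd w' * Ci)%C with (RtoC (fst w')). apply Cmod_R.
      destruct w' as [p q]. unfold Ci. apply injective_projections; simpl; ring. }
    rewrite G4 in G1.
    assert (I1 : A / snd w ^ 2 <= A / y ^ 2).
    { apply Rmult_le_compat_l; auto. apply Rinv_le_contravar. nra. apply pow_incr; lra. }
    assert (I2 : A / snd w ^ 3 <= A / y ^ 2).
    { apply Rmult_le_compat_l; auto. apply Rinv_le_contravar. nra.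
      apply Rle_trans with (snd w ^ 2). apply pow_incr; lra. simpl. nra. }
    assert (I3 : A / snd w ^ 3 * Rabs (fst w') <= A / y ^ 2 * Rabs b).
    { apply Rmult_le_compat; auto. apply Rdiv_le_0_compat; auto. apply pow_lt; lra. apply Rabs_pos. }
    replace (A * (Rabs b + 1) / y ^ 2) with (A / y ^ 2 * Rabs b + A / y ^ 2) by (field; lra). lra.
  - intros w w' y Hy Hw Hw'. eapply Rle_trans. apply (HL w w' y); lra.
    apply Rmult_le_compat_r. apply Cmod_ge_0.
    apply Rmult_le_compat; try nra. left; apply Rinv_0_lt_compat, pow_lt; lra.
    apply Rinv_le_contravar; simpl; nra.
Qed.

(** * The drift of a self-map that commutes with the translation, and the growth of its iterates *)

Section Drift.
Variable g : C -> C.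
Hypothesis Hg : holo uhp g.
Hypothesis Hgu : forall w, uhp w -> uhp (g w).
Hypothesis Hgb : forall w, uhp w -> g (w + b)%C = (g w + b)%C.

Lemma shift_INR (n : nat) w : uhp w -> g (w + INR n * b)%C = (g w + INR n * b)%C.
Proof.
  intros Hw. induction n as [|n IH].
  - simpl. replace (w + 0 * b)%C with w by ring. ring.
  - rewrite S_INR, RtoC_plus. replace (w + (INR n + 1) * b)%C with ((w + INR n * b) + b)%C by ring.
    rewrite Hgb, IH. ring. unfold uhp in *. simpl. lra.
Qed.

(** As [g (w + m * b) = g w + m * b], Schwarz-Pick is exactly the hypothesis of [im_compare] with
    [p = w] and [p' = g w], which compares the squares of the heights. *)
Lemma shift_im_le w : uhp w -> snd w <= snd (g w).
Proof.
  intros Hw. assert (H : snd w * snd w <= snd (g w) * snd (g w)).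
  { apply (im_compare w (g w) w (g w) b); auto. intros m. rewrite <- shift_INR by auto.
    apply schwarz_pick_HH; auto. unfold uhp in *. simpl. lra. }
  pose proof (Hgu w Hw). unfold uhp in *. nra.
Qed.

Lemma drift_holo : holo uhp (fun w => g w - w)%C.
Proof. intros w Hw. destruct (Hg w Hw) as (l & Hl). eexists. apply cder_minus; [apply Hl|apply cder_id]. Qed.

Lemma drift_periodic : periodic (fun w => g w - w)%C.
Proof. intros w Hw. rewrite Hgb by auto. ring. Qed.

Lemma translation_or_upward :
  (exists a : R, forall w, uhp w -> g w = (w + a)%C) \/ (forall w, uhp w -> snd w < snd (g w)).
Proof.
  destruct (classic (forall w, uhp w -> snd w < snd (g w))) as [|Hn]; auto. left.
  apply not_all_ex_not in Hn. destruct Hn as (w0 & Hn). apply imply_to_and in Hn. destruct Hn as [Hw0 Hn].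
  pose proof (shift_im_le w0 Hw0).
  assert (E0 : snd (g w0 - w0)%C = 0) by (simpl; lra).
  exists (fst (g w0 - w0)%C). intros w Hw.
  assert (E : (g w - w)%C = (g w0 - w0)%C).
  { apply (im_zero_const uhp (fun w => g w - w)%C w0); auto using uhp_open_convex, drift_holo.
    intros z Hz. simpl. pose proof (shift_im_le z Hz). lra. }
  replace (g w) with ((g w - w) + w)%C by ring. rewrite E.
  replace (RtoC (fst (g w0 - w0)%C)) with (g w0 - w0)%C. ring.
  apply injective_projections; auto.
Qed.

Hypothesis Hup : forall w, uhp w -> snd w < snd (g w).

Lemma drift_uhp w : uhp w -> uhp (g w - w)%C.
Proof. intros Hw. unfold uhp. simpl. pose proof (Hup w Hw). lra. Qed.

Lemma cay_sub x y : disc x -> disc y -> (cay x - cay y)%C = (2 * Ci * (x - y) / ((1 - x) * (1 - y)))%C.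
Proof.
  intros Hx Hy. pose proof (one_minus_neq x Hx). pose proof (one_minus_neq y Hy). unfold cay. field. auto.
Qed.

(** [periodic_disc_valued] is applied to [icay] of the drift. Its limit [l] lies inside the disc, so
    above height [Y] the values keep a distance [eta] from 1, the point that [cay] sends to
    infinity, and [cay] is Lipschitz there. *)
Lemma drift_asymptotics : exists a A Y, uhp a /\ 0 <= A /\ 1 <= Y /\
  tends_to (fun w => g w - w)%C a A Y /\ lipschitz_decay (fun w => g w - w)%C A Y.
Proof.
  pose (V := fun w => icay (g w - w)%C).
  assert (HVd : forall w, uhp w -> disc (V w)) by (intros w Hw; apply icay_disc, drift_uhp; auto).
  destruct (periodic_disc_valued V) as (l & A & Hl & HA & H1 & H2); auto.
  { apply (holo_comp uhp uhp (fun w => g w - w)%C icay); auto using drift_holo, icay_holo, drift_uhp. }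
  { intros w Hw. unfold V. f_equal. apply (drift_periodic w Hw). }
  assert (EV : forall w, uhp w -> (g w - w)%C = cay (V w)) by (intros w Hw; unfold V; rewrite cay_icay; auto using drift_uhp).
  unfold disc in Hl. set (eta := (1 - Cmod l) / 2). assert (Heta : 0 < eta) by (unfold eta; lra).
  set (Y := A / eta + 1).
  assert (HY : 1 <= Y). { assert (0 <= A / eta) by (apply Rdiv_le_0_compat; auto). unfold Y; lra. }
  assert (Hfar : forall w y, Y <= y -> y <= snd w -> eta <= Cmod (1 - V w)).
  { intros w y Hy Hw. pose proof (H1 w y ltac:(lra) Hw) as H.
    assert (A / y ^ 2 <= eta).
    { apply Rle_div_l. nra. apply Rle_trans with (eta * Y).
      unfold Y. replace (eta * (A / eta + 1)) with (A + eta) by (field; lra). lra.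
      apply Rmult_le_compat_l. lra. nra. }
    pose proof (Cmod_sub_le (V w) l). pose proof (Cmod_sub_le 1 (V w)). rewrite Cmod_1 in H4. unfold eta in *. lra. }
  assert (Hfl : eta <= Cmod (1 - l)).
  { pose proof (Cmod_sub_le 1 l). rewrite Cmod_1 in H. unfold eta. lra. }
  assert (HB : forall x y M, disc x -> disc y -> eta <= Cmod (1 - x) -> eta <= Cmod (1 - y) -> Cmod (x - y) <= M ->
    Cmod (cay x - cay y) <= 2 / eta ^ 2 * M).
  { intros x y M Hx Hy Ex Ey HM. rewrite cay_sub by auto.
    pose proof (one_minus_neq x Hx). pose proof (one_minus_neq y Hy).
    rewrite Cmod_div by (apply Cmult_neq_0; auto). rewrite !Cmod_mult, Cmod_Ci, Cmod_R, Rabs_pos_eq by lra.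
    apply Rle_div_l. nra.
    assert (eta ^ 2 <= Cmod (1 - x) * Cmod (1 - y)) by (simpl; rewrite Rmult_1_r; apply Rmult_le_compat; lra).
    pose proof (Cmod_ge_0 (x - y)).
    assert (E : 2 * 1 * Cmod (x - y) <= 2 / eta ^ 2 * M * eta ^ 2).
    { replace (2 / eta ^ 2 * M * eta ^ 2) with (2 * M) by (field; lra). lra. }
    eapply Rle_trans; [apply E|]. apply Rmult_le_compat_l; auto.
    apply Rmult_le_pos. apply Rdiv_le_0_compat. lra. nra. lra. }
  assert (Hc : 0 <= 2 / eta ^ 2) by (apply Rdiv_le_0_compat; nra).
  exists (cay l), (2 / eta ^ 2 * A), Y. split; [|split; [|split; [|split]]]; auto.
  - apply cay_uhp; auto.
  - apply Rmult_le_pos; auto.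
  - intros w y Hy Hw. assert (Hwu : uhp w) by (unfold uhp; lra). rewrite EV by auto.
    replace (2 / eta ^ 2 * A / y) with (2 / eta ^ 2 * (A / y)) by (unfold Rdiv; ring).
    apply HB; eauto. eapply Rle_trans. apply (H1 w y); lra.
    apply Rmult_le_compat_l; auto. apply Rinv_le_contravar; nra.
  - intros w w' y Hy Hw Hw'. assert (Hwu : uhp w) by (unfold uhp; lra). assert (Hwu' : uhp w') by (unfold uhp; lra).
    rewrite !EV by auto. replace (2 / eta ^ 2 * A / y ^ 2 * Cmod (w - w')) with (2 / eta ^ 2 * (A / y ^ 2 * Cmod (w - w')))
      by (unfold Rdiv; ring). apply HB; eauto. apply H2; lra.
Qed.

(** Above height [Y1] the drift is close to [a], whose imaginary part is positive. Between [y0] and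
    [Y1], periodicity brings [w] to bounded hyperbolic distance from [Ci], and the Harnack
    inequality of [dH_bounds] compares the drift with its value at [Ci]. *)
Lemma upward_uniform y0 : 0 < y0 -> exists c, 0 < c /\ forall w, y0 <= snd w -> snd w + c <= snd (g w).
Proof.
  intros Hy0. destruct drift_asymptotics as (a & A & Y & Ha & HA & HY & Ht & _).
  unfold uhp in Ha.
  set (Y1 := Y + 2 * A / snd a).
  assert (HY1 : Y <= Y1). { assert (0 <= 2 * A / snd a) by (apply Rdiv_le_0_compat; lra). unfold Y1; lra. }
  assert (HA1 : A / Y1 <= snd a / 2).
  { apply Rle_div_l. lra. unfold Y1. replace (snd a / 2 * (Y + 2 * A / snd a)) with (snd a / 2 * Y + A) by (field; lra). nra. }
  set (k := (Rabs b + Y1 + 1) ^ 2 / (4 * y0)).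
  assert (HCi : uhp Ci) by (unfold uhp; simpl; lra).
  assert (Hk : 0 <= k) by (apply Rdiv_le_0_compat; [apply pow2_ge_0|lra]).
  set (c1 := snd (g Ci - Ci)%C / (2 + 4 * k)).
  assert (Hc1 : 0 < c1) by (apply Rdiv_lt_0_compat; [apply drift_uhp; auto|lra]).
  exists (Rmin (snd a / 2) c1). split. apply Rmin_pos; lra.
  intros w Hw. assert (Hwu : uhp w) by (unfold uhp; lra).
  assert (H : Rmin (snd a / 2) c1 <= snd (g w - w)%C); [|simpl in H; lra].
  destruct (Rle_lt_dec Y1 (snd w)) as [Hbig|Hsmall].
  - eapply Rle_trans; [apply Rmin_l|].
    pose proof (Ht w Y1 HY1 Hbig) as H. pose proof (Rabs_snd_le (g w - w - a)) as H'.
    assert (E : snd (g w - w - a)%C = snd (g w - w)%C - snd a) by (simpl; ring).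
    rewrite E in H'. pose proof (Rle_abs (- (snd (g w - w)%C - snd a))) as H''. rewrite Rabs_Ropp in H''. lra.
  - eapply Rle_trans; [apply Rmin_r|].
    destruct (periodic_reduce (fun w => g w - w)%C w drift_periodic Hwu) as (w' & E1 & E2 & E3).
    rewrite <- E3. assert (Hwu' : uhp w') by (unfold uhp; lra).
    apply Rle_div_l. lra. rewrite Rmult_comm.
    apply (dH_bounds (g Ci - Ci)%C (g w' - w')%C k); auto using drift_uhp.
    eapply Rle_trans. apply (schwarz_pick_HH (fun w => g w - w)%C); auto using drift_holo, drift_uhp.
    unfold dH, k. rewrite E1. simpl (snd Ci).
    assert (Hcm : Cmod (Ci - w') <= Rabs b + Y1 + 1).
    { pose proof (Cmod_minus_le Ci w'). pose proof (Cmod_le_parts w'). rewrite Cmod_Ci in H.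
      rewrite E1, (Rabs_pos_eq (snd w)) in H0 by lra. lra. }
    pose proof (Cmod_ge_0 (Ci - w')).
    apply Rmult_le_compat. apply pow2_ge_0. left; apply Rinv_0_lt_compat; lra.
    apply pow_incr; lra. apply Rinv_le_contravar; lra.
Qed.

Lemma iterate_uhp n w : uhp w -> uhp (iterate g n w).
Proof. intros Hw. induction n; auto. exact (Hgu _ IHn). Qed.

Lemma iterate_holo_uhp n : holo uhp (iterate g n).
Proof.
  induction n. intros w _. exists 1%C. apply cder_id.
  exact (holo_comp uhp uhp (iterate g n) g IHn Hg (fun w => iterate_uhp n w)).
Qed.

Lemma iterate_height y0 : 0 < y0 -> exists c, 0 < c /\
  forall n w, y0 <= snd w -> y0 + INR n * c <= snd (iterate g n w) /\ snd w <= snd (iterate g n w).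
Proof.
  intros Hy0. destruct (upward_uniform y0 Hy0) as (c & Hc & H). exists c. split; auto.
  intros n w Hw. induction n as [|n [IH1 IH2]].
  - simpl. lra.
  - change (iterate g (S n) w) with (g (iterate g n w)). rewrite S_INR.
    assert (0 <= INR n * c) by (apply Rmult_le_pos; [apply pos_INR|lra]).
    specialize (H (iterate g n w) ltac:(lra)). lra.
Qed.

Lemma iterate_unbounded w Y : uhp w -> exists N, forall n, (N <= n)%nat -> Y <= snd (iterate g n w).
Proof.
  intros Hw. destruct (iterate_height (snd w) Hw) as (c & Hc & H).
  destruct (archimed_cor1 (c / (Rabs Y + 1))) as (N & HN & HN0).
  { pose proof (Rabs_pos Y). apply Rdiv_lt_0_compat; lra. }
  exists N. intros n Hn. destruct (H n w (Rle_refl _)) as [H1 _].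
  pose proof (Rabs_pos Y). pose proof (Rle_abs Y). unfold uhp in Hw.
  assert (HNp : 0 < INR N) by (apply lt_0_INR; auto). apply le_INR in Hn.
  assert (Rabs Y + 1 < INR N * c).
  { apply Rmult_lt_reg_l with (/ INR N). apply Rinv_0_lt_compat; auto.
    rewrite <- Rmult_assoc, Rinv_l, Rmult_1_l by lra.
    apply Rmult_lt_compat_r with (r := Rabs Y + 1) in HN; [|lra].
    replace (c / (Rabs Y + 1) * (Rabs Y + 1)) with c in HN by (field; lra). lra. }
  nra.
Qed.

(* The product of the factors [1 + A/(j+1)^2] converges. *)
Lemma slow_growth (D : nat -> R) A : 0 <= A -> (forall j, 0 <= D j) ->
  (forall j, D (S j) <= D j * (1 + A / INR (S j) ^ 2)) -> forall j, D j <= D 0%nat * exp (2 * A).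
Proof.
  intros HA HD Hs j.
  assert (H : D j <= D 0%nat * exp (2 * A * (1 - / INR (S j)))).
  { induction j as [|j IH].
    - simpl. rewrite Rinv_1. replace (2 * A * (1 - 1)) with 0 by ring. rewrite exp_0. lra.
    - eapply Rle_trans. apply Hs.
      assert (Hp : 0 < INR (S j)) by (apply lt_0_INR; lia).
      assert (Hp1 : 1 <= INR (S j)) by (change 1 with (INR 1); apply le_INR; lia).
      set (q := INR (S j)) in *. rewrite (S_INR (S j)). fold q.
      apply Rle_trans with (D 0%nat * exp (2 * A * (1 - / q)) * exp (2 * A * (/ q - / (q + 1)))).
      + apply Rmult_le_compat; auto.
        * assert (0 <= A / q ^ 2) by (apply Rdiv_le_0_compat; auto; nra). lra.
        * apply Rle_trans with (1 + 2 * A * (/ q - / (q + 1))).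
          -- apply Rplus_le_compat_l.
             replace (2 * A * (/ q - / (q + 1))) with (A * (2 / (q * (q + 1)))) by (field; lra).
             apply Rmult_le_compat_l; auto. apply Rle_div_r. nra.
             replace (/ q ^ 2 * (q * (q + 1))) with ((q + 1) / q) by (field; lra). apply Rle_div_l; lra.
          -- apply exp_ineq1_le.
      + rewrite Rmult_assoc, <- exp_plus. right. f_equal. f_equal. ring. }
  eapply Rle_trans; [apply H|]. apply Rmult_le_compat_l; auto.
  assert (0 < / INR (S j)) by (apply Rinv_0_lt_compat, lt_0_INR; lia).
  destruct (Rle_lt_or_eq_dec (2 * A * (1 - / INR (S j))) (2 * A)) as [Hlt|E].
  - nra.
  - left. apply exp_increasing. auto.
  - rewrite E. lra.
Qed.

(** For the first [N] steps Schwarz-Pick bounds the distance. Afterwards the heights exceed [Y] and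
    grow linearly, so the Lipschitz bound on the drift enlarges the distance in step [i] by a factor
    of at most [1 + B / (i + 1) ^ 2], to which [slow_growth] applies. *)
Lemma iterate_pair_bounded w' k y0 : uhp w' -> 0 < y0 -> y0 <= snd w' -> exists M, forall x, y0 <= snd x -> dH x w' <= k ->
  forall n, Cmod (iterate g n x - iterate g n w') <= M.
Proof.
  intros Hw' Hy0 Hyw.
  destruct drift_asymptotics as (a & A & Y & _ & HA & HY & _ & HL).
  destruct (iterate_height y0 Hy0) as (c & Hc & HH).
  destruct (archimed_cor1 (c / (Y + 1))) as (N & HN & HN0). { apply Rdiv_lt_0_compat; lra. }
  assert (HNp : 0 < INR N) by (apply lt_0_INR; auto).
  assert (HNc : Y + 1 < INR N * c).
  { apply Rmult_lt_reg_l with (/ INR N). apply Rinv_0_lt_compat; auto.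
    rewrite <- Rmult_assoc, Rinv_l, Rmult_1_l by lra.
    apply Rmult_lt_compat_r with (r := Y + 1) in HN; [|lra].
    replace (c / (Y + 1) * (Y + 1)) with c in HN by (field; lra). lra. }
  (* Then [Y + INR i * c >= c' * INR (S i)], which puts the heights into the form required by
     [slow_growth]. *)
  set (c' := Rmin Y c). assert (Hc' : 0 < c') by (apply Rmin_pos; lra).
  assert (Hc'Y : c' <= Y) by apply Rmin_l. assert (Hc'c : c' <= c) by apply Rmin_r.
  set (B := A / c' ^ 2). assert (HB : 0 <= B) by (apply Rdiv_le_0_compat; auto; nra).
  set (M0 := (2 + 4 * k) * snd (iterate g N w')).
  exists (M0 * exp (2 * B)). intros x Hx Hk n.
  assert (Hxu : uhp x) by (unfold uhp; lra).
  assert (Hk0 : 0 <= k) by (eapply Rle_trans; [apply (dH_ge_0 x w'); auto|auto]).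
  assert (Hd : forall n, dH (iterate g n x) (iterate g n w') <= k).
  { intros m. eapply Rle_trans; [|apply Hk]. apply schwarz_pick_HH; auto using iterate_holo_uhp, iterate_uhp. }
  assert (Hexp : 1 <= exp (2 * B)). { pose proof (exp_ineq1_le (2 * B)). lra. }
  assert (Hmono : forall m, snd (iterate g m w') <= snd (iterate g (S m) w')).
  { intros m. apply shift_im_le, iterate_uhp; auto. }
  assert (HM0 : forall m, (m <= N)%nat -> Cmod (iterate g m x - iterate g m w') <= M0).
  { intros m Hm. destruct (dH_bounds _ _ k (iterate_uhp m x Hxu) (iterate_uhp m w' Hw') (Hd m)) as [_ H].
    eapply Rle_trans; [apply H|]. apply Rmult_le_compat_l. lra.
    clear -Hm Hmono. induction Hm. lra. specialize (Hmono m0). lra. }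
  assert (HM0p : 0 <= M0) by (eapply Rle_trans; [apply Cmod_ge_0|apply (HM0 0%nat); lia]).
  destruct (Nat.le_gt_cases n N) as [Hn|Hn].
  - specialize (HM0 n Hn). nra.
  - replace n with (N + (n - N))%nat by lia. set (j := (n - N)%nat).
    pose (D := fun j => Cmod (iterate g (N + j) x - iterate g (N + j) w')).
    assert (HD : D j <= D 0%nat * exp (2 * B)).
    { apply slow_growth; auto. intros i; apply Cmod_ge_0.
      intros i. unfold D. rewrite Nat.add_succ_r.
      set (p := iterate g (N + i) x). set (q := iterate g (N + i) w').
      change (iterate g (S (N + i)) x) with (g p). change (iterate g (S (N + i)) w') with (g q).
      destruct (HH (N + i)%nat x Hx) as [G1 _]. destruct (HH (N + i)%nat w' Hyw) as [G2 _]. fold p in G1. fold q in G2.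
      set (y := c' * INR (S i)).
      pose proof (pos_INR i) as Hi.
      assert (Hyi : Y + INR i * c <= y0 + INR (N + i) * c) by (rewrite plus_INR; nra).
      assert (Hy1 : Y + INR i * c >= y) by (unfold y; rewrite S_INR; nra).
      assert (HyY : exists y', Y <= y' /\ y <= y' /\ y' <= snd p /\ y' <= snd q).
      { exists (Y + INR i * c). repeat split; nra. }
      destruct HyY as (y' & Q1 & Q2 & Q3 & Q4).
      pose proof (HL p q y' Q1 Q3 Q4) as HLpq.
      assert (Hyp : 0 < y). { unfold y. apply Rmult_lt_0_compat; auto. apply lt_0_INR; lia. }
      assert (A / y' ^ 2 <= B / INR (S i) ^ 2).
      { replace (B / INR (S i) ^ 2) with (A / y ^ 2).
        - apply Rmult_le_compat_l; auto. apply Rinv_le_contravar. apply pow_lt; auto. apply pow_incr; lra.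
        - unfold B, y. field. split. lra. apply not_0_INR. lia. }
      pose proof (Cmod_ge_0 (p - q)).
      assert (Cmod (g p - g q) <= Cmod (g p - p - (g q - q)) + Cmod (p - q)).
      { replace (g p - g q)%C with ((g p - p - (g q - q)) + (p - q))%C by ring. apply Cmod_triangle. }
      assert (A / y' ^ 2 * Cmod (p - q) <= B / INR (S i) ^ 2 * Cmod (p - q)) by (apply Rmult_le_compat_r; auto).
      lra. }
    eapply Rle_trans; [apply HD|]. apply Rmult_le_compat_r. lra. unfold D. rewrite Nat.add_0_r. apply HM0. lia.
Qed.

Lemma iterate_local_bound w0 w : uhp w0 -> uhp w -> exists r M, 0 < r /\
  (forall x, in_ball w r x -> uhp x) /\ forall n x, in_ball w r x -> Cmod (iterate g n x - iterate g n w0) <= M.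
Proof.
  intros Hw0 Hw. destruct (dH_small w 1 Hw Rlt_0_1) as (r & Hr & Hsm).
  pose proof Hw as Hs. unfold uhp in Hs. pose proof Hw0 as Hs0. unfold uhp in Hs0.
  set (y0 := Rmin (snd w / 2) (snd w0)). assert (Hy0 : 0 < y0) by (apply Rmin_pos; lra).
  assert (Hy1 : y0 <= snd w / 2) by apply Rmin_l. assert (Hy2 : y0 <= snd w0) by apply Rmin_r.
  destruct (iterate_pair_bounded w 1 y0 Hw Hy0 ltac:(lra)) as (M1 & H1).
  destruct (iterate_pair_bounded w0 (dH w w0) y0 Hw0 Hy0 Hy2) as (M2 & H2).
  exists (Rmin r (snd w / 2)), (M1 + M2). split. apply Rmin_pos; lra. split.
  - intros x Hx. apply Hsm. eapply in_ball_le; [apply Rmin_l|apply Hx].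
  - intros n x Hx. destruct (Hsm x) as [Hxu Hxd]. { eapply in_ball_le; [apply Rmin_l|apply Hx]. }
    assert (Hxs : y0 <= snd x).
    { assert (Hx' : Cmod (x - w) < snd w / 2) by (eapply Rlt_le_trans; [apply Hx|apply Rmin_r]).
      pose proof (Rabs_snd_le (x - w)) as H. simpl in H. apply Rle_lt_trans with (2 := Hx') in H.
      apply Rabs_def2 in H. lra. }
    specialize (H1 x Hxs Hxd n). specialize (H2 w ltac:(lra) (Rle_refl _) n).
    pose proof (Cmod_sub_triangle (iterate g n x) (iterate g n w) (iterate g n w0)). lra.
Qed.

End Drift.
End Shift.

(** * Linearization of commuting families *)

Definition upward (g : C -> C) : Prop := forall w, uhp w -> snd w < snd (g w).

(** The common form, for translations and for upward maps, of convergence of the drift at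
    infinity. *)
Definition asymptotic_shift (g : C -> C) (a : C) : Prop :=
  forall e, 0 < e -> exists Y, forall w, uhp w -> Y <= snd w -> Cmod (g w - w - a) < e.

Lemma small_solution (f : C -> C) (p m : C) (s : R) (x v : C) : m <> 0 -> 0 < s ->
  (forall y z, in_ball p s y -> in_ball p s z -> Cmod (f y - f z - m * (y - z)) <= Cmod m / 4 * Cmod (y - z)) ->
  in_ball p (s / 4) x -> Cmod (f x - v) <= Cmod m * s / 4 -> exists x', in_ball p s x' /\ f x' = v.
Proof.
  intros Hm Hs Hf Hx Hv. apply Cmod_gt_0 in Hm as Hmp.
  pose (T := fun y => (y - (f y - v) / m)%C).
  pose (xs := fun k => Nat.iter k T x).
  unfold in_ball in *.
  assert (HT : forall y z, Cmod (y - p) < s -> Cmod (z - p) < s -> Cmod (T y - T z) <= / 4 * Cmod (y - z)).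
  { intros y z Hy Hz. unfold T.
    replace (y - (f y - v) / m - (z - (f z - v) / m))%C with (- ((f y - f z - m * (y - z)) / m))%C by (field; auto).
    rewrite Cmod_opp, Cmod_div by auto. apply Rle_div_l; auto. specialize (Hf y z Hy Hz). lra. }
  assert (Hin : forall k, Cmod (xs k - x) <= s / 3 * (1 - (/ 4) ^ k) /\ Cmod (xs (S k) - xs k) <= s / 4 * (/ 4) ^ k).
  { induction k as [|k [IH1 IH2]].
    - split.
      + simpl. replace (x - x)%C with (RtoC 0) by ring. rewrite Cmod_0. lra.
      + simpl. unfold T. replace (x - (f x - v) / m - x)%C with (- ((f x - v) / m))%C by (field; auto).
        rewrite Cmod_opp, Cmod_div by auto. apply Rle_div_l; auto. lra.
    - assert (Hq : 0 < (/ 4) ^ k) by (apply pow_lt; lra).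
      assert (H1 : Cmod (xs (S k) - x) <= s / 3 * (1 - (/ 4) ^ S k)).
      { pose proof (Cmod_sub_triangle (xs (S k)) (xs k) x). simpl ((/ 4) ^ S k). nra. }
      split; auto. change (xs (S (S k))) with (T (xs (S k))). change (xs (S k)) with (T (xs k)) at 2.
      assert (HB : forall j, Cmod (xs j - x) <= s / 3 * (1 - (/ 4) ^ j) -> Cmod (xs j - p) < s).
      { intros j Hj. assert (0 < s * (/ 4) ^ j) by (apply Rmult_lt_0_compat; auto; apply pow_lt; lra).
        pose proof (Cmod_sub_triangle (xs j) x p). lra. }
      eapply Rle_trans; [apply HT; auto|]. simpl. change (xs (S k)) with (T (xs k)) in IH2. lra. }
  destruct some_ultrafilter as (U & HU).
  destruct (ulim_geometric U HU xs (s / 4) (/ 4)) as (x' & Hx' & Hn). lra. intros k; apply Hin.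
  assert (Hx'p : Cmod (x' - p) < s).
  { specialize (Hn 0%nat). simpl in Hn. rewrite Cmod_sub_sym in Hn. pose proof (Cmod_sub_triangle x' x p).
    replace (s / 4 / (1 - / 4) * 1) with (s / 3) in Hn by field. unfold xs in Hn. simpl in Hn. lra. }
  exists x'. split; auto.
  assert (HTx : T x' = x').
  { apply (ulim_unique U HU (fun k => xs (S k))).
    - apply ulim_of_bound with (fun k => / 4 * Cmod (xs k - x')); auto.
      + apply uf_true; auto. intros k. apply HT; auto.
        assert (0 < s * (/ 4) ^ k) by (apply Rmult_lt_0_compat; auto; apply pow_lt; lra). destruct (Hin k) as [Hk _].
        pose proof (Cmod_sub_triangle (xs k) x p). lra.
      + replace 0 with (/ 4 * 0) by ring. apply ulimR_mult; auto using ulimR_const, ulim_Cmod_sub.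
    - apply ulim_of_bound with (fun k => s / 3 * (/ 4) ^ k); auto.
      + apply uf_true; auto. intros k. eapply Rle_trans; [apply Hn|].
        assert (0 < (/ 4) ^ k) by (apply pow_lt; lra). simpl. replace (s / 4 / (1 - / 4)) with (s / 3) by field. nra.
      + replace 0 with (s / 3 * 0) by ring. apply ulimR_mult; auto using ulimR_const.
        apply ulimR_of_lim; auto. apply is_lim_seq_geom. rewrite Rabs_pos_eq; lra. }
  unfold T in HTx. apply Cmod_eq_sub.
  replace (f x' - v)%C with (- ((x' - (f x' - v) / m) - x') * m)%C by (field; auto).
  rewrite HTx. replace (- (x' - x') * m)%C with (RtoC 0) by ring. apply Cmod_0.
Qed.

(** Near a point where the derivative of [f1] does not vanish, the derivative of [f2] cannot vanish
    throughout, by the identity theorem. *)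
Lemma noncritical_point f1 f2 : holo disc f1 -> holo disc f2 ->
  (exists x y, disc x /\ disc y /\ f1 x <> f1 y) -> (exists x y, disc x /\ disc y /\ f2 x <> f2 y) ->
  exists p, disc p /\ cderiv f1 p <> 0 /\ cderiv f2 p <> 0.
Proof.
  intros H1 H2 N1 N2.
  assert (Hc : forall f, holo disc f -> (exists x y, disc x /\ disc y /\ f x <> f y) -> ~ forall z, disc z -> cderiv f z = 0).
  { intros f Hf (x & y & Hx & Hy & Hn) H0. apply Hn. symmetry. apply Cmod_eq_sub.
    destruct (disc_open_convex x y Hx Hy) as (r & Hr & Hp).
    assert (Hpath : forall t, 0 <= t <= 1 -> disc (path x y t)).
    { intros t Ht. apply (Hp t); auto. apply in_ball_center; auto. }
    apply Rle_antisym; [|apply Cmod_ge_0]. rewrite <- (Rmult_0_l (Cmod (y - x))).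
    apply (mean_value disc); auto using disc_open_convex. intros t Ht. rewrite H0 by auto. rewrite Cmod_0. lra. }
  pose proof (cderiv_holo disc f1 disc_open_convex H1) as D1. pose proof (cderiv_holo disc f2 disc_open_convex H2) as D2.
  assert (E : exists p, disc p /\ cderiv f1 p <> 0).
  { apply NNPP. intros Hn. apply (Hc f1 H1 N1). intros z Hz. apply NNPP. intros Hz0. apply Hn. eauto. }
  destruct E as (p0 & Hp0 & Hd). apply Cmod_gt_0 in Hd as Hdp.
  destruct (holo_ccont disc _ p0 D1 Hp0 _ Hdp) as (r & Hr & Hnear).
  destruct (open_convex_nbhd disc disc_open_convex p0 Hp0) as (r' & Hr' & Hb).
  apply NNPP. intros Hn. apply (Hc f2 H2 N2).
  apply (identity_theorem disc (cderiv f2) p0); auto using disc_open_convex.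
  apply zeros_cluster_near with (Rmin r r'). apply Rmin_pos; auto.
  intros z Hz. apply NNPP. intros Hz0. apply Hn. exists z. split; [|split]; auto.
  - apply Hb. eapply in_ball_le; [apply Rmin_r|apply Hz].
  - intros E. specialize (Hnear z). rewrite E in Hnear.
    replace (0 - cderiv f1 p0)%C with (- cderiv f1 p0)%C in Hnear by ring. rewrite Cmod_opp in Hnear.
    assert (Cmod (z - p0) < r) by (eapply Rlt_le_trans; [apply Hz|apply Rmin_l]). specialize (Hnear H). lra.
Qed.

Section Centralizer.
Variables (phi h : C -> C) (b : R) (G : (C -> C) -> C -> C).
Hypothesis Hself : self_map phi.
Hypothesis Hfix : forall z, disc z -> phi z <> z.
Hypothesis HM : hyperbolic_model phi h b G.

Lemma disc_0 : disc 0.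
Proof. unfold disc. rewrite Cmod_0. lra. Qed.

Lemma G_shift psi w : centralizer phi psi -> uhp w -> G psi (w + b)%C = (G psi w + b)%C.
Proof.
  intros Hp Hw. pose proof (hm_G_uhp _ _ _ _ HM psi w Hp Hw) as Hu.
  rewrite <- !(hm_G_phi _ _ _ _ HM) by auto. apply (hm_G_commute _ _ _ _ HM); auto using centralizer_self. apply Hp.
Qed.

Lemma G_translation_or_upward psi : centralizer phi psi ->
  (exists a : R, forall w, uhp w -> G psi w = (w + a)%C) \/ upward (G psi).
Proof.
  intros Hp. apply (translation_or_upward b); auto.
  - apply HM.
  - apply (hm_G_holo _ _ _ _ HM); auto.
  - intros; apply (hm_G_uhp _ _ _ _ HM); auto.
  - intros; apply G_shift; auto.
Qed.

Lemma G_im_le psi w : centralizer phi psi -> uhp w -> snd w <= snd (G psi w).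
Proof.
  intros Hp Hw. apply (shift_im_le b); auto.
  - apply HM.
  - apply (hm_G_holo _ _ _ _ HM); auto.
  - intros; apply (hm_G_uhp _ _ _ _ HM); auto.
  - intros; apply G_shift; auto.
Qed.

Lemma G_asymptotic psi : centralizer phi psi -> exists a, asymptotic_shift (G psi) a.
Proof.
  intros Hp. destruct (G_translation_or_upward psi Hp) as [(a & Ha)|Hup].
  - exists a. intros e He. exists 0. intros w Hw _. rewrite Ha by auto.
    replace (w + a - w - a)%C with (RtoC 0) by ring. rewrite Cmod_0. auto.
  - destruct (drift_asymptotics b (hm_b _ _ _ _ HM) (G psi)) as (a & A & Y & _ & HA & HY & Ht & _); auto.
    + apply (hm_G_holo _ _ _ _ HM); auto.
    + intros; apply G_shift; auto.
    + exists a. intros e He. exists (Y + A / e). intros w _ Hw.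
      assert (H0 : 0 <= A / e) by (apply Rdiv_le_0_compat; auto).
      eapply Rle_lt_trans; [apply (Ht w (Y + A / e)); lra|]. apply Rlt_div_l. lra.
      replace (e * (Y + A / e)) with (e * Y + A) by (field; lra). nra.
Qed.

Lemma h_iterate_G psi n z : centralizer phi psi -> disc z -> h (iterate psi n z) = iterate (G psi) n (h z).
Proof.
  intros Hp Hz. induction n as [|n IH]; auto.
  change (h (psi (iterate psi n z)) = G psi (iterate (G psi) n (h z))).
  rewrite (hm_G _ _ _ _ HM), IH; auto. apply iterate_disc; auto. apply Hp.
Qed.

Lemma centralizer_id : centralizer phi id_disc.
Proof.
  split. split; auto. apply holomorphic_iff. intros z _. exists 1%C. apply cder_id. intros z _. reflexivity.
Qed.

(** A fixed point [z] makes [h z] a fixed point of [G psi]. This is impossible for an upward map,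
    and a translation with a fixed point is the identity, so that [hm_faithful] gives [psi] equal to
    the identity. *)
Lemma centralizer_no_fixed_point psi : centralizer phi psi -> ~ eq_on_disc psi id_disc ->
  forall z, disc z -> psi z <> z.
Proof.
  intros Hp Hn z Hz E. pose proof (hm_G _ _ _ _ HM psi z Hp Hz) as EG. rewrite E in EG.
  pose proof (hm_uhp _ _ _ _ HM z Hz) as Hu.
  destruct (G_translation_or_upward psi Hp) as [(a & Ha)|Hup].
  - apply Hn. apply (hm_faithful _ _ _ _ HM); auto using centralizer_id.
    intros w Hw. rewrite (hm_G _ _ _ _ HM) by auto. rewrite Ha by (apply (hm_uhp _ _ _ _ HM); auto).
    rewrite Ha in EG by auto. unfold id_disc.
    replace (RtoC a) with ((h z + a) - h z)%C by ring. rewrite <- EG. ring.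
  - specialize (Hup _ Hu). rewrite <- EG in Hup. lra.
Qed.

Lemma model_orbit_escapes psi B : centralizer phi psi -> ~ eq_on_disc psi id_disc ->
  exists N, forall n, (N <= n)%nat -> B <= Cmod (h (iterate psi n 0)).
Proof.
  intros Hp Hn. pose proof (hm_uhp _ _ _ _ HM 0 disc_0) as Hu.
  destruct (G_translation_or_upward psi Hp) as [(a & Ha)|Hup].
  - assert (Ha0 : a <> 0).
    { intros E. apply (centralizer_no_fixed_point psi Hp Hn 0 disc_0). exfalso. apply Hn.
      apply (hm_faithful _ _ _ _ HM); auto using centralizer_id.
      intros w Hw. rewrite (hm_G _ _ _ _ HM) by auto. rewrite Ha by (apply (hm_uhp _ _ _ _ HM); auto).
      rewrite E. unfold id_disc. ring. }
    assert (Hit : forall n, iterate (G psi) n (h 0) = (h 0 + INR n * a)%C /\ uhp (iterate (G psi) n (h 0))).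
    { induction n as [|n [IH1 IH2]].
      - simpl. split; auto. ring.
      - change (iterate (G psi) (S n) (h 0)) with (G psi (iterate (G psi) n (h 0))).
        split. rewrite Ha, IH1, S_INR, RtoC_plus by auto. ring. apply (hm_G_uhp _ _ _ _ HM); auto. }
    set (D := Rabs B + Cmod (h 0) + 1).
    assert (HD : 0 < D) by (unfold D; pose proof (Rabs_pos B); pose proof (Cmod_ge_0 (h 0)); lra).
    assert (Hap : 0 < Rabs a) by (apply Rabs_pos_lt; auto).
    destruct (archimed_cor1 (Rabs a / D)) as (N & HN & HN0). apply Rdiv_lt_0_compat; auto.
    exists N. intros n HNn. rewrite h_iterate_G by auto using disc_0. rewrite (proj1 (Hit n)).
    assert (HNp : 0 < INR N) by (apply lt_0_INR; auto). apply le_INR in HNn.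
    assert (H1 : D < INR N * Rabs a).
    { apply Rmult_lt_reg_l with (/ INR N). apply Rinv_0_lt_compat; auto.
      rewrite <- Rmult_assoc, Rinv_l, Rmult_1_l by lra.
      apply Rmult_lt_compat_r with (r := D) in HN; auto.
      replace (Rabs a / D * D) with (Rabs a) in HN by (field; lra). lra. }
    pose proof (Cmod_sub_le (INR n * a) (- h 0)). rewrite Cmod_opp in H.
    replace (INR n * a - - h 0)%C with (h 0 + INR n * a)%C in H by ring.
    rewrite Cmod_mult, !Cmod_R, (Rabs_pos_eq (INR n)) in H by apply pos_INR.
    pose proof (Rle_abs B). unfold D in H1. nra.
  - destruct (iterate_unbounded b (hm_b _ _ _ _ HM) (G psi)) with (w := h 0) (Y := B) as (N & HN); auto.
    + apply (hm_G_holo _ _ _ _ HM); auto.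
    + intros; apply G_shift; auto.
    + exists N. intros n HNn. rewrite h_iterate_G by auto using disc_0. specialize (HN n HNn).
      pose proof (Rabs_snd_le (iterate (G psi) n (h 0))). pose proof (Rle_abs (snd (iterate (G psi) n (h 0)))). lra.
Qed.

(** While [1 - Cmod ^ 2] of an orbit point is at least [e], its [dD] to 0 is at most [/ e], which
    confines its image under [h] to a bounded set; the orbit leaves that set for good. *)
Lemma orbit_to_circle psi e : centralizer phi psi -> ~ eq_on_disc psi id_disc -> 0 < e ->
  exists N, forall n, (N <= n)%nat -> 1 - Cmod (iterate psi n 0) ^ 2 < e.
Proof.
  intros Hp Hn He.
  destruct (model_orbit_escapes psi (Cmod (h 0) + (2 + 4 * / e) * snd (h 0) + 1) Hp Hn) as (N & HN).
  exists N. intros n HNn. specialize (HN n HNn). apply Rnot_le_lt. intros Hle.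
  assert (Hd : disc (iterate psi n 0)) by (apply iterate_disc; auto using disc_0; apply Hp).
  pose proof (hm_uhp _ _ _ _ HM) as Hu.
  destruct (dH_bounds (h (iterate psi n 0)) (h 0) (/ e)) as [_ H]; auto using disc_0.
  - eapply Rle_trans. apply schwarz_pick_DH; auto using disc_0. apply (hm_holo _ _ _ _ HM).
    unfold dD. replace (iterate psi n 0 - 0)%C with (iterate psi n 0) by ring. rewrite Cmod_0.
    pose proof (pow2_ge_0 (Cmod (iterate psi n 0))). pose proof (disc_sqr _ Hd).
    replace (/ e) with (1 / e) by (field; lra).
    replace ((1 - Cmod (iterate psi n 0) ^ 2) * (1 - 0 ^ 2)) with (1 - Cmod (iterate psi n 0) ^ 2) by ring.
    apply Rle_div_l; auto. replace (1 / e * (1 - Cmod (iterate psi n 0) ^ 2)) with ((1 - Cmod (iterate psi n 0) ^ 2) / e) by (field; lra).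
    apply Rle_trans with 1. lra. apply (proj1 (Rle_div_r 1 _ e He)). lra.
  - pose proof (Cmod_sub_le (h (iterate psi n 0)) (h 0)). lra.
Qed.

(* The orbit of 0 leaves every compact subset of the model, hence tends to the circle; Wolff's
   horodiscs then force convergence to a single boundary point. *)
Lemma centralizer_non_elliptic psi : centralizer phi psi -> ~ eq_on_disc psi id_disc -> non_elliptic psi.
Proof.
  intros Hp Hn. pose proof (proj1 Hp) as Hps. split; auto.
  destruct (wolff psi Hps (centralizer_no_fixed_point psi Hp Hn)) as (s & Hs & HW).
  exists s. split; auto. split. lra.
  assert (HWn : forall n z, disc z -> Cmod (s - iterate psi n z) ^ 2 * (1 - Cmod z ^ 2) <= Cmod (s - z) ^ 2 * (1 - Cmod (iterate psi n z) ^ 2)).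
  { intros n z Hz. induction n as [|n IH]. simpl; lra.
    change (iterate psi (S n) z) with (psi (iterate psi n z)).
    assert (Hd : disc (iterate psi n z)) by (apply iterate_disc; auto).
    pose proof (HW _ Hd) as H. pose proof (disc_sqr _ Hd). pose proof (disc_sqr z Hz).
    pose proof (disc_sqr _ (proj2 Hps _ Hd)).
    set (p := 1 - Cmod (iterate psi n z) ^ 2) in *. set (q := 1 - Cmod (psi (iterate psi n z)) ^ 2) in *.
    set (r := 1 - Cmod z ^ 2) in *.
    apply Rmult_le_reg_r with p; auto.
    apply Rle_trans with (Cmod (s - iterate psi n z) ^ 2 * q * r).
    - apply Rmult_le_compat_r with (r := r) in H; lra.
    - apply Rmult_le_compat_r with (r := q) in IH; lra. }
  intros z0 Hz0. pose proof Hz0 as Hz0'. unfold disc in Hz0'.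
  set (rho := (1 + Cmod z0) / 2). pose proof (Cmod_ge_0 z0) as Hz00.
  assert (Hrho : 0 < rho < 1) by (unfold rho; lra).
  assert (Hdel : 0 < (1 - Cmod z0) / 2) by lra.
  exists (mkposreal _ Hdel). intros eps. simpl.
  set (k := / (1 - rho ^ 2)). assert (Hk : 0 < k) by (apply Rinv_0_lt_compat; nra).
  pose proof (cond_pos eps) as Heps.
  (* The square of the distance to [s] is at most [4 * p * k], and [p <= 4 * (k + 1) * q] compares
     the orbit of [z] with that of 0; together they give the factor [16 * k * (k + 1)]. *)
  destruct (orbit_to_circle psi (eps ^ 2 / (16 * k * (k + 1))) Hp Hn) as (N & HN).
  { apply Rdiv_lt_0_compat; nra. }
  exists N. intros n HNn z Hz Hzd. specialize (HN n HNn).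
  assert (Hzr : Cmod z <= rho).
  { pose proof (Cmod_sub_le z z0). unfold rho. lra. }
  assert (Hdn : disc (iterate psi n z)) by (apply iterate_disc; auto).
  assert (Hd0 : disc (iterate psi n 0)) by (apply iterate_disc; auto using disc_0).
  pose proof (Cmod_ge_0 z) as Hz0p.
  assert (Hz2 : 1 - rho ^ 2 <= 1 - Cmod z ^ 2) by nra.
  assert (Hr2 : 0 < 1 - rho ^ 2) by nra.
  assert (H1 : 1 - Cmod (iterate psi n z) ^ 2 <= 4 * (k + 1) * (1 - Cmod (iterate psi n 0) ^ 2)).
  { apply dD_bounds; auto.
    eapply Rle_trans. apply (schwarz_pick (iterate psi n)); auto using disc_0.
    apply self_map_holo, self_map_iterate; auto. intros x Hx; apply iterate_disc; auto.
    unfold dD. rewrite Cmod_0. replace (z - 0)%C with z by ring.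
    replace ((1 - Cmod z ^ 2) * (1 - 0 ^ 2)) with (1 - Cmod z ^ 2) by ring.
    apply Rle_trans with (1 * / (1 - Cmod z ^ 2)).
    - apply Rmult_le_compat_r. left; apply Rinv_0_lt_compat; lra. nra.
    - rewrite Rmult_1_l. apply Rinv_le_contravar; auto. }
  pose proof (HWn n z Hz) as H2.
  assert (H3 : Cmod (s - z) ^ 2 <= 4).
  { pose proof (Cmod_minus_le s z). pose proof (Cmod_ge_0 (s - z)). unfold disc in Hz. nra. }
  pose proof (disc_sqr _ Hdn) as H4. pose proof (disc_sqr _ Hd0) as H5.
  set (p := 1 - Cmod (iterate psi n z) ^ 2) in *. set (q := 1 - Cmod (iterate psi n 0) ^ 2) in *.
  set (X := Cmod (s - iterate psi n z)) in *. assert (HX : 0 <= X) by apply Cmod_ge_0.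
  rewrite Cmod_sub_sym. fold X.
  assert (H6 : X ^ 2 * (1 - rho ^ 2) <= 4 * p).
  { apply Rle_trans with (X ^ 2 * (1 - Cmod z ^ 2)). apply Rmult_le_compat_l; auto. apply pow2_ge_0.
    eapply Rle_trans; [apply H2|]. apply Rmult_le_compat_r; lra. }
  assert (H7 : X ^ 2 <= 4 * p * k).
  { unfold k. apply (proj1 (Rle_div_r (X ^ 2) (4 * p) _ Hr2)). auto. }
  assert (H8 : 4 * p * k <= 16 * k * (k + 1) * q).
  { apply Rmult_le_compat_l with (r := 4 * k) in H1; [|lra]. lra. }
  assert (Hkk : 16 * k * (k + 1) > 0) by nra.
  apply (proj2 (Rlt_div_r q _ _ Hkk)) in HN.
  assert (X ^ 2 < eps ^ 2) by lra. nra.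
Qed.

(** * The Abel function of an upward map *)

Section Abel.
Variable g : C -> C.
Hypothesis Hg : holo uhp g.
Hypothesis Hgu : forall w, uhp w -> uhp (g w).
Hypothesis Hgb : forall w, uhp w -> g (w + b)%C = (g w + b)%C.
Hypothesis Hup : upward g.
Variable U : (nat -> Prop) -> Prop.
Hypothesis HU : ultrafilter U.

(** Relative to the orbit of [Ci] the iterates stay locally bounded by [iterate_local_bound], so the
    ultralimit exists and is holomorphic by [ulim_local]. *)
Lemma abel_function : exists ht, holo uhp ht /\
  forall w, uhp w -> ulim U (fun n => iterate g n w - iterate g n Ci)%C (ht w).
Proof.
  pose proof (hm_b _ _ _ _ HM) as Hb.
  assert (HCi : uhp Ci) by (unfold uhp; simpl; lra).
  assert (Hex : forall w, exists l, uhp w -> ulim U (fun n => iterate g n w - iterate g n Ci)%C l).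
  { intros w. destruct (classic (uhp w)) as [Hw|Hw]; [|exists 0%C; tauto].
    destruct (iterate_local_bound b Hb g Hg Hgu Hgb Hup Ci w HCi Hw) as (r & M & Hr & _ & HB).
    destruct (ulim_bound_exists U HU (fun n => iterate g n w - iterate g n Ci)%C M) as (l & Hl); eauto.
    apply uf_true; auto. intros n. apply HB, in_ball_center; auto. }
  apply choice_fun in Hex. destruct Hex as (ht & Hht). exists ht. split; auto.
  intros w Hw. destruct (iterate_local_bound b Hb g Hg Hgu Hgb Hup Ci w HCi Hw) as (r & M & Hr & Hbu & HB).
  destruct (ulim_local U HU (fun n w => iterate g n w - iterate g n Ci)%C ht w r M Hr) as (l & Hl & _); eauto.
  apply uf_true; auto. intros n. split.
  - intros x Hx. destruct (iterate_holo_uhp g Hg Hgu n x (Hbu x Hx)) as (l & Hl).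
    eexists. apply cder_minus; [apply Hl|apply cder_const].
  - intros x Hx. apply HB; auto.
Qed.

Lemma abel_shift_limit g2 a2 w : asymptotic_shift g2 a2 -> uhp w ->
  ulim U (fun n => g2 (iterate g n w) - iterate g n w)%C a2.
Proof.
  intros Ha Hw e He. destruct (Ha e He) as (Y & HY).
  destruct (iterate_unbounded b (hm_b _ _ _ _ HM) g Hg Hgb Hup w Y Hw) as (N & HN).
  apply uf_ev; auto. exists N. intros n Hn. apply HY; auto. apply iterate_uhp; auto.
Qed.

(** Commutation turns [iterate g n (g2 w)] into [g2 (iterate g n w)], which differs from
    [iterate g n w] by the drift of [g2] at a point whose height tends to infinity. *)
Lemma abel_commuting ht g2 a2 w :
  (forall w, uhp w -> ulim U (fun n => iterate g n w - iterate g n Ci)%C (ht w)) ->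
  (forall w, uhp w -> uhp (g2 w)) -> (forall w, uhp w -> g2 (g w) = g (g2 w)) -> asymptotic_shift g2 a2 ->
  uhp w -> ht (g2 w) = (ht w + a2)%C.
Proof.
  intros Hht Hg2 Hc Ha Hw.
  apply (ulim_unique U HU (fun n => iterate g n (g2 w) - iterate g n Ci)%C); auto.
  apply ulim_ext with (fun n => (iterate g n w - iterate g n Ci) + (g2 (iterate g n w) - iterate g n w))%C; auto.
  - intros n.
    assert (E : g2 (iterate g n w) = iterate g n (g2 w)).
    { induction n as [|n IH]; auto. change (g2 (g (iterate g n w)) = g (iterate g n (g2 w))).
      rewrite Hc, IH; auto. apply iterate_uhp; auto. }
    rewrite E. ring.
  - apply ulim_plus; auto. apply abel_shift_limit; auto.
Qed.
End Abel.

(** In both cases the constant that belongs to [phi] is [b]; the inequality at 0 records that it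
    does not vanish. *)
Lemma commuting_linearizable (F : (C -> C) -> Prop) : (forall psi, F psi -> centralizer phi psi) -> F phi ->
  (forall psi1 psi2, F psi1 -> F psi2 -> commute_on_disc psi1 psi2) ->
  exists h0, holo disc h0 /\ h0 (phi 0) <> h0 0 /\
    forall psi, F psi -> exists a, forall z, disc z -> h0 (psi z) = (h0 z + a)%C.
Proof.
  intros HZ Hphi Hcomm. pose proof (hm_uhp _ _ _ _ HM) as Hu. pose proof (hm_b _ _ _ _ HM) as Hb.
  destruct (classic (exists psi1, F psi1 /\ upward (G psi1))) as [(psi1 & H1 & Hup)|Hno].
  - destruct some_ultrafilter as (U & HU). pose proof (HZ psi1 H1) as Z1.
    destruct (abel_function (G psi1)) with (U := U) as (ht & Hh & Hht); auto.
    { apply (hm_G_holo _ _ _ _ HM); auto. } { intros; apply (hm_G_uhp _ _ _ _ HM); auto. } { intros; apply G_shift; auto. }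
    assert (HA : forall psi a w, F psi -> asymptotic_shift (G psi) a -> uhp w -> ht (G psi w) = (ht w + a)%C).
    { intros psi a w Hp Ha Hw. apply (abel_commuting (G psi1)) with (U := U); auto.
      - apply (hm_G_holo _ _ _ _ HM); auto.
      - intros; apply (hm_G_uhp _ _ _ _ HM); auto.
      - intros; apply G_shift; auto.
      - intros; apply (hm_G_uhp _ _ _ _ HM); auto.
      - intros; apply (hm_G_commute _ _ _ _ HM); auto. }
    exists (fun z => ht (h z)). split; [|split].
    + apply (holo_comp disc uhp h ht); auto. apply (hm_holo _ _ _ _ HM).
    + rewrite (hm_G _ _ _ _ HM) by auto using centralizer_self, disc_0.
      rewrite (HA phi b); auto using disc_0.
      * intros E. apply Hb. apply RtoC_inj. replace (RtoC b) with (ht (h 0) + b - ht (h 0))%C by ring. rewrite E. ring.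
      * intros e He. exists 0. intros w Hw _. rewrite (hm_G_phi _ _ _ _ HM) by auto.
        replace (w + b - w - b)%C with (RtoC 0) by ring. rewrite Cmod_0. auto.
    + intros psi Hp. destruct (G_asymptotic psi (HZ psi Hp)) as (a & Ha). exists a.
      intros z Hz. rewrite (hm_G _ _ _ _ HM) by auto. apply HA; auto.
  - exists h. split; [|split].
    + apply (hm_holo _ _ _ _ HM).
    + rewrite (hm_phi _ _ _ _ HM) by auto using disc_0. intros E. apply Hb. apply RtoC_inj.
      replace (RtoC b) with (h 0 + b - h 0)%C by ring. rewrite E. ring.
    + intros psi Hp. destruct (G_translation_or_upward psi (HZ psi Hp)) as [(a & Ha)|Hup].
      * exists a. intros z Hz. rewrite (hm_G _ _ _ _ HM) by auto. auto.
      * exfalso. eauto.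
Qed.

Lemma shift_iterate h0 psi c n z : self_map psi -> (forall z, disc z -> h0 (psi z) = (h0 z + c)%C) -> disc z ->
  h0 (iterate psi n z) = (h0 z + INR n * c)%C.
Proof.
  intros Hp Hc Hz. induction n as [|n IH].
  - simpl. ring.
  - change (iterate psi (S n) z) with (psi (iterate psi n z)). rewrite Hc by (apply iterate_disc; auto).
    rewrite IH, S_INR, RtoC_plus. ring.
Qed.

(* In the coordinate [ht o h] the maps [psi1^n] are asymptotically translations, so both
   [psi1 o psi2 o psi1^n] and [psi2 o psi1 o psi1^n] are close to the same univalent map near a
   noncritical point; the common linearizer [h0], injective there, then identifies them. *)
Lemma linearized_commute psi1 psi2 h0 c0 c1 c2 : centralizer phi psi1 -> centralizer phi psi2 -> upward (G psi1) ->
  holo disc h0 -> (exists x y, disc x /\ disc y /\ h0 x <> h0 y) ->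
  (forall z, disc z -> h0 (phi z) = (h0 z + c0)%C) ->
  (forall z, disc z -> h0 (psi1 z) = (h0 z + c1)%C) -> (forall z, disc z -> h0 (psi2 z) = (h0 z + c2)%C) ->
  commute_on_disc psi1 psi2.
Proof.
  intros Z1 Z2 Hup Hh0 Hnc E0 E1 E2.
  pose proof (hm_uhp _ _ _ _ HM) as Hu. pose proof (hm_b _ _ _ _ HM) as Hb. pose proof (hm_holo _ _ _ _ HM) as Hh.
  set (g := G psi1) in *.
  assert (Hg : holo uhp g) by (apply (hm_G_holo _ _ _ _ HM); auto).
  assert (Hgu : forall w, uhp w -> uhp (g w)) by (intros; apply (hm_G_uhp _ _ _ _ HM); auto).
  assert (Hgb : forall w, uhp w -> g (w + b)%C = (g w + b)%C) by (intros; apply G_shift; auto).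
  destruct some_ultrafilter as (U & HU).
  destruct (abel_function g Hg Hgu Hgb Hup U HU) as (ht & Hht & Hlim).
  assert (HCi : uhp Ci) by (unfold uhp; simpl; lra).
  pose (M := fun z => ht (h z)).
  assert (HMh : holo disc M) by (apply (holo_comp disc uhp h ht); auto).
  (* The translation by [b] commutes with [g], so the Abel function shifts by [b] under it; this
     makes [M] nonconstant. *)
  assert (HMb : M (phi 0) <> M 0).
  { unfold M. rewrite (hm_phi _ _ _ _ HM) by auto using disc_0.
    rewrite (abel_commuting g Hg Hgu Hgb Hup U HU ht (fun w => w + b)%C b (h 0%C)); auto using disc_0.
    - intros E. apply Hb. apply RtoC_inj. replace (RtoC b) with (ht (h 0) + b - ht (h 0))%C by ring. rewrite E. ring.
    - intros; apply uhp_shift; auto.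
    - intros w Hw. symmetry. auto.
    - intros e He. exists 0. intros w _ _. replace (w + b - w - b)%C with (RtoC 0) by ring. rewrite Cmod_0. auto. }
  destruct (noncritical_point h0 M Hh0 HMh Hnc) as (p & Hp & Hd0 & HdM).
  { exists (phi 0), 0%C. split; [apply Hself, disc_0|split; auto using disc_0]. }
  set (l0 := cderiv h0 p) in *. set (m := cderiv M p) in *.
  assert (Hl0 : cder h0 p l0) by (apply (cderiv_spec disc); auto).
  destruct (G_asymptotic psi1 Z1) as (a1 & Ha1). destruct (G_asymptotic psi2 Z2) as (a2 & Ha2). fold g in Ha1.
  set (a3 := (a1 + a2)%C).
  assert (Hm : cder (fun z => M z + a3)%C p m).
  { replace m with (m + 0)%C by ring. apply cder_plus. apply (cderiv_spec disc); auto. apply cder_const. }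
  assert (Hasym : forall f1 f2 b1 b2, centralizer phi f2 -> asymptotic_shift (G f1) b1 -> asymptotic_shift (G f2) b2 ->
    asymptotic_shift (fun w => G f1 (G f2 w)) (b1 + b2)).
  { intros f1 f2 b1 b2 Hf2 A1 A2 e He. destruct (A1 (e / 2) ltac:(lra)) as (Y1 & H1). destruct (A2 (e / 2) ltac:(lra)) as (Y2 & H2).
    exists (Rmax Y1 Y2). intros w Hw HY.
    pose proof (G_im_le f2 w Hf2 Hw). pose proof (Rmax_l Y1 Y2). pose proof (Rmax_r Y1 Y2).
    specialize (H2 w Hw ltac:(lra)). specialize (H1 (G f2 w) ltac:(apply (hm_G_uhp _ _ _ _ HM); auto) ltac:(lra)).
    replace (G f1 (G f2 w) - w - (b1 + b2))%C with ((G f1 (G f2 w) - G f2 w - b1) + (G f2 w - w - b2))%C by ring.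
    eapply Rle_lt_trans; [apply Cmod_triangle|]. lra. }
  pose (t := fun n => iterate g n Ci).
  assert (Hhol : forall chi n, centralizer phi chi -> holo disc (fun z => h (chi (iterate psi1 n z)) - t n)%C).
  { intros chi n Zc z Hz.
    destruct (holo_comp disc disc (fun z => chi (iterate psi1 n z)) h) with (z := z) as (l & Hl); auto.
    - apply (holo_comp disc disc (iterate psi1 n) chi); auto.
      + apply self_map_holo, self_map_iterate, Z1.
      + apply self_map_holo, Zc.
      + intros y Hy. apply iterate_disc; auto. apply Z1.
    - intros y Hy. apply Zc, iterate_disc; auto. apply Z1.
    - eexists. apply cder_minus; [apply Hl|apply cder_const]. }
  (* Stated for any [chi] acting on the half-plane as a map [P] with asymptotic shift [a3], so that
     both compositions are covered: recentred by [t n], they tend to [M + a3] and are almost linear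
     of slope [m] on a ball independent of [n]. *)
  assert (Hfam : forall chi P, centralizer phi chi -> (forall z, disc z -> h (chi z) = P (h z)) -> asymptotic_shift P a3 ->
    (forall z, disc z -> ulim U (fun n => h (chi (iterate psi1 n z)) - t n)%C (M z + a3)%C) /\
    exists s, 0 < s /\ (forall x, in_ball p s x -> disc x) /\
      U (fun n => forall x y, in_ball p s x -> in_ball p s y ->
        Cmod ((h (chi (iterate psi1 n x)) - t n) - (h (chi (iterate psi1 n y)) - t n) - m * (x - y)) <= Cmod m / 4 * Cmod (x - y))).
  { intros chi P Zc HP HA.
    assert (Hit : forall n z, disc z -> disc (iterate psi1 n z)) by (intros; apply iterate_disc; auto; apply Z1).
    assert (HE : forall n z, disc z -> (h (chi (iterate psi1 n z)) - t n)%C =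
      ((iterate g n (h z) - t n) + (P (iterate g n (h z)) - iterate g n (h z)))%C).
    { intros n z Hz. rewrite HP by auto. rewrite h_iterate_G by auto. fold g. ring. }
    assert (HL : forall z, disc z -> ulim U (fun n => h (chi (iterate psi1 n z)) - t n)%C (M z + a3)%C).
    { intros z Hz. apply ulim_ext with (fun n => (iterate g n (h z) - t n) + (P (iterate g n (h z)) - iterate g n (h z)))%C; auto.
      intros n; symmetry; apply HE; auto.
      apply ulim_plus; [auto|apply (Hlim (h z)); auto|].
      apply (abel_shift_limit g Hg Hgu Hgb Hup U HU); auto. }
    split; auto.
    destruct (iterate_local_bound b Hb g Hg Hgu Hgb Hup Ci (h p) HCi (Hu p Hp)) as (r & M1 & Hr & Hru & HB).
    pose proof (Hu p Hp) as Hup'. unfold uhp in Hup'.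
    destruct (holo_ccont disc h p Hh Hp (Rmin r (snd (h p) / 2))) as (d & Hd & Hcont). apply Rmin_pos; lra.
    destruct (open_convex_nbhd disc disc_open_convex p Hp) as (r' & Hr' & Hrd).
    set (r0 := Rmin d r'). assert (Hr0 : 0 < r0) by (apply Rmin_pos; auto).
    assert (Hin : forall x, in_ball p r0 x -> disc x /\ in_ball (h p) r (h x) /\ snd (h p) / 2 <= snd (h x)).
    { intros x Hx. assert (Hxd : Cmod (x - p) < d) by (eapply Rlt_le_trans; [apply Hx|apply Rmin_l]).
      specialize (Hcont x Hxd). split; [|split].
      - apply Hrd. eapply in_ball_le; [apply Rmin_r|apply Hx].
      - eapply Rlt_le_trans; [apply Hcont|apply Rmin_l].
      - assert (Hc2 : Cmod (h x - h p) < snd (h p) / 2) by (eapply Rlt_le_trans; [apply Hcont|apply Rmin_r]).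
        pose proof (Rabs_snd_le (h x - h p)) as H. simpl in H. apply Rle_lt_trans with (2 := Hc2) in H.
        apply Rabs_def2 in H. lra. }
    destruct (HA 1 Rlt_0_1) as (Y & HY).
    destruct (iterate_height b Hb g Hg Hgb Hup (snd (h p) / 2) ltac:(lra)) as (c & Hc & Hheight).
    destruct (archimed_cor1 (c / (Rabs Y + 1))) as (N & HN & HN0). { apply Rdiv_lt_0_compat; auto. pose proof (Rabs_pos Y). lra. }
    assert (HNp : 0 < INR N) by (apply lt_0_INR; auto).
    assert (HNc : Y < INR N * c).
    { pose proof (Rabs_pos Y). pose proof (Rle_abs Y).
      assert (Rabs Y + 1 < INR N * c); [|lra].
      apply Rmult_lt_reg_l with (/ INR N). apply Rinv_0_lt_compat; auto.
      rewrite <- Rmult_assoc, Rinv_l, Rmult_1_l by lra.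
      apply Rmult_lt_compat_r with (r := Rabs Y + 1) in HN; [|lra].
      replace (c / (Rabs Y + 1) * (Rabs Y + 1)) with c in HN by (field; lra). lra. }
    destruct (ulim_two_points U HU (fun n z => h (chi (iterate psi1 n z)) - t n)%C (fun z => M z + a3)%C p r0 (M1 + (Cmod a3 + 1)) m (Cmod m / 4) Hr0)
      as (s & Hs & Hsr & HS); auto.
    - apply Cmod_gt_0 in HdM. lra.
    - apply uf_ev; auto. exists N. intros n Hn. split.
      + intros x Hx. destruct (Hin x Hx) as (Hxd & _ & _).
        apply (Hhol chi n Zc); auto.
      + intros x Hx. destruct (Hin x Hx) as (Hxd & Hxb & Hxs). rewrite HE by auto.
        eapply Rle_trans; [apply Cmod_triangle|]. apply Rplus_le_compat. apply HB; auto.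
        assert (Hge : Y <= snd (iterate g n (h x))).
        { destruct (Hheight n (h x) Hxs) as [H _]. apply le_INR in Hn. nra. }
        specialize (HY (iterate g n (h x)) (iterate_uhp g Hgu n _ (Hu x Hxd)) Hge).
        pose proof (Cmod_sub_le (P (iterate g n (h x)) - iterate g n (h x)) a3). lra.
    - intros x Hx. apply HL. apply Hin; auto.
    - exists s. split; auto. split; auto. intros x Hx. apply (Hin x). eapply in_ball_le; [apply Hsr|apply Hx]. }
  pose (chi1 := compose psi1 psi2). pose (chi2 := compose psi2 psi1).
  assert (Zc1 : centralizer phi chi1) by (apply centralizer_compose; auto).
  assert (Zc2 : centralizer phi chi2) by (apply centralizer_compose; auto).
  assert (Hcomp : forall f1 f2 z, centralizer phi f1 -> centralizer phi f2 -> disc z -> h (compose f1 f2 z) = G f1 (G f2 (h z))).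
  { intros f1 f2 z F1 F2 Hz. unfold compose. rewrite (hm_G _ _ _ _ HM) by (auto; apply F2; auto).
    rewrite (hm_G _ _ _ _ HM); auto. }
  destruct (Hfam chi1 (fun w => G psi1 (G psi2 w)) Zc1) as (L1 & s1 & Hs1 & Hs1d & HS1).
  { intros; apply Hcomp; auto. } { apply Hasym; auto. }
  destruct (Hfam chi2 (fun w => G psi2 (G psi1 w)) Zc2) as (L2 & s2 & Hs2 & Hs2d & HS2).
  { intros; apply Hcomp; auto. } { unfold a3. rewrite Cplus_comm. apply Hasym; auto. }
  assert (Hinj : exists s, 0 < s /\ forall x y, in_ball p s x -> in_ball p s y -> h0 x = h0 y -> x = y).
  { destruct (holo_ccont disc h0 p Hh0 Hp 1 Rlt_0_1) as (d & Hd & Hcont).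
    destruct (open_convex_nbhd disc disc_open_convex p Hp) as (r' & Hr' & Hrd).
    assert (Hr0 : 0 < Rmin d r') by (apply Rmin_pos; auto).
    apply Cmod_gt_0 in Hd0 as Hd0p.
    destruct (ulim_two_points U HU (fun _ => h0) h0 p (Rmin d r') (Cmod (h0 p) + 1) l0 (Cmod l0 / 2) Hr0) as (s & Hs & _ & HS); auto; try lra.
    - apply uf_true; auto. intros _. split.
      + intros x Hx. apply Hh0, Hrd. eapply in_ball_le; [apply Rmin_r|apply Hx].
      + intros x Hx. assert (Hxd : Cmod (x - p) < d) by (eapply Rlt_le_trans; [apply Hx|apply Rmin_l]).
        specialize (Hcont x Hxd). pose proof (Cmod_sub_le (h0 x) (h0 p)). lra.
    - intros w _. apply ulim_const; auto.
    - exists s. split; auto. destruct (uf_ex U HU _ HS) as (_ & H). intros x y Hx Hy E.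
      specialize (H x y Hx Hy). rewrite E in H.
      replace (h0 y - h0 y - l0 * (x - y))%C with (- (l0 * (x - y)))%C in H by ring.
      rewrite Cmod_opp, Cmod_mult in H. apply Cmod_eq_sub. pose proof (Cmod_ge_0 (x - y)). nra. }
  destruct Hinj as (s3 & Hs3 & Hinj).
  set (s := Rmin s1 (Rmin s2 s3)). assert (Hs : 0 < s) by (repeat apply Rmin_pos; auto).
  assert (Hss1 : s <= s1) by apply Rmin_l.
  assert (Hss2 : s <= s2) by (unfold s; eapply Rle_trans; [apply Rmin_r|apply Rmin_l]).
  assert (Hss3 : s <= s3) by (unfold s; eapply Rle_trans; [apply Rmin_r|apply Rmin_r]).
  apply Cmod_gt_0 in HdM as HmP.
  (* Four errors of this size, two from the linear approximation at distance [s / 4] and two from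
     the limits at [p], add up to the tolerance [Cmod m * s / 4] of [small_solution]. *)
  assert (He : 0 < Cmod m * s / 16) by (apply Rdiv_lt_0_compat; [apply Rmult_lt_0_compat; auto|lra]).
  destruct (uf_ex U HU _ (uf_and U HU _ _ (uf_and U HU _ _ HS1 HS2) (uf_and U HU _ _ (L1 p Hp _ He) (L2 p Hp _ He))))
    as (n & (T1 & T2) & Q1 & Q2).
  assert (Hit : forall z, disc z -> disc (iterate psi1 n z)) by (intros; apply iterate_disc; auto; apply Z1).
  set (A := fun z => (h (chi1 (iterate psi1 n z)) - t n)%C) in *.
  set (B := fun z => (h (chi2 (iterate psi1 n z)) - t n)%C) in *.
  assert (Hpc : forall r, 0 < r -> in_ball p r p) by (intros; apply in_ball_center; auto).
  (* The equation [B x' = A x] is solved in the ball [in_ball p s]. The value of [h0] at both images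
     is shifted by the same constants of [psi1] and [psi2], only in a different order, so
     [h0 x' = h0 x] and injectivity of [h0] gives [x' = x]. *)
  assert (Hkey : forall x, in_ball p (s / 4) x -> A x = B x).
  { intros x Hx. pose proof Hx as Hx'. unfold in_ball in Hx'.
    assert (Hx1 : in_ball p s1 x) by (eapply in_ball_le; [|apply Hx]; lra).
    assert (Hx2 : in_ball p s2 x) by (eapply in_ball_le; [|apply Hx]; lra).
    assert (HAB : Cmod (B x - A x) <= Cmod m * s / 4).
    { specialize (T1 x p Hx1 (Hpc s1 Hs1)). specialize (T2 x p Hx2 (Hpc s2 Hs2)). fold (A x) (A p) in T1. fold (B x) (B p) in T2.
      replace (B x - A x)%C with (((B x - B p - m * (x - p)) - (A x - A p - m * (x - p))) + ((B p - (M p + a3)) - (A p - (M p + a3))))%C by ring.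
      eapply Rle_trans; [apply Cmod_triangle|].
      pose proof (Cmod_minus_le (B x - B p - m * (x - p)) (A x - A p - m * (x - p))).
      pose proof (Cmod_minus_le (B p - (M p + a3)) (A p - (M p + a3))).
      change (Cmod (A p - (M p + a3)) < Cmod m * s / 16) in Q1. change (Cmod (B p - (M p + a3)) < Cmod m * s / 16) in Q2.
      assert (Cmod m / 4 * Cmod (x - p) <= Cmod m * s / 16) by nra. lra. }
    destruct (small_solution B p m s x (A x)) as (x' & Hx'b & Ex); auto.
    { intros y z Hy Hz. apply T2; eapply in_ball_le; eauto. }
    assert (Hxd : disc x) by (apply Hs1d; auto).
    assert (Hxd' : disc x') by (apply Hs2d; eapply in_ball_le; eauto).
    assert (Eh : h (chi2 (iterate psi1 n x')) = h (chi1 (iterate psi1 n x))).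
    { unfold A, B in Ex. replace (h (chi2 (iterate psi1 n x'))) with (h (chi2 (iterate psi1 n x')) - t n + t n)%C by ring.
      rewrite Ex. ring. }
    assert (D1 : disc (chi1 (iterate psi1 n x))) by (apply Zc1; auto).
    assert (D2 : disc (chi2 (iterate psi1 n x'))) by (apply Zc2; auto).
    (* Equal values under [h] identify the two points only after [k] steps of [phi]; these steps add
       [INR k * c0] to [h0] on both sides, which cancels. *)
    destruct (hm_eventually _ _ _ _ HM _ _ D2 D1 Eh) as (k & Ek). apply (f_equal h0) in Ek.
    rewrite !(shift_iterate h0 phi c0) in Ek by auto.
    assert (Ek' : h0 (chi2 (iterate psi1 n x')) = h0 (chi1 (iterate psi1 n x))).
    { replace (h0 (chi2 (iterate psi1 n x'))) with (h0 (chi2 (iterate psi1 n x')) + INR k * c0 - INR k * c0)%C by ring.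
      rewrite Ek. ring. }
    unfold chi1, chi2, compose in Ek'.
    rewrite E2 in Ek' by (apply Z1; auto). rewrite E1 in Ek' by auto. rewrite (E1 (psi2 _)) in Ek' by (apply Z2; auto).
    rewrite E2 in Ek' by auto. rewrite !(shift_iterate h0 psi1 c1) in Ek' by (auto; apply Z1).
    assert (Exx : x' = x).
    { apply Hinj. eapply in_ball_le; eauto. eapply in_ball_le; [|apply Hx]; lra.
      replace (h0 x') with (h0 x' + INR n * c1 + c1 + c2 - (INR n * c1 + c1 + c2))%C by ring. rewrite Ek'. ring. }
    rewrite <- Ex, Exx. auto. }
  pose proof (Hhol chi1 n Zc1) as HA. pose proof (Hhol chi2 n Zc2) as HB. fold A in HA. fold B in HB.
  assert (Hall : forall z, disc z -> (A z - B z)%C = 0).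
  { apply (identity_theorem disc (fun z => A z - B z)%C p); auto using disc_open_convex.
    - intros z Hz. destruct (HA z Hz) as (lA & HlA). destruct (HB z Hz) as (lB & HlB). eexists. apply cder_minus; eauto.
    - apply zeros_cluster_near with (s / 4). lra. intros z Hz. rewrite Hkey by auto. ring. }
  pose proof (centralizer_iterate phi psi1 n Z1) as Zn.
  (* Equality of [A] and [B] is equality after [h], hence equality of the maps composed with
     [iterate psi1 n]; the identity theorem then removes the iterate. *)
  assert (Hfaith : eq_on_disc (compose chi1 (iterate psi1 n)) (compose chi2 (iterate psi1 n))).
  { apply (hm_faithful _ _ _ _ HM); auto using centralizer_compose.
    intros z Hz. unfold compose at 1 2.
    replace (h (chi1 (iterate psi1 n z))) with (A z - B z + B z + t n)%C by (unfold A; ring).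
    rewrite Hall by auto. unfold B. ring. }
  intros z Hz. apply (identity_after_centralizer phi (iterate psi1 n) chi1 chi2 0 1); auto using self_map_holo, disc_0.
  - apply self_map_holo, Zc1.
  - apply self_map_holo, Zc2.
  - intros w Hw. apply Hfaith. unfold in_ball in Hw. unfold disc. replace w with (w - 0)%C by ring. auto.
Qed.

(** If one of the two maps acts upward, [linearized_commute] applies, up to exchanging their roles;
    two translations commute, and [hm_faithful] lifts this to the disc. *)
Lemma linearizable_commuting psi1 psi2 h0 c0 c1 c2 : centralizer phi psi1 -> centralizer phi psi2 ->
  holo disc h0 -> (exists x y, disc x /\ disc y /\ h0 x <> h0 y) ->
  (forall z, disc z -> h0 (phi z) = (h0 z + c0)%C) ->
  (forall z, disc z -> h0 (psi1 z) = (h0 z + c1)%C) -> (forall z, disc z -> h0 (psi2 z) = (h0 z + c2)%C) ->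
  commute_on_disc psi1 psi2.
Proof.
  intros Z1 Z2 Hh0 Hnc E0 E1 E2. pose proof (hm_uhp _ _ _ _ HM) as Hu.
  destruct (G_translation_or_upward psi1 Z1) as [(a1 & A1)|U1].
  2: { apply (linearized_commute psi1 psi2 h0 c0 c1 c2); auto. }
  destruct (G_translation_or_upward psi2 Z2) as [(a2 & A2)|U2].
  2: { pose proof (linearized_commute psi2 psi1 h0 c0 c2 c1 Z2 Z1 U2 Hh0 Hnc E0 E2 E1) as H.
       intros z Hz. symmetry. apply H; auto. }
  apply (hm_faithful _ _ _ _ HM); auto using centralizer_compose.
  intros z Hz. unfold compose.
  assert (D1 := proj2 (proj1 Z1) z Hz). assert (D2 := proj2 (proj1 Z2) z Hz).
  rewrite (hm_G _ _ _ _ HM psi1 (psi2 z)), (hm_G _ _ _ _ HM psi2 (psi1 z)), A1, A2 by auto.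
  rewrite (hm_G _ _ _ _ HM psi2 z), (hm_G _ _ _ _ HM psi1 z), A1, A2 by auto. ring.
Qed.

End Centralizer.

Theorem theorem4p11 :
  forall (phi : C -> C) (Delta : (C -> C) -> Prop),
    parabolic phi ->
    positive_hyperbolic_step phi ->
    (exists psi, Delta psi) ->
    (forall psi, Delta psi -> centralizer phi psi) ->
    ((forall psi1 psi2, Delta psi1 -> Delta psi2 -> commute_on_disc psi1 psi2)
     <->
     simultaneous_linearization (fun psi => Delta psi \/ psi = phi)).
Proof.
  intros phi Delta Hpar Hstep _ HZ.
  destruct (hyperbolic_model_exists phi Hpar Hstep) as (h & b & G & HM).
  destruct Hpar as (Hself & tau & HDW & Htau & _).
  assert (Hfix : forall z, disc z -> phi z <> z) by (intros z Hz; apply DW_no_fixed_point with tau; auto).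
  assert (HZ' : forall psi, Delta psi \/ psi = phi -> centralizer phi psi).
  { intros psi [H| ->]; auto using centralizer_self. }
  split.
  - intros Hcomm. split.
    + split.
      * intros psi Hpsi. pose proof (HZ' psi Hpsi) as Zp. split. apply Zp.
        destruct (classic (eq_on_disc psi id_disc)) as [|Hn]; auto. left.
        apply (centralizer_non_elliptic phi h b G Hself HM psi Zp Hn).
      * exists phi. split; auto. intros E. apply (Hfix 0 disc_0). apply (E 0 disc_0).
    + destruct (commuting_linearizable phi h b G Hself HM (fun psi => Delta psi \/ psi = phi)) as (h0 & Hh0 & Hn & Hsh); auto.
      { intros p q [Hp| ->] [Hq| ->]; auto.
        - apply HZ; auto.
        - intros z Hz. symmetry. apply (HZ q Hq); auto.
        - intros z _; reflexivity. }
      (* Evaluation at 0 determines the constant, so it can be written down without a choice. *)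
      exists h0, (fun psi => h0 (psi 0) - h0 0)%C. split; [|split].
      * apply holomorphic_iff; auto.
      * exists phi. split; auto. intros E. apply Hn. apply Cmod_eq_sub. rewrite E. apply Cmod_0.
      * intros psi Hpsi z Hz. destruct (Hsh psi Hpsi) as (a & Ha). unfold compose.
        rewrite (Ha z Hz), (Ha 0 disc_0). ring.
  - intros (_ & h0 & c & Hh0 & (psi & Hpsi & Hc) & Hlin) psi1 psi2 H1 H2.
    apply holomorphic_iff in Hh0.
    apply (linearizable_commuting phi h b G Hself Hfix HM psi1 psi2 h0 (c phi) (c psi1) (c psi2)); auto.
    (* A member of the family with nonzero constant keeps [h0] from being constant. *)
    + exists (psi 0), 0%C. split. apply (HZ' psi Hpsi), disc_0. split; auto using disc_0.
      intros E. apply Hc. pose proof (Hlin psi Hpsi 0 disc_0) as HL. unfold compose in HL. rewrite E in HL.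
      replace (c psi) with (h0 0 + c psi - h0 0)%C by ring. rewrite <- HL. ring.
    + intros z Hz. apply (Hlin phi); auto.
    + intros z Hz. apply (Hlin psi1); auto.
    + intros z Hz. apply (Hlin psi2); auto.
Qed.
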